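(* Let $p$ be a prime, $m\geq 3$ an odd integer, $q=p^m$, and let $a\in\mathbf{F}_q^*$ be a $(p^{(m-1)/2}-1)$-th power in $\mathbf{F}_q^*$. Then the curve $C_m$ defined over $\mathbf{F}_q$ by the equation $$y^{q-1}=-\frac{\big(x^{p^{(m+1)/2}}-a^{p^{(m+1)/2}}x\big)^{p^{(m-1)/2}}}{a x^{p^{(m-1)/2}}-x}$$ has genus $$g(C_m)=\frac{1}{2}\Big\{\big(p^{(m+1)/2}+p^{(m-1)/2}-p-1\big)(q-2)-p^2+p+2\Big\}$$ and has the following number of $\mathbf{F}_q$-rational points: $$\#C_m(\mathbf{F}_q)=\begin{cases}(q-1)(q-p) & \text{for odd } p,\\ (q-1)(q-p)+3 & \text{for } p=2.\end{cases}$$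
   Context: $\mathbf{F}_q$ is the finite field with $q=p^m$ elements. The curve ''defined by'' an affine equation $y^{q-1}=f(x)$ with $f\in\mathbf{F}_q(x)$ means the non-singular complete irreducible curve over $\mathbf{F}_q$ with function field $\mathbf{F}_q(x,y)$, $y^{q-1}=f(x)$. *)

(* Defs.v *)
From HB Require Import structures.
From mathcomp Require Import all_boot all_order all_algebra all_field.
From mathcomp Require Import boolp classical_sets functions cardinality fsbigop.

Set Implicit Arguments.
Unset Strict Implicit.
Unset Printing Implicit Defensive.

Import Order.TTheory GRing.Theory Num.Theory.
Local Open Scope classical_set_scope.
Local Open Scope ring_scope.

(* A nonsingular complete irreducible curve over K is handled through its
   function field F, given as a field with an embedding iota of the
   constants K.  Its closed points are the places of F over K, that is, the
   normalized discrete valuations of F that are trivial on K.  *)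

(* The value at 0, morally +oo, is set to 0, so that a valuation is
   determined by its restriction to the nonzero elements. *)
Definition discrete_valuation (K F : fieldType) (iota : {rmorphism K -> F})
    (v : F -> int) : Prop :=
  [/\ v 0 = 0,
      forall c : K, c != 0 -> v (iota c) = 0,
      forall z w : F, z != 0 -> w != 0 -> v (z * w) = v z + v w,
      forall z w : F, z != 0 -> w != 0 -> z + w != 0 ->
        Num.min (v z) (v w) <= v (z + w)
    & exists t : F, v t = 1].

Record place (K F : fieldType) (iota : {rmorphism K -> F}) : Type := Place {
  place_ord :> F -> int;
  place_ordP : discrete_valuation iota place_ord }.

HB.instance Definition _ (K F : fieldType) (iota : {rmorphism K -> F}) :=
  gen_eqMixin (place iota).
HB.instance Definition _ (K F : fieldType) (iota : {rmorphism K -> F}) :=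
  gen_choiceMixin (place iota).

(* b is a family of elements of V whose classes form a K-basis of V / W. *)
Definition quotient_basis (K F : fieldType) (iota : {rmorphism K -> F})
    (V W : set F) (d : nat) (b : 'I_d -> F) : Prop :=
  (forall i, V (b i)) /\
  forall z, V z ->
    exists! c : 'rV[K]_d, W (z - \sum_(i < d) iota (c 0 i) * b i).

(* dim_K (V / W) for K-subspaces W of V; it is 0 in infinite dimension. *)
Definition quotient_dim (K F : fieldType) (iota : {rmorphism K -> F})
    (V W : set F) : nat :=
  xget 0%N [set d | exists b : 'I_d -> F, quotient_basis iota V W b].

Definition valuation_ring (K F : fieldType) (iota : {rmorphism K -> F})
    (P : place iota) : set F := [set z | z = 0 \/ 0 <= P z].

Definition valuation_ideal (K F : fieldType) (iota : {rmorphism K -> F})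
    (P : place iota) : set F := [set z | z = 0 \/ 0 < P z].

Definition place_deg (K F : fieldType) (iota : {rmorphism K -> F})
    (P : place iota) : nat :=
  quotient_dim iota (valuation_ring P) (valuation_ideal P).

Definition divisor (K F : fieldType) (iota : {rmorphism K -> F}) :
    set (place iota -> int) :=
  [set D | finite_set [set P | D P != 0]].
Arguments divisor {K F} iota _.

Definition divisor_deg (K F : fieldType) (iota : {rmorphism K -> F})
    (D : place iota -> int) : int :=
  \sum_(P \in [set: place iota]) D P * (place_deg P)%:Z.

Definition riemann_roch_space (K F : fieldType) (iota : {rmorphism K -> F})
    (D : place iota -> int) : set F :=
  [set z | z = 0 \/ forall P : place iota, - D P <= P z].

Definition riemann_roch_dim (K F : fieldType) (iota : {rmorphism K -> F})
    (D : place iota -> int) : nat :=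
  quotient_dim iota (riemann_roch_space D) [set 0].

(* The maximum of deg D - l(D) + 1 over all divisors D; K is meant to be
   algebraically closed in F. *)
Definition genus (K F : fieldType) (iota : {rmorphism K -> F}) : int :=
  let S := [set divisor_deg D - (riemann_roch_dim D)%:Z + 1
             | D in divisor iota] in
  xget 0 (S `&` ubound S).

(* The K-rational points are the places of degree one. *)
Definition rational_points (K F : fieldType) (iota : {rmorphism K -> F}) :
    set (place iota) :=
  [set P | place_deg P = 1%N].
Arguments rational_points {K F} iota _.

(* The embedding of K in a finite extension L of the rational function field
   K(x) := {fraction {poly K}}. *)
Definition constants (K : fieldType) (L : fieldExtType {fraction {poly K}}) :
    {rmorphism K -> L} :=
  (in_alg L \o (@FracField.tofrac {poly K} \o @polyC K)) : {rmorphism K -> L}.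

(* With h = (m - 1) / 2 and h' = (m + 1) / 2, the element
     - (x^(p^h') - a^(p^h') x)^(p^h) / (a x^(p^h) - x)   of K(x). *)
Definition curve_rhs (K : fieldType) (p m : nat) (a : K) :
    {fraction {poly K}} :=
  let h := ((m - 1) %/ 2)%N in
  let h' := ((m + 1) %/ 2)%N in
  let x := FracField.tofrac ('X : {poly K}) in
  let A := FracField.tofrac (a%:P : {poly K}) in
  - ((x ^+ (p ^ h') - A ^+ (p ^ h') * x) ^+ (p ^ h) / (A * x ^+ (p ^ h) - x)).

(* Main.v *)
Require Import Defs.
From HB Require Import structures.
From mathcomp Require Import all_boot all_order all_algebra all_field.
From mathcomp Require Import boolp classical_sets functions cardinality fsbigop.
From mathcomp Require Import finmap zify ring lra.

Set Implicit Arguments.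
Unset Strict Implicit.
Unset Printing Implicit Defensive.

Import Order.TTheory GRing.Theory Num.Theory.
Local Open Scope classical_set_scope.
Local Open Scope card_scope.
Local Open Scope ring_scope.

(* Write h = (m - 1) / 2, a = b^(p^h - 1) and u = b x.  The equation becomes
     y^(q - 1) = f,   f = - (u^(p^(h+1)) - u)^(p^h) / (u^(p^h) - u)
                        = (u^(p^h) - u^q) / (u^(p^h) - u).
   In a Kummer extension y^n = f with n = q - 1, the space L(D) of a divisor D
   pulled back from K(x) is the direct sum of the y^i L(D_i) with explicit
   divisors D_i of K(x), so that
     2 g - 2 = - 2 n + sum over b of (n - gcd(n, b(f))) deg b.
   The polynomials u^(p^k) - u are separable, and the common zeros of those for
   k = h + 1 and k = h are the zeros of u^p - u; hence the gcd is p - 1 at these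
   zeros and at infinity, 1 at the other zeros of either polynomial, and n elsewhere.

   A rational place of L lies above infinity or above a point x = c.  If u(c)^p
   differs from u(c) then f = 1 at c, and there are n rational places above c.
   At the p other points and at infinity, f is - s^(p-1) times a function that is 1
   there.  For odd p the number n / (p - 1) is odd, so y^n = f would force
   (-1)^(n/(p-1)) = 1 at a rational place, and there is none; for p = 2 the gcd is 1
   and there is exactly one. *)

(** The genus is a maximum over all divisors, while the decomposition into components only reaches
    divisors pulled back from K(x). Monotonicity closes the gap: adding a place never decreases deg
    D - l(D), and every D lies below a pullback with enough poles above infinity, where Riemann-Roch
    on K(x) gives deg - l the same constant value each time. The splitting rests on K containing all
    n-th roots of unity: each c in K^* gives an automorphism y -> c y, and since K^* has order -1 in
    K, projecting onto a component is minus a sum over K^*. Independence of the powers of y comes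
    from a place b of K(x) with b(f) prime to n; one exists because u^(p^(h+1)) - u has more zeros,
    counted with degree, than u^p - u. Since points are valuations, places above a given place have
    to be constructed, which is done with Chevalley's maximal subrings. Degrees and ramification
    indices are then read off from Galois-stable ideals attached to a whole fiber. *)

(** * Dimensions of quotients of K-subspaces of a field *)

Section QuotientDimension.
Variables (K F : fieldType) (iota : {rmorphism K -> F}).
Implicit Types (V W U A B : set F).

Definition subspace V :=
  [/\ V 0, forall z w, V z -> V w -> V (z + w) & forall c z, V z -> V (iota c * z)].

Definition lincomb d (c : 'rV[K]_d) (b : 'I_d -> F) : F :=
  \sum_(i < d) iota (c 0 i) * b i.

Definition has_quotient_dim V W d := exists b : 'I_d -> F, quotient_basis iota V W b.

Definition independent_mod V W d (b : 'I_d -> F) :=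
  (forall i, V (b i)) /\ forall c, W (lincomb c b) -> c = 0.

Lemma subspaceN V z : subspace V -> V z -> V (- z).
Proof. by case=> _ _ VZ Vz; have := VZ (-1) z Vz; rewrite rmorphN rmorph1 mulN1r. Qed.

Lemma subspaceB V z w : subspace V -> V z -> V w -> V (z - w).
Proof. by move=> sV Vz Vw; case: (sV) => _ VD _; apply: VD => //; apply: subspaceN. Qed.

Lemma subspace_lincomb V d (c : 'rV[K]_d) b :
  subspace V -> (forall i, V (b i)) -> V (lincomb c b).
Proof.
by move=> [V0 VD VZ] Vb; apply: (big_ind V) => // i _; apply: VZ.
Qed.

Lemma subspaceI V W : subspace V -> subspace W -> subspace (V `&` W).
Proof.
move=> [V0 VD VZ] [W0 WD WZ]; split=> [//|z w [? ?] [? ?]|c z [? ?]].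
  by split; [apply: VD | apply: WD].
by split; [apply: VZ | apply: WZ].
Qed.

Lemma lincombB d (c c' : 'rV[K]_d) b : lincomb (c - c') b = lincomb c b - lincomb c' b.
Proof.
rewrite /lincomb -sumrB; apply: eq_bigr => i _.
by rewrite !mxE rmorphB mulrBl.
Qed.

Lemma lincomb0 d (b : 'I_d -> F) : lincomb 0 b = 0.
Proof. by rewrite /lincomb big1 // => i _; rewrite mxE rmorph0 mul0r. Qed.

Lemma lincombZ d k (c : 'rV[K]_d) b : lincomb (k *: c) b = iota k * lincomb c b.
Proof.
by rewrite /lincomb mulr_sumr; apply: eq_bigr => i _; rewrite !mxE rmorphM mulrA.
Qed.

Lemma lincomb_mulmx k d (c : 'rV[K]_k) (M : 'M[K]_(k, d)) b :
  lincomb (c *m M) b = lincomb c (fun i => lincomb (row i M) b).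
Proof.
rewrite /lincomb; under eq_bigr do rewrite mxE rmorph_sum mulr_suml.
rewrite exchange_big; apply: eq_bigr => i _ /=.
rewrite mulr_sumr; apply: eq_bigr => j _.
by rewrite !mxE rmorphM mulrA.
Qed.

Lemma lincomb_row_mx d1 d2 (c1 : 'rV[K]_d1) (c2 : 'rV[K]_d2) b :
  lincomb (row_mx c1 c2) b =
  lincomb c1 (fun i => b (lshift d2 i)) + lincomb c2 (fun i => b (rshift d1 i)).
Proof.
rewrite /lincomb big_split_ord /=.
by congr (_ + _); apply: eq_bigr => i _; rewrite ?row_mxEl ?row_mxEr.
Qed.

(** Uniqueness of the coordinates of 0 already gives independence: if the combination c lies in W,
    then 0 and -c are both coordinates of 0. Conversely, two coordinate vectors of z differ by a
    combination in W. *)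
Lemma quotient_basisP V W d (b : 'I_d -> F) : subspace V -> subspace W ->
  quotient_basis iota V W b <->
  independent_mod V W b /\ forall z, V z -> exists c, W (z - lincomb c b).
Proof.
move=> [V0 _ _] sW; split=> [[Vb Hb]|[[Vb bI] bS]].
  split; last by move=> z /Hb [c [Wc _]]; exists c.
  split=> // c Wc; have [c0 [_ c0U]] := Hb 0 V0.
  have e0 : c0 = 0 by apply: c0U; rewrite -/(lincomb _ _) lincomb0 subr0; case: sW.
  have ec : c0 = - c.
    by apply: c0U; rewrite -/(lincomb _ _) -[- c]sub0r lincombB lincomb0 !sub0r opprK.
  by rewrite -[c]opprK -ec e0 oppr0.
split=> // z /bS [c Wc]; exists c; split=> // c' Wc'.
apply/eqP; rewrite -subr_eq0; apply/eqP/bI; rewrite lincombB.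
have -> : lincomb c b - lincomb c' b = (z - lincomb c' b) - (z - lincomb c b) by ring.
exact: subspaceB.
Qed.

(** The coordinates of the [b' i] form a k by d matrix. A vector in its left kernel gives a
    combination of the [b' i] lying in W, hence is zero, so the rank is k. *)
Lemma independent_mod_leq V W d k (b : 'I_d -> F) (b' : 'I_k -> F) :
  subspace V -> subspace W ->
  quotient_basis iota V W b -> independent_mod V W b' -> (k <= d)%N.
Proof.
move=> sV sW /(quotient_basisP b sV sW) [_ bS] [Vb' b'I].
have [M HM] : {M : 'I_k -> 'rV[K]_d & forall i, W (b' i - lincomb (M i) b)}.
  exact: (boolp.choice (fun i => bS _ (Vb' i))).
have : row_free (\matrix_i M i).
  rewrite -kermx_eq0; apply/eqP/row_matrixP => i.
  rewrite row0; apply: b'I.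
  set c := row i _; have cM : c *m (\matrix_i M i) = 0.
    by apply/sub_kermxP; exact: row_sub.
  have -> : lincomb c b' = lincomb c (fun i => b' i - lincomb (M i) b).
    have := lincomb_mulmx c (\matrix_i M i) b; rewrite cM lincomb0 => e.
    rewrite /lincomb; under [RHS]eq_bigr do rewrite mulrBr.
    rewrite sumrB -[LHS]subr0; congr (_ - _); apply: (etrans e).
    by apply: eq_bigr => j _; rewrite rowK.
  exact: subspace_lincomb.
by rewrite /row_free => /eqP <-; exact: rank_leq_col.
Qed.

Lemma has_quotient_dim_uniq V W d d' : subspace V -> subspace W ->
  has_quotient_dim V W d -> has_quotient_dim V W d' -> d = d'.
Proof.
move=> sV sW [b Hb] [b' Hb']; apply/eqP; rewrite eqn_leq.
have [Ib _] := (quotient_basisP b sV sW).1 Hb.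
have [Ib' _] := (quotient_basisP b' sV sW).1 Hb'.
by rewrite (independent_mod_leq _ _ Hb Ib') // (independent_mod_leq _ _ Hb' Ib).
Qed.

Lemma quotient_dimE V W d : subspace V -> subspace W ->
  has_quotient_dim V W d -> quotient_dim iota V W = d.
Proof.
move=> sV sW H; rewrite /quotient_dim; case: xgetP => [d' -> /= Hd'|/(_ d)//].
exact: has_quotient_dim_uniq Hd' H.
Qed.

(** [quotient_dim] has a default value in infinite dimension, so a basis must be exhibited. Once
    independent families have bounded size, a longest one spans. *)
Lemma has_quotient_dim_bounded V W N : subspace V -> subspace W ->
  (forall k (b : 'I_k -> F), independent_mod V W b -> (k <= N)%N) ->
  exists2 d, (d <= N)%N & has_quotient_dim V W d.
Proof.
move=> sV sW HN.
have ex0 : exists k, `[< exists b : 'I_k -> F, independent_mod V W b >].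
  exists 0%N; apply/asboolP; exists (fun=> 0); split=> [[]//|c _].
  by apply/rowP => - [].
have bnd k : `[< exists b : 'I_k -> F, independent_mod V W b >] -> (k <= N)%N.
  by move=> /asboolP [b]; apply: HN.
case: (ex_maxnP ex0 bnd) => d /asboolP [b [Vb bI]] dmax.
exists d; first by apply: HN; split; eauto.
exists b; apply/quotient_basisP => //; split=> // z Vz.
apply: contrapT => nz.
pose b' (i : 'I_(d + 1)) := match fintype.split i with inl j => b j | inr _ => z end.
have: (d + 1 <= d)%N; last by rewrite addn1 ltnn.
apply: dmax; apply/asboolP; exists b'; split=> [i|c].
  by rewrite /b'; case: fintype.split.
rewrite -[c]hsubmxK; set c1 := lsubmx c; set c2 := rsubmx c.
rewrite lincomb_row_mx.
have -> : lincomb c1 (fun i => b' (lshift 1 i)) = lincomb c1 b.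
  by apply: eq_bigr => i _; rewrite /b' (unsplitK (inl i)).
have -> : lincomb c2 (fun i => b' (rshift d i)) = iota (c2 0 0) * z.
  by rewrite /lincomb big_ord1 /b' (unsplitK (inr 0)).
move=> Wc; have [c20|c2n0] := eqVneq (c2 0 0) 0.
  have -> : c2 = 0 by apply/rowP => i; rewrite ord1 c20 mxE.
  rewrite c20 rmorph0 mul0r addr0 in Wc.
  by rewrite (bI _ Wc) row_mx0.
case: nz; exists (- (c2 0 0)^-1 *: c1); rewrite lincombZ.
have [_ _ WZ] := sW; have := WZ (c2 0 0)^-1 _ Wc; congr W.
rewrite mulrDr mulrA -rmorphM mulVf // rmorph1 mul1r rmorphN mulNr opprK.
by rewrite addrC.
Qed.

Lemma has_quotient_dim_chain V W U d1 d2 :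
  subspace V -> subspace W -> subspace U -> W `<=` V -> U `<=` W ->
  has_quotient_dim V W d1 -> has_quotient_dim W U d2 ->
  has_quotient_dim V U (d1 + d2).
Proof.
move=> sV sW sU WV UW [b1 /quotient_basisP[] // [Vb1 b1I] b1S].
move=> [b2 /quotient_basisP[] // [Wb2 b2I] b2S].
pose b i := match fintype.split i with inl j => b1 j | inr j => b2 j end.
have bE (c1 : 'rV_d1) (c2 : 'rV_d2) :
    lincomb (row_mx c1 c2) b = lincomb c1 b1 + lincomb c2 b2.
  rewrite lincomb_row_mx; congr (_ + _); apply: eq_bigr => i _.
    by rewrite /b (unsplitK (inl i)).
  by rewrite /b (unsplitK (inr i)).
exists b; apply/quotient_basisP => //; split.
  split=> [i|c]; first by rewrite /b; case: fintype.split => j //; apply/WV.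
  rewrite -[c]hsubmxK bE => Uc.
  have c10 : lsubmx c = 0.
    apply: b1I; rewrite -[lincomb _ _](addrK (lincomb (rsubmx c) b2)).
    by apply: subspaceB => //; [apply: UW | apply: subspace_lincomb].
  rewrite c10 lincomb0 add0r in Uc.
  by rewrite c10 (b2I _ Uc) row_mx0.
move=> z /b1S [c1 /b2S [c2 Uc]]; exists (row_mx c1 c2).
by rewrite bE opprD addrA.
Qed.

Lemma has_quotient_dim_sub A B V d :
  subspace A -> subspace B -> subspace V -> V `<=` A ->
  has_quotient_dim A B d -> exists2 d', (d' <= d)%N & has_quotient_dim V (V `&` B) d'.
Proof.
move=> sA sB sV VA [b Hb]; apply: has_quotient_dim_bounded => //; first exact: subspaceI.
move=> k b' [Vb' b'I]; apply: (independent_mod_leq sA sB Hb).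
split=> [i|c Bc]; first exact/VA.
by apply: b'I; split=> //; apply: subspace_lincomb.
Qed.

Lemma has_quotient_dim_quo V W U d :
  subspace V -> subspace W -> subspace U -> U `<=` W ->
  has_quotient_dim V U d -> exists2 d', (d' <= d)%N & has_quotient_dim V W d'.
Proof.
move=> sV sW sU UW [b Hb]; apply: has_quotient_dim_bounded => //.
move=> k b' [Vb' b'I]; apply: (independent_mod_leq sV sU Hb).
by split=> // c Uc; apply/b'I/UW.
Qed.

Lemma has_quotient_dim_refl V : subspace V -> has_quotient_dim V V 0.
Proof.
move=> sV; exists (fun=> 0); apply/quotient_basisP => //; split.
  by split=> [[]//|c _]; apply/rowP => - [].
by move=> z Vz; exists 0; rewrite lincomb0 subr0.
Qed.

End QuotientDimension.

(** The hypotheses say that phi induces a K-linear isomorphism from V1/W1 onto V2/W2. It serves for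
    multiplication by a power of a uniformizer or by a function, for r -> r y^i, and for the
    identity between different quotients. *)
Lemma has_quotient_dim_image (K F1 F2 : fieldType) (iota1 : {rmorphism K -> F1})
    (iota2 : {rmorphism K -> F2}) (phi : F1 -> F2) (V1 W1 : set F1) (V2 W2 : set F2) d :
  {morph phi : z w / z + w} -> (forall c z, phi (iota1 c * z) = iota2 c * phi z) ->
  subspace iota1 V1 -> subspace iota1 W1 -> subspace iota2 V2 -> subspace iota2 W2 ->
  (forall z, V1 z -> V2 (phi z)) -> (forall z, V1 z -> W2 (phi z) <-> W1 z) ->
  (forall w, V2 w -> exists2 z, V1 z & W2 (w - phi z)) ->
  has_quotient_dim iota1 V1 W1 d -> has_quotient_dim iota2 V2 W2 d.
Proof.
move=> phiD phiZ sV1 sW1 sV2 sW2 phiV phiW phiS [b /quotient_basisP[] // [Vb bI] bS].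
have phi0 : phi 0 = 0 by have := phiD 0 0; rewrite addr0 => /eqP; rewrite eq_sym -subr_eq0 addrK => /eqP.
have phiB z w : phi (z - w) = phi z - phi w.
  by apply/esym/eqP; rewrite subr_eq -phiD subrK.
have phi_lin c : phi (lincomb iota1 c b) = lincomb iota2 c (phi \o b).
  by rewrite /lincomb (big_morph phi phiD phi0); apply: eq_bigr.
exists (phi \o b); apply/quotient_basisP => //; split.
  split=> [i|c]; first exact/phiV.
  by rewrite -phi_lin phiW => [/bI|] //; apply: subspace_lincomb.
move=> w /phiS [z Vz Wz]; have [c Wc] := bS z Vz; exists c.
rewrite -phi_lin -(subrKA (phi z)) -phiB; case: (sW2) => _ W2D _; apply: W2D => //.
by apply: (phiW _ _).2 => //; apply: (subspaceB sV1) => //; apply: subspace_lincomb.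
Qed.

(** * Valuations before normalization *)

Section Valuation.
Variables (K F : fieldType) (iota : {rmorphism K -> F}).
Implicit Types z w : F.

(** The normalization is dropped in order to cover the restriction of a place to a subfield, whose
    values are multiples of a ramification index, and the valuation built from a maximal subring. *)
Definition prevaluation (v : F -> int) : Prop :=
  [/\ v 0 = 0,
      forall c : K, c != 0 -> v (iota c) = 0,
      forall z w : F, z != 0 -> w != 0 -> v (z * w) = v z + v w
    & forall z w : F, z != 0 -> w != 0 -> z + w != 0 ->
        Num.min (v z) (v w) <= v (z + w)].

Lemma place_prevaluation (P : place iota) : prevaluation P.
Proof. by case: (place_ordP P). Qed.

(* With this convention on zero, [vge v k] is the K-subspace v >= k. *)
Definition vge (v : F -> int) (k : int) (z : F) : Prop := z = 0 \/ k <= v z.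

Variable v : F -> int.
Hypothesis v_val : prevaluation v.

Lemma valM z w : z != 0 -> w != 0 -> v (z * w) = v z + v w.
Proof. by case: v_val => _ _ + _; apply. Qed.

Lemma val0 : v 0 = 0. Proof. by case: v_val. Qed.

Lemma val1 : v 1 = 0.
Proof. by case: v_val => _ vc _ _; rewrite -(rmorph1 iota) vc ?oner_neq0. Qed.

Lemma valV z : v z^-1 = - v z.
Proof.
have [->|z0] := eqVneq z 0; first by rewrite invr0 val0 oppr0.
by apply/eqP; rewrite -addr_eq0 -valM ?invr_eq0 // mulVf ?val1.
Qed.

Lemma valN z : v (- z) = v z.
Proof.
have [->|z0] := eqVneq z 0; first by rewrite oppr0.
rewrite -mulN1r valM ?oppr_eq0 ?oner_eq0 //.
case: v_val => _ vc _ _.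
by rewrite -(rmorph1 iota) -rmorphN vc ?add0r // oppr_eq0 oner_eq0.
Qed.

Lemma valX z n : v (z ^+ n) = v z *+ n.
Proof.
have [->|z0] := eqVneq z 0.
  by rewrite expr0n val0 mul0rn; case: n => [|n]; rewrite ?val1 ?val0.
elim: n => [|n IH]; first by rewrite expr0 mulr0n val1.
by rewrite exprS valM ?expf_neq0 // IH mulrS.
Qed.

Lemma valXz z (k : int) : v (z ^ k) = k * v z.
Proof.
case: k => n; first by rewrite -exprnP valX -mulr_natl natz.
by rewrite NegzE -invr_expz valV -exprnP valX -mulr_natl natz mulNr.
Qed.

Lemma val_prod (I : Type) (s : seq I) (z : I -> F) :
  (forall i, z i != 0) -> v (\prod_(i <- s) z i) = \sum_(i <- s) v (z i).
Proof.
move=> z0; elim: s => [|i s IH]; first by rewrite !big_nil val1.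
rewrite !big_cons valM ?IH //.
by apply: (big_ind (fun x => x != 0)); [exact: oner_neq0 | exact: mulf_neq0 |].
Qed.

Lemma vge_neq0 k z : z != 0 -> vge v k z -> k <= v z.
Proof. by move=> z0 [z00|//]; rewrite z00 eqxx in z0. Qed.

Lemma vge_le k k' z : k' <= k -> vge v k z -> vge v k' z.
Proof. by move=> kk [->|kz]; [left | right; apply: le_trans kz]. Qed.

Lemma vgeN k z : vge v k z -> vge v k (- z).
Proof. by case=> [->|kz]; [left; rewrite oppr0 | right; rewrite valN]. Qed.

Lemma vgeD k z w : vge v k z -> vge v k w -> vge v k (z + w).
Proof.
have [->|z0] := eqVneq z 0; first by rewrite add0r.
have [->|w0] := eqVneq w 0; first by rewrite addr0.
have [->|zw0] := eqVneq (z + w) 0; first by left.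
move=> /(vge_neq0 z0) kz /(vge_neq0 w0) kw; right.
by case: v_val => _ _ _ /(_ z w z0 w0 zw0); apply: le_trans; rewrite le_min kz.
Qed.

Lemma vgeB k z w : vge v k z -> vge v k w -> vge v k (z - w).
Proof. by move=> Hz Hw; apply: vgeD => //; apply: vgeN. Qed.

Lemma vgeM k l z w : vge v k z -> vge v l w -> vge v (k + l) (z * w).
Proof.
have [->|z0] := eqVneq z 0; first by rewrite mul0r; left.
have [->|w0] := eqVneq w 0; first by rewrite mulr0; left.
move=> /(vge_neq0 z0) kz /(vge_neq0 w0) kw; right.
by rewrite valM // lerD.
Qed.

Lemma vge_const c : vge v 0 (iota c).
Proof.
have [->|c0] := eqVneq c 0; first by rewrite rmorph0; left.
by right; case: v_val => _ -> .
Qed.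

Lemma vgeZ k c z : vge v k z -> vge v k (iota c * z).
Proof. by move=> Hz; rewrite -[k]add0r; apply: vgeM => //; apply: vge_const. Qed.

Lemma vge_sum k (I : Type) (r : seq I) (Q : pred I) (z : I -> F) :
  (forall i, Q i -> vge v k (z i)) -> vge v k (\sum_(i <- r | Q i) z i).
Proof. by move=> H; apply: (big_ind (vge v k)) => //; [left | apply: vgeD]. Qed.

Lemma vge_subspace k : subspace iota (vge v k).
Proof. by split; [left | move=> *; apply: vgeD | move=> *; apply: vgeZ]. Qed.

Lemma vgeMl k w z : w != 0 -> vge v k (w * z) <-> vge v (k - v w) z.
Proof.
move=> w0; split=> H; last by rewrite -[k](subrKC (v w)); apply: vgeM => //; right.
rewrite -[z](mulKf w0) addrC; apply: vgeM => //; right; by rewrite valV.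
Qed.

Lemma valD_lt z w : z != 0 -> vge v (v z + 1) w -> v (z + w) = v z.
Proof.
move=> z0 Hw; have Hzw : vge v (v z) (z + w).
  by apply: vgeD; [right | apply: vge_le Hw; rewrite lerDl].
have [zw0|zw0] := eqVneq (z + w) 0.
  have : vge v (v z + 1) z.
    by rewrite -[X in vge v _ X](addrK w) zw0 sub0r; apply: vgeN.
  by move=> /(vge_neq0 z0); rewrite gerDl.
apply/eqP; rewrite eq_le (vge_neq0 zw0 Hzw) andbT leNgt; apply/negP => lt.
have : vge v (v z + 1) z.
  rewrite -[X in vge v _ X](addrK w z); apply: vgeB => //; right.
  by rewrite -lezD1 in lt.
by move=> /(vge_neq0 z0); rewrite gerDl.
Qed.

(** The nonzero term of least value is unique, so the other terms cannot cancel it. *)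
Lemma sum_distinct_val (I : finType) (z : I -> F) :
  (exists i, z i != 0) ->
  (forall i j, z i != 0 -> z j != 0 -> v (z i) = v (z j) -> i = j) ->
  \sum_i z i != 0.
Proof.
move=> [i0 zi0] inj.
case: (@Order.TotalTheory.arg_minP _ _ _ i0 (fun i => z i != 0) (fun i => v (z i)) zi0) => i zi imin.
apply/eqP => S0; have : vge v (v (z i) + 1) (z i).
  move: S0; rewrite (bigD1 i) //= => /eqP; rewrite addr_eq0 => /eqP e.
  rewrite [X in vge v _ X]e.
  apply: vgeN; apply: vge_sum => j ji.
  have [->|zj] := eqVneq (z j) 0; [by left | right].
  rewrite lezD1 lt_neqAle imin // andbT; apply: contra_neq ji => eji.
  exact: inj.
by move=> /(vge_neq0 zi); rewrite gerDl.
Qed.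

(** The values of v form a nonzero subgroup of the integers; e is its positive generator and P is v
    / e. *)
Lemma normalize_valuation : (exists z, v z != 0) ->
  exists (P : place iota) (e : int), 0 < e /\ forall z, v z = e * P z.
Proof.
move=> [z1 z1v].
have ex0 : exists n : nat, (0 < n)%N && `[< exists2 z : F, z != 0 & v z = n >].
  exists `|v z1|%N; rewrite absz_gt0 z1v /=; apply/asboolP.
  have z10 : z1 != 0 by apply: contra_neq z1v => ->; rewrite val0.
  have [H|H] := leP 0 (v z1); first by exists z1; rewrite // gez0_abs.
  by exists z1^-1; rewrite ?invr_eq0 // valV ltz0_abs.
case: (ex_minnP ex0) => e /andP[e0 /asboolP [t t0 te]] emin.
have e_neq0 : e%:Z != 0 by rewrite eqz_nat -lt0n.
have dv z : (e %| v z)%Z.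
  have [->|z0] := eqVneq z 0; first by rewrite val0 dvdz0.
  apply/dvdz_mod0P/eqP; apply/negPn/negP => r0.
  have rge0 := modz_ge0 (v z) e_neq0.
  have : (e <= `|(v z %% e)%Z|)%N.
    apply: emin; rewrite absz_gt0 r0 /=; apply/asboolP.
    exists (z / t ^ (v z %/ e)%Z); first by rewrite mulf_neq0 // invr_eq0 expfz_neq0.
    by rewrite valM ?invr_eq0 ?expfz_neq0 // valV valXz te gez0_abs.
  by rewrite -lez_nat gez0_abs // leNgt ltz_mod.
pose w z := (v z %/ e)%Z.
have vw z : v z = e%:Z * w z by rewrite mulrC divzK.
have wP : discrete_valuation iota w.
  have inj : injective (fun k : int => e%:Z * k) by apply: mulfI.
  split.
  - by rewrite /w val0 div0z.
  - by move=> c c0; rewrite /w; case: v_val => _ -> //; rewrite div0z.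
  - by move=> z y z0 y0; apply: inj; rewrite mulrDr -!vw valM.
  - move=> z y z0 y0 zy0; have ep : 0 < e%:Z by rewrite ltz_nat.
    rewrite -(ler_pM2l ep) minr_pMr ?(ltW ep) // -!vw.
    by case: v_val => _ _ _; apply.
  - by exists t; rewrite /w te divzz e_neq0.
by exists (Place wP), e%:Z; split; rewrite ?ltz_nat.
Qed.

End Valuation.

(** * Independence of finitely many places *)

Section WeakApproximation.
Variables (K F : fieldType) (iota : {rmorphism K -> F}).
Implicit Types (P Q : place iota) (z w : F).
Let pv := @place_prevaluation K F iota.

Lemma place_inj P Q : (forall z, P z = Q z) -> P = Q.
Proof.
case: P Q => [v vP] [w wP] /= /funext e.
by case: _ / e in wP *; congr Place; exact: Prop_irrelevance.
Qed.

Lemma place_deg_unique P d :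
  has_quotient_dim iota (vge P 0) (vge P 1) d -> place_deg P = d.
Proof.
move=> H; rewrite /place_deg.
have -> : valuation_ideal P = vge P 1.
  by apply/funext => z; apply: propext; split=> -[->|H1]; [left | right; lia | left | right; lia].
exact: quotient_dimE (vge_subspace (pv P) 0) (vge_subspace (pv P) 1) H.
Qed.

Lemma place_uniformizer P : exists2 t, t != 0 & P t = 1.
Proof.
case: (place_ordP P) => v0 _ _ _ [t vt]; exists t => //.
by apply/eqP => t0; rewrite t0 v0 in vt.
Qed.

(** One inclusion is enough: units for P are units for Q, so Q is Q(t) times P for a uniformizer t
    of P. The inclusion gives Q(t) >= 0, and Q takes the value 1, so Q(t) = 1. *)
Lemma place_subring_eq P Q : (forall z, vge P 0 z -> vge Q 0 z) -> P = Q.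
Proof.
move=> PQ; have [t t0 Pt] := place_uniformizer P.
have Q0 z : z != 0 -> P z = 0 -> Q z = 0.
  move=> z0 Pz; apply/eqP; rewrite eq_le -oppr_ge0 -(valV (pv Q)).
  rewrite !(vge_neq0 (v := Q)) ?invr_eq0 //; apply: PQ; right; rewrite ?(valV (pv P)) Pz //.
have QE z : z != 0 -> Q z = P z * Q t.
  move=> z0; have := Q0 (z / t ^ P z).
  rewrite !(valM (pv _)) ?mulf_neq0 ?invr_eq0 ?expfz_neq0 // !(valV (pv _)) !(valXz (pv _)) Pt mulr1.
  by rewrite subrr => /(_ isT erefl)/eqP; rewrite subr_eq0 => /eqP.
have Qt : 0 <= Q t by apply: (vge_neq0 t0); apply: PQ; right; rewrite Pt.
have [s s0 Qs] := place_uniformizer Q.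
have Qt1 : Q t = 1.
  have := QE s s0; rewrite Qs => /eqP; rewrite eq_sym mulrC.
  move: Qt (P s); case: (Q t) => // n _ k /eqP nk.
  by have : (n%:Z %| 1)%Z; [apply/dvdzP; exists k; rewrite mulrC | rewrite dvdz1 absz_nat => /eqP ->].
apply: place_inj => z; have [->|z0] := eqVneq z 0; first by rewrite !(val0 (pv _)).
by rewrite QE // Qt1 mulr1.
Qed.

(** By [place_subring_eq] neither valuation ring contains the other; the quotient of witnesses of
    the two failures makes both inequalities strict. *)
Lemma separate_two_places P Q : P != Q -> exists u, [/\ u != 0, 0 < P u & Q u < 0].
Proof.
have half P' Q' : P' != Q' -> exists u, [/\ u != 0, 0 <= P' u & Q' u < 0].
  move=> PQ; apply: contrapT => H; case/eqP: PQ; apply: place_subring_eq => z Pz.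
  have [->|z0] := eqVneq z 0; [by left | right].
  rewrite leNgt; apply/negP => Qz; apply: H; exists z; split=> //.
  exact: (vge_neq0 z0).
move=> PQ; have [u [u0 Pu Qu]] := half _ _ PQ.
rewrite eq_sym in PQ; have [w [w0 Qw Pw]] := half _ _ PQ.
exists (u / w); rewrite !(valM (pv _)) ?invr_eq0 // !(valV (pv _)).
by rewrite mulf_neq0 ?invr_eq0 //; split=> //; lia.
Qed.

Lemma separate_places P (s : seq (place iota)) : P \notin s ->
  exists z, [/\ z != 0, 0 < P z & forall Q, Q \in s -> Q z < 0].
Proof.
elim: s => [|Q s IH].
  by move=> _; have [t t0 Pt] := place_uniformizer P; exists t; rewrite Pt.
rewrite inE negb_or => /andP[PQ /IH [z [z0 Pz sz]]] {IH}.
have [u [u0 Pu Qu]] := separate_two_places PQ.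
(* This k exceeds |R z| at every R of the list. Where u has a pole, the pole of u^k then dominates
   z; at the remaining places of s, z has a pole and u^k does not, so z dominates. *)
pose k := (\sum_(R <- Q :: s) `|R z|).+1.
have kP R : R \in Q :: s -> `|R z| < k%:Z.
  move=> Rs; rewrite /k (big_rem _ Rs) /=; lia.
have uk0 : u ^+ k != 0 by rewrite expf_neq0.
have E R : R \in Q :: s -> R u < 0 -> R (z + u ^+ k) < 0.
  move=> Rs Ru; have := kP R Rs => kR.
  have Ruk : R (u ^+ k) <= - k%:Z by rewrite (valX (pv R)) -mulr_natl natz; nia.
  rewrite addrC (valD_lt (pv R) uk0); first by lia.
  by right; lia.
exists (z + u ^+ k); split.
- apply: contraTneq (Qu) => zu0; rewrite -leNgt; have := E Q.
  by rewrite mem_head zu0 (val0 (pv _)) => /(_ isT) H; rewrite leNgt; apply/negP => /H.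
- have : vge P 1 (z + u ^+ k).
    apply: (vgeD (pv P)); right; rewrite -?gtz0_ge1 // (valX (pv P)) /k; nia.
  apply: (vge_neq0 (v := P)).
  apply: contraTneq (Qu) => zu0; rewrite -leNgt; have := E Q.
  by rewrite mem_head zu0 (val0 (pv _)) => /(_ isT) H; rewrite leNgt; apply/negP => /H.
- move=> R Rs; case: (ltP (R u) 0) => [|Ru]; first exact: E.
  have {}Rs : R \in s.
    by move: Rs; rewrite inE => /orP[/eqP RQ|//]; rewrite RQ leNgt Qu in Ru.
  have := sz R Rs => Rz; rewrite (valD_lt (pv R) z0) //; right.
  by rewrite (valX (pv R)) -mulr_natl natz; nia.
Qed.

(** For z vanishing at P with poles along s, the element 1 / (1 + z^M) is close to 1 at P and close
    to 0 along s. *)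
Lemma approximate_idempotent P (s : seq (place iota)) (N : nat) : P \notin s ->
  exists w, vge P N (w - 1) /\ forall Q, Q \in s -> vge Q N w.
Proof.
move=> /separate_places [z [z0 Pz sz]].
pose M := N.+1; have zM0 : z ^+ M != 0 by rewrite expf_neq0.
have PzM : N%:Z + 1 <= P (z ^+ M) by rewrite (valX (pv P)) -mulr_natl natz; nia.
have P1 : P (1 + z ^+ M) = 0.
  by rewrite (valD_lt (pv P)) ?oner_neq0 // (val1 (pv P)) //; right; lia.
have D0 : 1 + z ^+ M != 0.
  apply/eqP => e; have e1 : 1 = - z ^+ M by apply/eqP; rewrite -addr_eq0 e.
  by have := val1 (pv P); rewrite e1 (valN (pv P)); lia.
exists (1 + z ^+ M)^-1; split.
  have -> : (1 + z ^+ M)^-1 - 1 = - (z ^+ M / (1 + z ^+ M)) by field.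
  apply: (vgeN (pv P)); right.
  by rewrite (valM (pv P)) ?invr_eq0 // (valV (pv P)) P1; lia.
move=> Q Qs; right; rewrite (valV (pv Q)).
have QzM : Q (z ^+ M) <= - N%:Z - 1.
  by rewrite (valX (pv Q)) -mulr_natl natz; have := sz Q Qs; nia.
rewrite addrC (valD_lt (pv Q)) //; first by lia.
by right; rewrite (val1 (pv Q)); lia.
Qed.

Lemma weak_approximation P (s : seq (place iota)) z (N : nat) : P \notin s ->
  exists w, vge P N (w - z) /\ forall Q, Q \in s -> vge Q N w.
Proof.
have [->|z0] := eqVneq z 0.
  by exists 0; split; [rewrite subrr|]; left.
pose M := (N + \sum_(R <- P :: s) `|R z|)%N.
have MP R : R \in P :: s -> N%:Z - R z <= M%:Z.
  by move=> Rs; rewrite /M (big_rem _ Rs) /=; lia.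
move=> /(approximate_idempotent M) [w [Pw sw]]; exists (z * w); split.
  rewrite -[X in _ - X]mulr1 -mulrBr; apply/(vgeMl (pv P)) => //.
  by apply: vge_le Pw; apply: MP; rewrite mem_head.
move=> Q Qs; apply/(vgeMl (pv Q)) => //.
by apply: vge_le (sw Q Qs); apply: MP; rewrite inE Qs orbT.
Qed.

End WeakApproximation.

(** * Riemann-Roch spaces and the monotonicity of deg D - l(D) *)

Section RiemannRoch.
Variables (K F : fieldType) (iota : {rmorphism K -> F}).
Implicit Types (P Q : place iota) (D : place iota -> int) (z w : F).
Let pv := @place_prevaluation K F iota.

Lemma shifted_residue P d k : has_quotient_dim iota (vge P 0) (vge P 1) d ->
  has_quotient_dim iota (vge P k) (vge P (k + 1)) d.
Proof.
have pb := pv P; have [t t0 bt] := place_uniformizer P.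
have tk0 : t ^ k != 0 by exact: expfz_neq0.
have btk : P (t ^ k) = k by rewrite (valXz pb) bt mulr1.
apply: (has_quotient_dim_image (phi := fun r => t ^ k * r) _ _ (vge_subspace pb 0) (vge_subspace pb 1)
  (vge_subspace pb k) (vge_subspace pb (k + 1))).
- by move=> r s; rewrite mulrDr.
- by move=> c r; rewrite mulrCA.
- by move=> r Hr; apply/(vgeMl pb) => //; rewrite btk subrr.
- by move=> r _; rewrite (vgeMl pb) // btk addrAC subrr add0r.
- move=> r Hr; exists ((t ^ k)^-1 * r); last by rewrite mulVKf // subrr; left.
  by apply/(vgeMl pb); rewrite ?invr_eq0 // (valV pb) btk opprK add0r.
Qed.

Lemma zero_subspace : subspace iota [set 0].
Proof. by split=> [//|z w -> ->|c z ->]; rewrite /= ?addr0 ?mulr0. Qed.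

Lemma riemann_roch_spaceE D :
  riemann_roch_space D = [set z | forall P, vge P (- D P) z].
Proof.
apply/seteqP; split=> z /=; first by case=> [-> P|H P]; [left | right].
move=> H; have [->|z0] := eqVneq z 0; [by left | right => P].
exact: (vge_neq0 z0 (H P)).
Qed.

Lemma riemann_roch_subspace D : subspace iota (riemann_roch_space D).
Proof.
rewrite riemann_roch_spaceE; split=> [P|z w Hz Hw P|c z Hz P]; first by left.
  exact: (vgeD (pv P)).
exact: (vgeZ (pv P)).
Qed.

Lemma riemann_roch_dimE D l : has_quotient_dim iota (riemann_roch_space D) [set 0] l ->
  riemann_roch_dim D = l.
Proof. exact: quotient_dimE (riemann_roch_subspace D) zero_subspace. Qed.

Lemma divisor_degE D (s : seq (place iota)) : uniq s -> (forall P, P \notin s -> D P = 0) ->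
  divisor_deg D = \sum_(P <- s) D P * (place_deg P)%:Z.
Proof.
move=> us Ds; rewrite /divisor_deg (fsbigE s) // => [|P _ /Ds ->]; last by rewrite mul0r.
by apply: eq_bigl => P; rewrite in_setT.
Qed.

Hypothesis residues : forall P, has_quotient_dim iota (vge P 0) (vge P 1) (place_deg P).

(** L(D) / L(D - P) embeds into the functions of P-value at least -D(P) modulo those of larger
    value. This quotient is a copy of the residue field, so l drops by at most deg P. *)
Lemma riemann_roch_pred D P l :
  has_quotient_dim iota (riemann_roch_space D) [set 0] l ->
  exists2 l', (l <= l' + place_deg P)%N &
    has_quotient_dim iota (riemann_roch_space (fun Q => D Q - (Q == P)%:Z)) [set 0] l'.
Proof.
set D' := fun Q => _; move=> Hl; have pP := pv P.
have sV := riemann_roch_subspace D; have sW := riemann_roch_subspace D'.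
have WV : riemann_roch_space D' `<=` riemann_roch_space D.
  rewrite !riemann_roch_spaceE => z Hz Q; apply: vge_le (Hz Q).
  by rewrite /D' lerN2 gerBl.
have [l' _] := has_quotient_dim_sub sV zero_subspace sW WV Hl.
have -> : riemann_roch_space D' `&` [set 0] = [set 0].
  by apply/seteqP; split=> [z []|z ->] //; split=> //; case: sW.
move=> Hl'; exists l' => //.
have VA : riemann_roch_space D `<=` vge P (- D P).
  by rewrite riemann_roch_spaceE => z; apply.
have [d dP] := has_quotient_dim_sub (vge_subspace pP _) (vge_subspace pP _) sV VA
  (shifted_residue (- D P) (residues P)).
have -> : riemann_roch_space D `&` vge P (- D P + 1) = riemann_roch_space D'.
  rewrite !riemann_roch_spaceE; apply/seteqP; split=> [z [Hz HP] Q|z Hz]; rewrite /D'.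
    by case: eqVneq => [->|_]; [rewrite opprB addrC | rewrite subr0].
  split=> [Q|]; last by have := Hz P; rewrite /D' eqxx opprB addrC.
  by apply: vge_le (Hz Q); rewrite /D' lerN2 gerBl.
move=> Hd; have H := has_quotient_dim_chain sV sW zero_subspace WV _ Hd Hl'.
rewrite (has_quotient_dim_uniq sV zero_subspace Hl (H _)); first by rewrite addnC leq_add2l.
by move=> z ->; case: sW.
Qed.

(** Rearranged, the inequality says that deg - l does not decrease from D to D'. The list s contains
    all places where the two divisors differ, and one place is removed at a time. *)
Lemma riemann_roch_mono D D' (s : seq (place iota)) l' :
  (forall P, P \notin s -> D P = D' P) -> uniq s -> (forall P, D P <= D' P) ->
  has_quotient_dim iota (riemann_roch_space D') [set 0] l' ->
  exists2 l, has_quotient_dim iota (riemann_roch_space D) [set 0] l &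
    l'%:Z <= l%:Z + \sum_(P <- s) (D' P - D P) * (place_deg P)%:Z.
Proof.
move=> Ds us DD'.
have [N] := ubnP (\sum_(P <- s) `|D' P - D P|%N); elim: N D' l' Ds DD' => // N IH D' l' Ds DD' DN Hl'.
have [e|[P PD]] : D = D' \/ exists P, D P != D' P.
  have [H|H] := pselect (exists P, D P != D' P); [by right | left].
  by apply/funext => P; apply/eqP/negPn/negP => HP; apply: H; exists P.
  exists l'; rewrite ?e // big1 ?addr0 // => P _; rewrite subrr mul0r //.
have Ps : P \in s by apply: contraNT PD => /Ds ->.
have DP : D P + 1 <= D' P by rewrite lezD1 lt_neqAle PD DD'.
have [l1 l1P Hl1] := riemann_roch_pred P Hl'.
set D1 := fun Q => _ in Hl1.
have D1E Q : Q \in rem P s -> D1 Q = D' Q.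
  by rewrite mem_rem_uniq // inE /D1 => /andP[/negPf -> _]; rewrite subr0.
have D1P : D1 P = D' P - 1 by rewrite /D1 eqxx.
have [||| l Hl lP] := IH D1 l1 _ _ _ Hl1.
- move=> Q Qs; rewrite Ds // /D1; case: eqVneq => [QP|_]; last by rewrite subr0.
  by rewrite QP Ps in Qs.
- by move=> Q; rewrite /D1; case: eqVneq => [->|_]; rewrite ?subr0 // lerBrDr.
- move: DN; rewrite !(big_rem _ Ps) /= D1P.
  have -> : (\sum_(Q <- rem P s) `|(D1 Q - D Q)%R| = \sum_(Q <- rem P s) `|(D' Q - D Q)%R|)%N.
    by apply: eq_big_seq => Q /D1E ->.
  by move: (\sum_(Q <- _) _)%N => x; lia.
exists l => //; move: lP l1P; rewrite !(big_rem _ Ps) /= D1P.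
have -> : \sum_(Q <- rem P s) (D1 Q - D Q) * (place_deg Q)%:Z =
    \sum_(Q <- rem P s) (D' Q - D Q) * (place_deg Q)%:Z.
  by apply: eq_big_seq => Q /D1E ->.
by move: (\sum_(Q <- _) _) => x; nia.
Qed.

Lemma genus_unique (g : int) :
  (exists2 D, divisor iota D & divisor_deg D - (riemann_roch_dim D)%:Z + 1 = g) ->
  (forall D, divisor iota D -> divisor_deg D - (riemann_roch_dim D)%:Z + 1 <= g) ->
  genus iota = g.
Proof.
move=> [D dD eD] gmax; rewrite /genus; set S := [set _ | D in _].
have Sg : S g by exists D.
have ug : ubound S g by move=> _ [D' dD' <-]; exact: gmax.
case: xgetP => [g' _ [Sg' ug']|/(_ g)]; last by case.
by apply/eqP; rewrite eq_le ug // ug'.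
Qed.

End RiemannRoch.

(** * Places of the rational function field *)

Local Notation "g %:F" := (FracField.tofrac g).

Lemma sum_rem (T : eqType) (x : T) (s : seq T) (F : T -> int) : x \in s ->
  \sum_(y <- s) F y = F x + \sum_(y <- rem x s) F y.
Proof. by move=> xs; rewrite (big_rem _ xs). Qed.

Lemma sum_support (T : eqType) (s t : seq T) (F : T -> int) : uniq s -> uniq t ->
  {subset s <= t} -> (forall y, y \notin s -> F y = 0) ->
  \sum_(y <- s) F y = \sum_(y <- t) F y.
Proof.
move=> us ut st F0; rewrite [RHS](bigID (mem s)) /= [X in _ + X]big1 ?addr0 => [|y ys]; last exact: F0.
rewrite -[RHS]big_filter; apply: perm_big; apply: uniq_perm => [//||y]; first exact: filter_uniq.
by rewrite mem_filter; case: (boolP (y \in s)) => // /st.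
Qed.

Lemma mulf_div2l (F : fieldType) (a b c : F) : a != 0 -> a * b / (a * c) = b / c.
Proof. by move=> a0; rewrite -mulf_div divff // mul1r. Qed.

Lemma irreducible_factor (K : fieldType) (h : {poly K}) : (1 < size h)%N ->
  exists pi : {poly K}, irreducible_poly pi /\ pi %| h.
Proof.
move=> sh.
have ex0 : exists n, `[< exists g : {poly K}, [/\ (1 < size g)%N, size g = n & g %| h] >].
  by exists (size h); apply/asboolP; exists h.
case: (ex_minnP ex0) => n /asboolP [pi [spi sn pih]] nmin.
exists pi; split=> //; split=> // q sq qpi.
have q0 : q != 0 by apply: contraTneq qpi => ->; rewrite dvd0p -size_poly_gt0 ltnW.
have pi0 : pi != 0 by rewrite -size_poly_gt0 ltnW.
rewrite -(dvdp_size_eqp qpi) eqn_leq dvdp_leq //= sn; apply: nmin; apply/asboolP.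
exists q; split=> //; last exact: dvdp_trans pih.
by rewrite ltn_neqAle eq_sym sq size_poly_gt0.
Qed.

Section FractionValuation.
Variable K : fieldType.
Local Notation Kx := {fraction {poly K}}.
Implicit Types (g h : {poly K}) (z w : Kx).

Definition base_constants : {rmorphism K -> Kx} :=
  (@FracField.tofrac {poly K} \o @polyC K) : {rmorphism K -> Kx}.

Lemma fraction_repr (z : Kx) : z = (\n_(repr z))%:F / (\d_(repr z))%:F.
Proof.
have d0 : \d_(repr z) != 0 by exact: denom_ratioP.
apply: (mulIf (x := (\d_(repr z))%:F)); first by rewrite tofrac_eq0.
rewrite mulfVK ?tofrac_eq0 // -{1}[z]reprK.
unlock FracField.tofrac; rewrite -[LHS]FracField.pi_mul; apply/eqmodP.
rewrite /= FracField.equivfE /FracField.mulf !numden_Ratio ?mulf_neq0 ?oner_neq0 //; by rewrite !mulr1 mulrC.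
Qed.

Lemma fractionP (z : Kx) : exists g h : {poly K}, h != 0 /\ z = g%:F / h%:F.
Proof. by exists \n_(repr z), \d_(repr z); rewrite denom_ratioP -fraction_repr. Qed.

Section Extension.
Variable mu : {poly K} -> int.
Hypotheses (muC : forall c : K, c != 0 -> mu c%:P = 0)
  (muM : forall g h : {poly K}, g != 0 -> h != 0 -> mu (g * h) = mu g + mu h)
  (muD : forall g h : {poly K}, g != 0 -> h != 0 -> g + h != 0 -> Num.min (mu g) (mu h) <= mu (g + h)).

Definition fraction_valuation (z : Kx) : int :=
  if z == 0 then 0 else mu \n_(repr z) - mu \d_(repr z).

Lemma fraction_valuationE g h : g != 0 -> h != 0 ->
  fraction_valuation (g%:F / h%:F) = mu g - mu h.
Proof.
move=> g0 h0; set z := _ / _.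
have z0 : z != 0 by rewrite mulf_neq0 ?invr_eq0 ?tofrac_eq0.
rewrite /fraction_valuation (negPf z0).
have d0 : \d_(repr z) != 0 by exact: denom_ratioP.
have n0 : \n_(repr z) != 0.
  by apply: contra_neq z0 => n0; rewrite [z]fraction_repr n0 tofrac0 mul0r.
have /eqP : z = (\n_(repr z))%:F / (\d_(repr z))%:F by exact: fraction_repr.
rewrite /z eqr_div ?tofrac_eq0 // -!tofracM tofrac_eq => /eqP/(congr1 mu).
by rewrite !muM // => e; rewrite -[mu g](addrK (mu \d_(repr z))) e; ring.
Qed.

Lemma fraction_valuation_prevaluation : prevaluation base_constants fraction_valuation.
Proof.
have mu1 : mu 1 = 0 by rewrite -polyC1 muC ?oner_neq0.
have fP (z : Kx) : z != 0 -> exists g h : {poly K}, [/\ g != 0, h != 0 & z = g%:F / h%:F].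
  move=> z0; have [g [h [h0 e]]] := fractionP z; exists g, h; split=> //.
  by apply: contra_neq z0 => g0; rewrite e g0 tofrac0 mul0r.
split.
- by rewrite /fraction_valuation eqxx.
- move=> c c0; have := @fraction_valuationE c%:P 1.
  by rewrite polyC_eq0 oner_neq0 tofrac1 divr1 muC // mu1 subr0; apply.
- move=> z w /fP [g [h [g0 h0 ->]]] /fP [g' [h' [g'0 h'0 ->]]].
  by rewrite mulf_div -!tofracM !fraction_valuationE ?mulf_neq0 // !muM //; ring.
- move=> z w /fP [g [h [g0 h0 ->]]] /fP [g' [h' [g'0 h'0 ->]]].
  rewrite addf_div ?tofrac_eq0 // -!tofracM -tofracD => n0.
  have {}n0 : g * h' + g' * h != 0.
    by apply: contra_neq n0 => ->; rewrite tofrac0 mul0r.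
  rewrite !fraction_valuationE ?mulf_neq0 // lerBrDr.
  apply: le_trans (muD _ _ _); rewrite ?mulf_neq0 // !muM //; lia.
Qed.

End Extension.

Lemma fraction_valuation_tofrac mu g : g != 0 -> mu 1 = 0 ->
  (forall g h : {poly K}, g != 0 -> h != 0 -> mu (g * h) = mu g + mu h) ->
  fraction_valuation mu g%:F = mu g.
Proof.
move=> g0 mu1 muM; have := fraction_valuationE muM g0 (oner_neq0 _).
by rewrite tofrac1 divr1 mu1 subr0.
Qed.

Definition neg_degree (g : {poly K}) : int := - (size g).-1%:Z.

Lemma neg_degreeM g h : g != 0 -> h != 0 -> neg_degree (g * h) = neg_degree g + neg_degree h.
Proof.
move=> g0 h0; rewrite /neg_degree size_mul //.
by move: g0 h0; rewrite -!size_poly_gt0; case: (size g) (size h) => [|m] [|n] //= _ _; rewrite addnS /= PoszD opprD.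
Qed.

Lemma place_at_infinityP : discrete_valuation base_constants (fraction_valuation neg_degree).
Proof.
have [v0 vC vM vD] : prevaluation base_constants (fraction_valuation neg_degree).
  apply: fraction_valuation_prevaluation; last 1 first.
  - move=> g h; rewrite -!size_poly_gt0 => g0 h0 gh0; have := size_polyD g h.
    rewrite /neg_degree; move: (size g) (size h) (size (g + h)) g0 h0 gh0 => i j k; lia.
  - by move=> c c0; rewrite /neg_degree size_polyC c0.
  - exact: neg_degreeM.
split=> //; exists (1%:F / 'X%:F).
rewrite (fraction_valuationE neg_degreeM) ?oner_neq0 ?polyX_eq0 //.
by rewrite /neg_degree size_poly1 size_polyX.
Qed.

Definition place_at_infinity : place base_constants := Place place_at_infinityP.
Arguments place_at_infinity : simpl never.

Lemma place_at_infinity_tofrac g : g != 0 -> place_at_infinity g%:F = - (size g).-1%:Z.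
Proof.
by move=> g0; apply: fraction_valuation_tofrac => //;
  [rewrite /neg_degree size_poly1 | exact: neg_degreeM].
Qed.

Section Finite.
Variable pi : {poly K}.
Hypothesis pi_irr : irreducible_poly pi.

Definition has_multiplicity (g : {poly K}) (k : nat) : Prop :=
  exists2 h, ~~ (pi %| h) & g = pi ^+ k * h.

Let pi_gt1 : (1 < size pi)%N. Proof. by case: pi_irr. Qed.
Let pi0 : pi != 0. Proof. by rewrite -size_poly_gt0 ltnW. Qed.

Lemma irreducible_dvdpM g h : (pi %| g * h) = (pi %| g) || (pi %| h).
Proof.
apply/idP/orP => [gh|[]]; [|exact: dvdp_mulr|exact: dvdp_mull].
have [|ng] := boolP (pi %| g); [by left | right].
by rewrite -(@Gauss_dvdpr _ h g pi) // irreducible_poly_coprime.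
Qed.

Lemma multiplicity_exists g : g != 0 -> exists k, has_multiplicity g k.
Proof.
have [n] := ubnP (size g); elim: n g => // n IH g gn g0.
have [/dvdpP [h e]|nd] := boolP (pi %| g); last by exists 0%N, g; rewrite ?expr0 ?mul1r.
have h0 : h != 0 by apply: contra_neq g0 => h0; rewrite e h0 mul0r.
have [|k [h' nh' e']] := IH h _ h0.
  move: gn; rewrite e size_mul //; move: pi_gt1 h0; rewrite -size_poly_gt0.
  by move: (size h) (size pi) => i j; lia.
by exists k.+1, h' => //; rewrite e e' exprS; ring.
Qed.

Lemma multiplicity_uniq g k l : has_multiplicity g k -> has_multiplicity g l -> k = l.
Proof.
wlog kl : k l / (k <= l)%N => [H|].
  by case: (leqP k l) => [/H//|/ltnW lk] Hk Hl; apply/esym/H.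
move=> [h nh ->] [h' nh']; rewrite -(subnKC kl) exprD -mulrA.
move/(mulfI (expf_neq0 k pi0)) => e; move: nh; rewrite e.
case: (l - k)%N => [|j]; first by rewrite addn0.
by rewrite exprS -mulrA dvdp_mulr.
Qed.

Definition multiplicity (g : {poly K}) : int := (xget 0%N [set k | has_multiplicity g k])%:Z.

Lemma multiplicityE g k : has_multiplicity g k -> multiplicity g = k.
Proof.
rewrite /multiplicity; case: xgetP => [l -> /= Hl Hk|/(_ k)//].
by rewrite (multiplicity_uniq Hl Hk).
Qed.

Lemma multiplicityM g h : g != 0 -> h != 0 ->
  multiplicity (g * h) = multiplicity g + multiplicity h.
Proof.
move=> /multiplicity_exists [k Hk] /multiplicity_exists [l Hl].
rewrite (multiplicityE Hk) (multiplicityE Hl); case: Hk Hl => [g' ng ->] [h' nh ->].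
apply: (@multiplicityE _ (k + l)); exists (g' * h').
  by rewrite irreducible_dvdpM negb_or ng.
by rewrite exprD; ring.
Qed.

Lemma multiplicityD g h : g != 0 -> h != 0 -> g + h != 0 ->
  Num.min (multiplicity g) (multiplicity h) <= multiplicity (g + h).
Proof.
wlog kl : g h / multiplicity g <= multiplicity h => [H|].
  case: (boolP (multiplicity g <= multiplicity h)) => [|]; first exact: H.
  rewrite -ltNge => /ltW lk.
  by move=> g0 h0 gh0; rewrite minC addrC H // addrC.
move=> g0 h0 gh0; rewrite min_l //.
have [k Hk] := multiplicity_exists g0; have [l Hl] := multiplicity_exists h0.
have [j Hj] := multiplicity_exists gh0.
move: kl; rewrite (multiplicityE Hk) (multiplicityE Hl) (multiplicityE Hj) !lez_nat => kl.
have dk : pi ^+ k %| g + h.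
  case: Hk Hl => [g' _ ->] [h' _ ->]; apply: dvdp_add; first exact: dvdp_mulr.
  by rewrite -(subnKC kl) exprD -mulrA dvdp_mulr.
rewrite leqNgt; apply/negP => jk; case: Hj dk => [f nf ->].
rewrite -(subnKC jk) exprD exprSr -mulrA dvdp_mul2l ?expf_neq0 // => /(dvdp_trans _).
by move=> /(_ pi (dvdp_mulr _ (dvdpp _))) => H; case/negP: nf.
Qed.

Lemma multiplicityC (c : K) : c != 0 -> multiplicity c%:P = 0.
Proof.
move=> c0; apply: (@multiplicityE _ 0); exists c%:P; last by rewrite expr0 mul1r.
by apply/negP => /dvdp_leq; rewrite polyC_eq0 c0 size_polyC c0 => /(_ isT); rewrite leqNgt pi_gt1.
Qed.

Lemma multiplicity_self : multiplicity pi = 1.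
Proof.
apply: (@multiplicityE _ 1); exists 1; last by rewrite expr1 mulr1.
by rewrite dvdp1 neq_ltn pi_gt1 orbT.
Qed.

Lemma finite_placeP : discrete_valuation base_constants (fraction_valuation multiplicity).
Proof.
have [v0 vC vM vD] := fraction_valuation_prevaluation multiplicityC multiplicityM multiplicityD.
split=> //; exists pi%:F; rewrite fraction_valuation_tofrac ?multiplicity_self //.
  by rewrite -polyC1 multiplicityC ?oner_neq0.
exact: multiplicityM.
Qed.

Definition finite_place : place base_constants := Place finite_placeP.
Arguments finite_place : simpl never.

Lemma finite_place_tofrac g : g != 0 -> finite_place g%:F = multiplicity g.
Proof.
move=> g0; apply: fraction_valuation_tofrac => //; last exact: multiplicityM.
by rewrite -polyC1 multiplicityC ?oner_neq0.
Qed.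

Lemma finite_place_self : finite_place pi%:F = 1.
Proof. by rewrite finite_place_tofrac // multiplicity_self. Qed.

Lemma finite_place_poly g : vge finite_place 0 g%:F.
Proof.
have [->|g0] := eqVneq g 0; first by left; rewrite tofrac0.
by right; rewrite finite_place_tofrac.
Qed.

Lemma finite_place_gt0 g : vge finite_place 1 g%:F <-> pi %| g.
Proof.
have [->|g0] := eqVneq g 0; first by rewrite dvdp0; split=> // _; left; rewrite tofrac0.
have [k Hk] := multiplicity_exists g0.
have fk : finite_place g%:F = k by rewrite finite_place_tofrac // (multiplicityE Hk).
have gF : g%:F != 0 by rewrite tofrac_eq0.
split=> [/(vge_neq0 gF)|].
  by rewrite fk; case: k Hk {fk} => // k [h _ ->] _; rewrite exprS -mulrA dvdp_mulr.
case/dvdpP=> h e; rewrite e; have := vgeM (place_prevaluation finite_place).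
move=> /(_ 0 1); rewrite add0r tofracM; apply; first exact: finite_place_poly.
by right; rewrite finite_place_self.
Qed.

Lemma finite_place_integral z : vge finite_place 0 z ->
  exists g h, [/\ h != 0, ~~ (pi %| h) & z = g%:F / h%:F].
Proof.
have [->|z0] := eqVneq z 0.
  by exists 0, 1; rewrite tofrac0 mul0r oner_neq0 dvdp1 neq_ltn pi_gt1 orbT.
have [g [h [h0 e]]] := fractionP z.
have g0 : g != 0 by apply: contra_neq z0 => g0; rewrite e g0 tofrac0 mul0r.
move=> /(vge_neq0 z0).
have -> : finite_place z = multiplicity g - multiplicity h.
  by rewrite e; exact: (fraction_valuationE multiplicityM).
have [k Hk] := multiplicity_exists g0; have [l Hl] := multiplicity_exists h0.
rewrite (multiplicityE Hk) (multiplicityE Hl) subr_ge0 lez_nat => lk.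
case: Hk Hl => [g' ng' eg] [h' nh' eh]; exists (pi ^+ (k - l) * g'), h'.
have h'0 : h' != 0 by apply: contra_neq h0 => h'0; rewrite eh h'0 mulr0.
split=> //; rewrite e eg eh -{1}(subnKC lk) exprD -mulrA 2!tofracM [X in _ / X]tofracM.
by apply: mulf_div2l; rewrite tofrac_eq0 expf_neq0.
Qed.

End Finite.

(** * Classification of the places of K(x), and Riemann-Roch in genus zero *)

Section BasePlaces.
Arguments finite_place : simpl never.
Local Notation inf := place_at_infinity.
Implicit Types b : place base_constants.

Lemma base_place_poly b g : 0 <= b 'X%:F -> vge b 0 g%:F.
Proof.
move=> bX; have -> : g%:F = \sum_(i < size g) (g`_i)%:P%:F * 'X%:F ^+ i.
  rewrite -{1}[g]coefK poly_def raddf_sum; apply: eq_bigr => i _ /=.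
  by rewrite -mul_polyC tofracM tofracXn.
apply: (vge_sum (place_prevaluation b)) => i _.
apply: (vgeZ (place_prevaluation b)); right.
by rewrite (valX (place_prevaluation b)) mulrn_wge0.
Qed.

(** If X has a pole at b, the leading term of a polynomial g dominates and b(g) = deg(g) b(X). Hence
    the valuation ring at infinity lies in that of b. *)
Lemma base_place_infinity b : b 'X%:F < 0 -> b = inf.
Proof.
move=> bX; have pb := place_prevaluation b.
have bE g : g != 0 -> b g%:F = b 'X%:F *+ (size g).-1.
  elim/poly_ind: g => [|g c IH]; first by rewrite eqxx.
  have bc (a : K) : b a%:P%:F = 0.
    case: (pb) => b0 bc _ _; have [->|/bc//] := eqVneq a 0.
    by rewrite polyC0 tofrac0.
  have [->|g0 _] := eqVneq g 0.
    by rewrite mul0r add0r polyC_eq0 => c0; rewrite size_polyC c0 bc.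
  have X0 : 'X%:F != 0 :> Kx by rewrite tofrac_eq0 polyX_eq0.
  have gF : g%:F != 0 by rewrite tofrac_eq0.
  have sg : (0 < size g)%N by rewrite size_poly_gt0.
  have bgX : b (g * 'X)%:F = b 'X%:F *+ size g.
    by rewrite tofracM (valM pb gF X0) (IH g0) -mulrSr (prednK sg).
  have gX0 : (g * 'X)%:F != 0 by rewrite tofrac_eq0 mulf_neq0 ?polyX_eq0.
  rewrite tofracD (valD_lt pb gX0); first by rewrite bgX size_MXaddC (negPf g0).
  right; rewrite bc bgX -mulr_natl natz; move: (b _) (size g) bX sg => i j; nia.
have {}bE g : g != 0 -> b g%:F = (size g).-1%:Z * b 'X%:F.
  by move=> /bE ->; rewrite -mulr_natl natz.
apply/esym/place_subring_eq => z; have [->|z0] := eqVneq z 0; first by left.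
have [g [h [h0 e]]] := fractionP z.
have g0 : g != 0 by apply: contra_neq z0 => g0; rewrite e g0 tofrac0 mul0r.
move=> /(vge_neq0 z0); rewrite e (valM (place_prevaluation inf)) ?invr_eq0 ?tofrac_eq0 //.
rewrite (valV (place_prevaluation inf)) !place_at_infinity_tofrac // => gh; right.
have gF : g%:F != 0 by rewrite tofrac_eq0.
have hF : h%:F^-1 != 0 by rewrite invr_eq0 tofrac_eq0.
rewrite (valM pb gF hF) (valV pb) (bE _ g0) (bE _ h0).
by move: (b _) (size g).-1 (size h).-1 bX gh => i j k; nia.
Qed.

(** If pi does not divide h, then h is a unit at b: otherwise a Bezout relation between pi and h
    would give 1 a positive value. So the valuation ring of [finite_place pi_irr] lies in that of
    b. *)
Lemma finite_place_uniq pi (pi_irr : irreducible_poly pi) b :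
  b != inf -> 0 < b pi%:F -> b = finite_place pi_irr.
Proof.
move=> binf bpi; have bX : 0 <= b 'X%:F.
  by rewrite leNgt; apply: contra_neqN binf => /base_place_infinity.
have pb := place_prevaluation b.
apply/esym/place_subring_eq => z /finite_place_integral [g [h [h0 nh ->]]].
rewrite -[0]addr0; apply: (vgeM pb); first exact: base_place_poly.
right; rewrite (valV pb) oppr_ge0 leNgt; apply/negP => bh.
have : coprimep pi h by rewrite irreducible_poly_coprime.
case/Bezout_eq1_coprimepP => -[u v] /= uv.
have : vge b 1 1.
  rewrite -tofrac1 -uv tofracD !tofracM; apply: (vgeD pb).
    by rewrite -[1]add0r; apply: (vgeM pb); [exact: base_place_poly | right].
  by rewrite -[1]add0r; apply: (vgeM pb); [exact: base_place_poly | right].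
by move=> /(vge_neq0 (oner_neq0 _)); rewrite (val1 pb).
Qed.

(** A nonzero polynomial of least degree among those of positive value is irreducible, because a
    factor of positive value cannot be smaller. *)
Lemma base_place_finite b : b != inf ->
  exists pi (pi_irr : irreducible_poly pi), b = finite_place pi_irr.
Proof.
move=> binf; have bX : 0 <= b 'X%:F.
  by rewrite leNgt; apply: contra_neqN binf => /base_place_infinity.
have pb := place_prevaluation b.
have bp g : g != 0 -> 0 <= b g%:F.
  by move=> g0; apply: (vge_neq0 (v := b)); rewrite ?tofrac_eq0 //; exact: base_place_poly.
have ex0 : exists n, `[< exists g : {poly K}, [/\ g != 0, size g = n & 0 < b g%:F] >].
  have [t t0 bt] := place_uniformizer b; have [g [h [h0 e]]] := fractionP t.
  have g0 : g != 0 by apply: contra_neq t0 => g0; rewrite e g0 tofrac0 mul0r.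
  exists (size g); apply/asboolP; exists g; split=> //.
  have := bp h h0; move: bt; rewrite e (valM pb) ?invr_eq0 ?tofrac_eq0 // (valV pb); lia.
case: (ex_minnP ex0) => n /asboolP [pi [pi0 sn bpi]] nmin.
have pi_min g : g != 0 -> 0 < b g%:F -> (size pi <= size g)%N.
  by move=> g0 bg; rewrite sn; apply: nmin; apply/asboolP; exists g.
have pi_irr : irreducible_poly pi.
  split.
    rewrite ltnNge; apply/negP => /size1_polyC e; move: pi0 bpi; rewrite e polyC_eq0 => c0.
    by case: (pb) => _ bc _ _; have := bc _ c0 => /= ->.
  move=> q sq qpi; case/dvdpP: (qpi) => r e.
  have q0 : q != 0 by apply: contra_neq pi0 => q0; rewrite e q0 mulr0.
  have r0 : r != 0 by apply: contra_neq pi0 => r0; rewrite e r0 mul0r.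
  rewrite -(dvdp_size_eqp qpi) eqn_leq dvdp_leq //=.
  apply: (pi_min) => //; rewrite lt_neqAle bp // andbT eq_sym; apply: contraNneq sq => bq.
  have : 0 < b r%:F by move: bpi; rewrite e tofracM (valM pb) ?tofrac_eq0 // bq addr0.
  move=> /(pi_min _ r0); rewrite e size_mul //.
  move: q0; rewrite -size_poly_gt0; move: (size q) (size r) => i j; lia.
by exists pi, pi_irr; apply: finite_place_uniq.
Qed.

Lemma finite_place_neq_infinity pi (pi_irr : irreducible_poly pi) :
  finite_place pi_irr != inf.
Proof.
apply/eqP => e; have := finite_place_self pi_irr.
by rewrite e place_at_infinity_tofrac ?irredp_neq0 //; lia.
Qed.

(** In a fraction g/h with h of least size, an irreducible factor of h would also divide g by
    integrality at its place, and could be cancelled. *)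
Lemma integral_polynomial z : (forall b, b != inf -> vge b 0 z) -> exists g, z = g%:F.
Proof.
move=> Hz.
have ex0 : exists n, `[< exists g h : {poly K}, [/\ h != 0, size h = n & z = g%:F / h%:F] >].
  have [g [h [h0 e]]] := fractionP z.
  by exists (size h); apply/asboolP; exists g, h.
case: (ex_minnP ex0) => n /asboolP [g [h [h0 sn e]]] nmin.
have [sh|] := leqP (size h) 1.
  have [hc] := size1_polyC sh; rewrite hc in h0 e *; rewrite polyC_eq0 in h0.
  exists ((h`_0)^-1 *: g); rewrite e -mul_polyC tofracM mulrC; congr (_ * _).
  apply: (mulfI (x := (h`_0)%:P%:F)); first by rewrite tofrac_eq0 polyC_eq0.
  by rewrite divff ?tofrac_eq0 ?polyC_eq0 // -tofracM -polyCM divff // tofrac1.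
move=> sh.
have [pi [pi_irr pih]] := irreducible_factor sh.
have [spi _] := pi_irr.
case/dvdpP: (pih) => h' eh.
have h'0 : h' != 0 by apply: contra_neq h0 => h'0; rewrite eh h'0 mul0r.
have pi0 := irredp_neq0 pi_irr.
have pb := place_prevaluation (finite_place pi_irr).
have : vge (finite_place pi_irr) 1 g%:F.
  have -> : g%:F = z * h%:F by rewrite e mulfVK // tofrac_eq0.
  rewrite -[1]add0r; apply: (vgeM pb); first by apply: Hz; exact: finite_place_neq_infinity.
  exact/finite_place_gt0.
move=> /finite_place_gt0 /dvdpP [g' eg].
have : (n <= size h')%N.
  apply: nmin; apply/asboolP; exists g', h'; split=> //.
  by rewrite e eg eh !tofracM -mulf_div divff ?mulr1 ?tofrac_eq0.
rewrite -sn eh size_mul //; move: spi h'0; rewrite -size_poly_gt0.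
move: (size h') (size pi) => i j; lia.
Qed.

Lemma finite_place_residue pi (pi_irr : irreducible_poly pi) :
  has_quotient_dim base_constants (vge (finite_place pi_irr) 0) (vge (finite_place pi_irr) 1)
    (size pi).-1.
Proof.
set P := finite_place _; have pP := place_prevaluation P.
have [spi _] := pi_irr.
pose X i := ('X^i)%:F : Kx.
have linX (c : 'rV[K]_(size pi).-1) :
    lincomb base_constants c (fun i : 'I_(size pi).-1 => X i) = (rVpoly c)%:F.
  rewrite /lincomb /rVpoly poly_def raddf_sum; apply: eq_bigr => i _ /=.
  rewrite insubT // => ilt; rewrite -mul_polyC tofracM; congr (_%:P%:F * _%:F).
  by congr (c 0 _); apply: val_inj.
exists (fun i => X i); apply/(quotient_basisP _ (vge_subspace pP 0) (vge_subspace pP 1)); split.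
  split=> [i|c]; first exact: finite_place_poly.
  rewrite linX => /finite_place_gt0 H; apply: (can_inj rVpolyK); rewrite linear0.
  apply/eqP; apply: contraTT H => c0; apply/negP => /(dvdp_leq c0).
  by rewrite leqNgt (leq_ltn_trans (size_poly _ _)) // prednK // ltnW.
move=> z /finite_place_integral [g [h [h0 nh ->]]].
have : coprimep pi h by rewrite irreducible_poly_coprime.
case/Bezout_eq1_coprimepP => -[u v] /= uv.
(* The Bezout cofactor v inverts h modulo pi, so g/h is congruent to g v, taken in reduced form. *)
exists (poly_rV ((g * v) %% pi)); rewrite linX poly_rV_K; last first.
  by rewrite -ltnS prednK ?ltn_modp ?irredp_neq0 // ltnW.
have hF : h%:F != 0 by rewrite tofrac_eq0.
have -> : g%:F / h%:F - ((g * v) %% pi)%:F =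
    (g * u * pi + h * ((g * v) %/ pi) * pi)%:F / h%:F.
  apply: (mulIf hF); rewrite mulrBl !(mulfVK hF) -tofracM -tofracB; congr (_%:F).
  have ge : g = g * u * pi + (g * v) * h.
    by rewrite -mulrA -[(g * v) * h]mulrA -mulrDr uv mulr1.
  by rewrite [X in X - _]ge {1}(divp_eq (g * v) pi); ring.
rewrite -[1]addr0; apply: (vgeM pP).
  by apply/finite_place_gt0; rewrite dvdp_add // dvdp_mull.
right; rewrite (valV pP) (finite_place_tofrac _ h0) oppr_ge0.
by rewrite (@multiplicityE _ pi_irr h 0) //; exists h; rewrite ?expr0 ?mul1r.
Qed.

Lemma finite_place_deg pi (pi_irr : irreducible_poly pi) :
  place_deg (finite_place pi_irr) = (size pi).-1.
Proof. exact: place_deg_unique (finite_place_residue pi_irr). Qed.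

Lemma base_place_irreducible b pi (pi_irr : irreducible_poly pi) :
  b != inf -> b != finite_place pi_irr -> b pi%:F = 0.
Proof.
move=> binf bP; apply/eqP; rewrite eq_le.
rewrite (@vge_neq0 _ b) ?tofrac_eq0 ?irredp_neq0 // ?andbT; last first.
  apply: base_place_poly; rewrite leNgt.
  by apply: contra_neqN binf => /base_place_infinity.
by rewrite leNgt; apply: contraNN bP => H; apply/eqP; exact: finite_place_uniq.
Qed.

Lemma place_at_infinity_residue : has_quotient_dim base_constants (vge inf 0) (vge inf 1) 1.
Proof.
have pP := place_prevaluation inf.
exists (fun=> 1); apply/(quotient_basisP _ (vge_subspace pP 0) (vge_subspace pP 1)); split.
  split=> [i|c]; first by right; rewrite (val1 pP).
  rewrite /lincomb big_ord1 mulr1 => H; apply/rowP => i; rewrite ord1 mxE; apply/eqP.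
  apply: contraPT H => c0 /vge_neq0; rewrite fmorph_eq0 => /(_ c0).
  by case: (pP) => _ -> .
move=> z; have [->|z0] := eqVneq z 0.
  by move=> _; exists 0; rewrite lincomb0 subrr; left.
have [g [h [h0 e]]] := fractionP z.
have g0 : g != 0 by apply: contra_neq z0 => g0; rewrite e g0 tofrac0 mul0r.
have hF : h%:F != 0 by rewrite tofrac_eq0.
have hV : h%:F^-1 != 0 by rewrite invr_eq0.
have gF : g%:F != 0 by rewrite tofrac_eq0.
move=> /(vge_neq0 z0); rewrite e (valM pP gF hV) (valV pP).
rewrite (place_at_infinity_tofrac g0) (place_at_infinity_tofrac h0) => gh.
have sgh : (size g <= size h)%N.
  by move: g0 h0 gh; rewrite -!size_poly_gt0; move: (size g) (size h) => i j; lia.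
(* The value of g/h at infinity: the coefficient of g in degree deg h, which is 0 when g has smaller
   degree, over the leading coefficient of h. *)
pose c := g`_(size h).-1 / lead_coef h.
exists (const_mx c); rewrite /lincomb big_ord1 mxE mulr1.
have -> : g%:F / h%:F - base_constants c = (g - c *: h)%:F / h%:F.
  apply: (mulIf hF); rewrite mulrBl !(mulfVK hF) tofracB; congr (_ - _).
  by rewrite -mul_polyC tofracM.
have [->|r0] := eqVneq (g - c *: h) 0; first by left; rewrite tofrac0 mul0r.
have rF : (g - c *: h)%:F != 0 by rewrite tofrac_eq0.
right; rewrite (valM pP rF hV) (valV pP) (place_at_infinity_tofrac r0) (place_at_infinity_tofrac h0).
have sr : (size (g - c *: h)%R < size h)%N.
  rewrite -[X in (_ < X)%N]prednK ?size_poly_gt0 // ltnS; apply/leq_sizeP => j.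
  rewrite leq_eqVlt coefB coefZ => /orP[/eqP <-|ij].
    by rewrite /c -/(lead_coef h) divfK ?lead_coef_eq0 // subrr.
  have hj : (size h <= j)%N by move: ij h0; rewrite -size_poly_gt0; move: (size h) => k; lia.
  by rewrite (nth_default _ hj) (nth_default _ (leq_trans sgh hj)) mulr0 subr0.
move: sr r0 h0; rewrite -!size_poly_gt0; move: (size h) (size _) => i j; lia.
Qed.

Lemma place_at_infinity_deg : place_deg inf = 1%N.
Proof. exact: place_deg_unique place_at_infinity_residue. Qed.

Lemma base_residue b : has_quotient_dim base_constants (vge b 0) (vge b 1) (place_deg b).
Proof.
have [->|binf] := eqVneq b inf.
  rewrite place_at_infinity_deg; exact: place_at_infinity_residue.
have [pi [pi_irr ->]] := base_place_finite binf.
rewrite finite_place_deg; exact: finite_place_residue.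
Qed.

(** A principal divisor has degree zero. Quantifying over every list that contains a fixed finite
    support lets two such formulas be added over a common list. *)
Definition has_product_formula (z : Kx) := exists S0 : seq (place base_constants),
  (forall b, b \notin S0 -> b z = 0) /\
  forall S, uniq S -> {subset S0 <= S} -> \sum_(b <- S) b z * (place_deg b)%:Z = 0.

Lemma has_product_formulaM z w : z != 0 -> w != 0 ->
  has_product_formula z -> has_product_formula w -> has_product_formula (z * w).
Proof.
move=> z0 w0 [Sz [zout zsum]] [Sw [wout wsum]]; exists (Sz ++ Sw); split=> [b|S uS sS].
  rewrite mem_cat negb_or (valM (place_prevaluation b) z0 w0) => /andP[bz bw].
  by rewrite (zout _ bz) (wout _ bw).
under eq_bigr do rewrite (valM (place_prevaluation _) z0 w0) mulrDl.
rewrite big_split /= (zsum _ uS) ?(wsum _ uS) // => b bS; apply: sS;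
  by rewrite mem_cat bS ?orbT.
Qed.

Lemma has_product_formulaV z : has_product_formula z -> has_product_formula z^-1.
Proof.
move=> [S0 [out sum]]; exists S0; split=> [b /out e|S uS sS].
  by rewrite (valV (place_prevaluation b)) e.
under eq_bigr do rewrite (valV (place_prevaluation _)) mulNr.
by rewrite sumrN (sum _ uS sS).
Qed.

(** By multiplicativity it is enough to treat an irreducible pi: its simple zero at a place of
    degree deg pi balances a pole of order deg pi at infinity, of degree one. *)
Lemma product_formula z : z != 0 -> has_product_formula z.
Proof.
have const (c : K) : c != 0 -> has_product_formula c%:P%:F.
  move=> c0; have bc (b : place base_constants) : b c%:P%:F = 0.
    by case: (place_prevaluation b) => _ bc _ _; exact: bc.
  by exists [::]; split=> // S _ _; apply: big1 => b _; rewrite bc mul0r.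
have irr pi (pi_irr : irreducible_poly pi) : has_product_formula pi%:F.
  have pi0 := irredp_neq0 pi_irr.
  have Pinf := finite_place_neq_infinity pi_irr.
  exists [:: inf; finite_place pi_irr]; split=> [b|S uS sS].
    rewrite !inE negb_or => /andP[binf bP]; exact: base_place_irreducible.
  have iS : inf \in S by apply: sS; rewrite mem_head.
  have PS : finite_place pi_irr \in rem inf S.
    by rewrite mem_rem_uniq // !inE Pinf; apply: sS; rewrite !inE eqxx orbT.
  rewrite (sum_rem _ iS) (sum_rem _ PS) big1_seq => [|b].
    rewrite addr0 (finite_place_self pi_irr) (place_at_infinity_tofrac pi0).
    by rewrite finite_place_deg place_at_infinity_deg mulr1 mul1r addNr.
  rewrite (rem_filter _ (rem_uniq _ uS)) (rem_filter _ uS) !mem_filter => /and4P[_ bP binf _].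
  by rewrite base_place_irreducible // mul0r.
have poly g : g != 0 -> has_product_formula g%:F.
  have [n] := ubnP (size g); elim: n g => // n IH g gn g0.
  have [sg|/irreducible_factor [pi [pi_irr /dvdpP [h e]]]] := leqP (size g) 1.
    by move: g0; rewrite (size1_polyC sg) polyC_eq0; apply: const.
  have pi0 := irredp_neq0 pi_irr.
  have h0 : h != 0 by apply: contra_neq g0 => h0; rewrite e h0 mul0r.
  rewrite e tofracM; apply: has_product_formulaM; rewrite ?tofrac_eq0 //; last exact: irr.
  apply: IH => //; move: gn; rewrite e size_mul //; case: pi_irr => + _; move: h0.
  rewrite -size_poly_gt0; move: (size h) (size pi) => i j; lia.
have [g [h [h0 ->]]] := fractionP z => z0.
have hF : h%:F^-1 != 0 by rewrite invr_eq0 tofrac_eq0.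
have g0 : g != 0 by apply: contra_neq z0 => ->; rewrite tofrac0 mul0r.
have gF : g%:F != 0 by rewrite tofrac_eq0.
by apply: (has_product_formulaM gF hF); [exact: poly | apply/has_product_formulaV/poly].
Qed.

(** The function h is the product of the pi^(M b) over the finite places b in S. Its value at
    infinity is not prescribed; the product formula determines it. *)
Lemma realize_divisor (M : place base_constants -> int) (S : seq (place base_constants)) :
  uniq S -> exists2 h : Kx, h != 0 &
    forall b, b != inf -> b h = if b \in S then M b else 0.
Proof.
elim: S => [|b0 S IH] /=.
  by exists 1; [exact: oner_neq0 | move=> b _; exact: val1 (place_prevaluation b)].
move=> /andP[b0S /IH [h h0 hM]]; have [b0inf|b0inf] := eqVneq b0 inf.
  by exists h => // b binf; rewrite hM // inE b0inf (negPf binf).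
have [pi [pi_irr e]] := base_place_finite b0inf.
have pF : pi%:F != 0 by rewrite tofrac_eq0 irredp_neq0.
have pM : pi%:F ^ M b0 != 0 by exact: expfz_neq0.
exists (pi%:F ^ M b0 * h); first exact: (mulf_neq0 pM h0).
move=> b binf; rewrite (valM (place_prevaluation b) pM h0) (valXz (place_prevaluation b)) inE.
rewrite (hM _ binf); have [->|bb0] := eqVneq b b0.
  by rewrite (negPf b0S) addr0 e finite_place_self mulr1.
by rewrite base_place_irreducible -?e // mulr0 add0r.
Qed.

Lemma poly_subspace n :
  subspace base_constants [set z | exists2 g : {poly K}, (size g <= n)%N & z = g%:F].
Proof.
split.
- by exists 0; rewrite ?size_poly0 ?tofrac0.
- move=> z w [g gn ->] [h hn ->]; exists (g + h); last by rewrite tofracD.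
  by rewrite (leq_trans (size_polyD _ _)) // geq_max gn.
- move=> c z [g gn ->]; exists (c%:P * g); last by rewrite tofracM.
  by rewrite mul_polyC (leq_trans (size_scale_leq _ _)).
Qed.

Lemma poly_space_dim n :
  has_quotient_dim base_constants [set z | exists2 g : {poly K}, (size g <= n)%N & z = g%:F]
    [set 0] n.
Proof.
have s0 : subspace base_constants [set 0].
  by split=> [//|z w -> ->|c z ->]; rewrite /= ?addr0 ?mulr0.
have sP := @poly_subspace n.
pose X i := ('X^i)%:F : Kx.
have linX (c : 'rV[K]_n) : lincomb base_constants c (fun i : 'I_n => X i) = (rVpoly c)%:F.
  rewrite /lincomb /rVpoly poly_def raddf_sum; apply: eq_bigr => i _ /=.
  rewrite insubT // => ilt; rewrite -mul_polyC tofracM; congr (_%:P%:F * _%:F).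
  by congr (c 0 _); apply: val_inj.
exists (fun i => X i); apply/(quotient_basisP _ sP s0); split.
  split=> [i|c]; first by exists 'X^i; rewrite ?size_polyXn.
  rewrite linX /= => /eqP; rewrite tofrac_eq0 => /eqP H.
  by apply: (can_inj rVpolyK); rewrite linear0.
move=> z [g gn ->]; exists (poly_rV g); rewrite linX poly_rV_K //= subrr //.
Qed.

(** Multiplication by a function h realizing M at the finite places carries the space of M onto that
    of (N - 1) times infinity, which consists of the polynomials of size at most N. Degree -1 is the
    case N = 0. *)
Lemma base_riemann_roch (M : place base_constants -> int) (S : seq (place base_constants)) (N : nat) :
  uniq S -> (forall b, b \notin S -> M b = 0) ->
  \sum_(b <- S) M b * (place_deg b)%:Z + 1 = N ->
  has_quotient_dim base_constants [set z | forall b, vge b (- M b) z] [set 0] N.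
Proof.
move=> uS Mout MN; have [h h0 hM] := realize_divisor M uS.
have [Sh [hout hsum]] := product_formula h0.
have s0 : subspace base_constants [set 0].
  by split=> [//|z w -> ->|c z ->]; rewrite /= ?addr0 ?mulr0.
have hM' b : b != inf -> b h = M b.
  by move=> /hM ->; case: ifPn => // /Mout.
have hinf : M inf - inf h = N%:Z - 1.
  set T := undup (inf :: S ++ Sh); have uT : uniq T by exact: undup_uniq.
  have iT : inf \in T by rewrite mem_undup mem_head.
  have := hsum T uT; rewrite (sum_rem _ iT) place_at_infinity_deg mulr1 => hT.
  have {}hT : inf h + \sum_(b <- rem inf T) b h * (place_deg b)%:Z = 0.
    by apply: hT => b bS; rewrite mem_undup inE mem_cat bS !orbT.
  have MT : \sum_(b <- S) M b * (place_deg b)%:Z = \sum_(b <- T) M b * (place_deg b)%:Z.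
    apply: sum_support => // [b bS|b /Mout ->]; last by rewrite mul0r.
    by rewrite mem_undup inE mem_cat bS !orbT.
  move: MN; rewrite MT (sum_rem _ iT) place_at_infinity_deg mulr1.
  have -> : \sum_(b <- rem inf T) M b * (place_deg b)%:Z = \sum_(b <- rem inf T) b h * (place_deg b)%:Z.
    apply: eq_big_seq => b; rewrite mem_rem_uniq // inE => /andP[binf _].
    by rewrite hM'.
  move: hT; move: (\sum_(b <- _) _) (M inf) (inf h) => x y z; lia.
have hV0 : h^-1 != 0 by rewrite invr_eq0.
have sM : subspace base_constants [set z | forall b, vge b (- M b) z].
  split=> [b|z w Hz Hw b|c z Hz b]; first by left.
    exact: (vgeD (place_prevaluation b)).
  exact: (vgeZ (place_prevaluation b)).
have sP : subspace base_constants [set z | exists2 g : {poly K}, (size g <= N)%N & z = g%:F].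
  exact: poly_subspace.
have infP g : (size g <= N)%N <-> vge inf (1 - N%:Z) g%:F.
  have [->|g0] := eqVneq g 0; first by rewrite size_poly0; split=> // _; left; rewrite tofrac0.
  have gF : g%:F != 0 by rewrite tofrac_eq0.
  split=> [gN|/(vge_neq0 gF)]; last first.
    rewrite (place_at_infinity_tofrac g0); move: g0; rewrite -size_poly_gt0.
    by move: (size g) => k; lia.
  right; rewrite (place_at_infinity_tofrac g0); move: g0 gN; rewrite -size_poly_gt0.
  by move: (size g) => k; lia.
have mulP b z : vge b (- M b) (h^-1 * z) <-> vge b (b h - M b) z.
  have pb := place_prevaluation b.
  by rewrite (vgeMl pb _ _ hV0) (valV pb) opprK addrC.
apply: (has_quotient_dim_image (phi := fun z => h^-1 * z) _ _ sP s0 sM s0 _ _ _ (poly_space_dim N)).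
- by move=> z w; rewrite mulrDr.
- by move=> c z; rewrite mulrCA.
- move=> z [g gN ->] b /=; apply/mulP; have [->|binf] := eqVneq b inf.
    by rewrite -opprB hinf opprB; apply/infP.
  rewrite (hM' _ binf) subrr; apply: base_place_poly; rewrite leNgt.
  by apply: contra_neqN binf => /base_place_infinity.
- move=> z _ /=; split=> [/eqP|->]; last by rewrite mulr0.
  by rewrite mulf_eq0 (negPf hV0) => /eqP.
- move=> w Hw; exists (h * w); last by rewrite (mulKf h0) subrr.
  have Hw' b : vge b (b h - M b) (h * w) by apply/mulP; rewrite (mulKf h0).
  have [g e] : exists g, h * w = g%:F.
    by apply: integral_polynomial => b binf; have := Hw' b; rewrite (hM' _ binf) subrr.
  exists g => //; apply/infP; rewrite -e.
  by have := Hw' inf; rewrite -opprB hinf opprB.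
Qed.

End BasePlaces.

End FractionValuation.

(** * Places above a given place *)

Section Extension.
Variables (K E : fieldType) (iota0 : {rmorphism K -> E}) (L : fieldExtType E).
Implicit Types (b : place iota0) (r : E) (z w : L).

Definition ext_constants : {rmorphism K -> L} := (in_alg L \o iota0) : {rmorphism K -> L}.

Local Notation pv := place_prevaluation.
Implicit Types P : place ext_constants.

Lemma linear_relation k (z : 'I_k -> L) : (\dim {:L} < k)%N ->
  exists c : 'I_k -> E, (exists i, c i != 0) /\ \sum_i c i *: z i = 0.
Proof.
move=> dk; pose X := [tuple z i | i < k].
have nX : ~~ free X.
  by apply: contraL dk => /eqP; rewrite size_tuple -leqNgt => <-; rewrite dimvS // subvf.
apply: contrapT => H; case/negP: nX; apply/freeP => c Hc i.
apply/eqP/negPn/negP => ci; apply: H; exists c; split; first by exists i.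
rewrite -[RHS]Hc; apply: eq_bigr => j _.
by rewrite -tnth_nth tnth_mktuple.
Qed.

Lemma scale_alg_mul r z : r *: z = r%:A * z.
Proof. by rewrite -scalerAl mul1r. Qed.

Lemma alg_neq0 r : r != 0 -> r%:A != 0 :> L.
Proof. by move=> r0; rewrite scaler_eq0 negb_or r0 oner_neq0. Qed.

Lemma place_scale P r z : r != 0 -> z != 0 -> P (r *: z) = P r%:A + P z.
Proof. by move=> r0 z0; rewrite scale_alg_mul (valM (pv P)) // alg_neq0. Qed.

Lemma restriction_prevaluation (P : place ext_constants) :
  prevaluation iota0 (fun r => P r%:A).
Proof.
case: (pv P) => P0 PC PM PD; split.
- by rewrite scale0r P0.
- by move=> c c0; have := PC c c0.
- by move=> r s r0 s0; rewrite -PM ?alg_neq0 // -scale_alg_mul scalerA.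
- by move=> r s r0 s0 rs0; rewrite scalerDl; apply: PD; rewrite -?scalerDl alg_neq0.
Qed.

(** P cannot be trivial on E: the powers of a uniformizer would then have distinct values even after
    multiplication by nonzero elements of E, hence be independent over E, against the finite degree
    of L. *)
Lemma place_restriction (P : place ext_constants) :
  exists be : place iota0 * int, 0 < be.2 /\ forall r, P r%:A = be.2 * be.1 r.
Proof.
have [b [e [e0 He]]] : exists (b : place iota0) (e : int),
    0 < e /\ forall r, P r%:A = e * b r; last by exists (b, e).
apply: normalize_valuation (restriction_prevaluation P) _.
apply: contrapT => H.
have P0 r : P r%:A = 0.
  by apply/eqP/negPn/negP => Hr; apply: H; exists r.
have [t t0 Pt] := place_uniformizer P.
have [c [[i ci] Hc]] := @linear_relation (\dim {:L}).+1 (fun i => t ^+ i) (ltnSn _).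
suff : \sum_i c i *: t ^+ i != 0 by rewrite Hc eqxx.
apply: (sum_distinct_val (pv P)).
  by exists i; rewrite scaler_eq0 negb_or ci expf_neq0.
have Pc j : c j *: t ^+ j != 0 -> P (c j *: t ^+ j) = j%:Z.
  rewrite scaler_eq0 negb_or => /andP[cj tj].
  by rewrite (place_scale P cj tj) (P0 (c j)) add0r (valX (pv P)) Pt -mulr_natl mulr1 natz.
by move=> j k /Pc -> /Pc -> [/ord_inj].
Qed.

Definition restrict (P : place ext_constants) : place iota0 := (sval (cid (place_restriction P))).1.
Definition ramification (P : place ext_constants) : int := (sval (cid (place_restriction P))).2.

Lemma ramification_gt0 P : 0 < ramification P.
Proof. by rewrite /ramification; case: cid => be []. Qed.

Lemma restrictE P r : P r%:A = ramification P * restrict P r.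
Proof. by rewrite /ramification /restrict; case: cid => be []. Qed.

Lemma restrict_unique P b : (forall r, vge b 0 r -> vge P 0 r%:A) -> restrict P = b.
Proof.
move=> H; apply/esym/place_subring_eq => r br.
have [->|r0] := eqVneq r 0; [by left | right].
have := vge_neq0 (alg_neq0 r0) (H r br); rewrite restrictE.
by have := ramification_gt0 P; move: (ramification P) (restrict P r) => x y; nia.
Qed.

Lemma vge_alg P k r : vge P k (r%:A : L) <-> r = 0 \/ k <= ramification P * restrict P r.
Proof.
have [->|r0] := eqVneq r 0; first by rewrite scale0r; split=> _; left.
have rA := alg_neq0 r0; rewrite -restrictE; split=> [/(vge_neq0 rA)|[r00|]]; try by right.
by rewrite r00 eqxx in r0.
Qed.

(** With more places than the degree of L, approximate idempotents [w i], one for each place,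
    satisfy a relation with coefficients c in E. At the place i where b(c i) is least, the term c i
    w i has strictly smaller value than all others, a contradiction. *)
Lemma size_places_above b (s : seq (place ext_constants)) :
  uniq s -> (forall P, P \in s -> restrict P = b) -> (size s <= \dim {:L})%N.
Proof.
move=> us sb; rewrite leqNgt; apply/negP => dk.
case: s => [//|P0 s0] in us sb dk *; set s := P0 :: s0 in us sb dk.
pose Pl (i : 'I_(size s)) := nth P0 s i.
have Pls i : Pl i \in s by exact: mem_nth.
have Plinj i j : Pl i = Pl j -> i = j.
  by move/eqP; rewrite nth_uniq // => /eqP/ord_inj.
have [w Hw] : {w : 'I_(size s) -> L & forall i, vge (Pl i) 1 (w i - 1) /\
    forall j, j != i -> vge (Pl j) 1 (w i)}.
  suff Hw i : exists w, vge (Pl i) 1 (w - 1) /\ forall j, j != i -> vge (Pl j) 1 w.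
    exact: (boolp.choice Hw).
  have [|w [w1 w2]] := @approximate_idempotent _ _ _ (Pl i) (rem (Pl i) s) 1.
    by rewrite mem_rem_uniq // !inE eqxx.
  exists w; split=> // j ji; apply: w2; rewrite mem_rem_uniq // !inE; apply/andP; split; last exact: Pls.
  by apply: contra_neq ji; exact: Plinj.
have [c [[i0 ci0] Hc]] := linear_relation w dk.
case: (@Order.TotalTheory.arg_minP _ _ _ i0 (fun i => c i != 0) (fun i => b (c i)) ci0) => i ci imin.
have pP := pv (Pl i); set P := Pl i in pP.
have Pb : restrict P = b := sb _ (Pls i).
have e0 := ramification_gt0 P; set e := ramification P in e0.
have [w1 w2] := Hw i.
have Pw : P (w i) = 0.
  rewrite -(subrK 1 (w i)) addrC (valD_lt pP (oner_neq0 _)) (val1 pP) //.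
have w0 : w i != 0.
  apply: contra_eq_neq Pw => wi0; move: w1; rewrite wi0 sub0r => /(vgeN pP).
  by rewrite opprK => /(vge_neq0 (oner_neq0 _)); rewrite (val1 pP).
have : vge P (e * b (c i) + 1) (c i *: w i).
  move: Hc; rewrite (bigD1 i) //= => /eqP; rewrite addr_eq0 => /eqP ->.
  apply: (vgeN pP); apply: (vge_sum pP) => j ji.
  have [->|cj] := eqVneq (c j) 0; first by rewrite scale0r; left.
  rewrite scale_alg_mul; apply: (vgeM pP).
    apply/vge_alg; right; rewrite Pb -/e.
    by have := imin j cj; move: (b _) (b _) e e0 => x y f; nia.
  by have [_] := Hw j; apply; rewrite eq_sym.
have cw0 : c i *: w i != 0 by rewrite scaler_eq0 negb_or ci.
move/(vge_neq0 cw0); rewrite place_scale // Pw restrictE Pb -/e.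
by rewrite addr0 gerDl.
Qed.

Lemma fiber_exists b : exists s : seq (place ext_constants),
  uniq s /\ forall P, P \in s <-> restrict P = b.
Proof.
have ex0 : exists k, `[< exists s : seq (place ext_constants),
    [/\ uniq s, size s = k & forall P, P \in s -> restrict P = b] >].
  by exists 0%N; apply/asboolP; exists [::].
have bnd k : `[< exists s : seq (place ext_constants),
    [/\ uniq s, size s = k & forall P, P \in s -> restrict P = b] >] -> (k <= \dim {:L})%N.
  by move=> /asboolP [s [us <- sb]]; apply: size_places_above sb.
case: (ex_maxnP ex0 bnd) => k /asboolP [s [us sk sb]] kmax.
exists s; split=> // P; split=> [/sb//|Pb]; apply: contraT => Ps.
have : (k.+1 <= k)%N; last by rewrite ltnn.
apply: kmax; apply/asboolP; exists (P :: s); split=> /=; rewrite ?Ps ?sk //.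
by move=> Q; rewrite inE => /orP[/eqP->|/sb].
Qed.

Definition fiber b : seq (place ext_constants) := sval (cid (fiber_exists b)).

Lemma fiber_uniq b : uniq (fiber b).
Proof. by rewrite /fiber; case: cid => s []. Qed.

Lemma mem_fiber b P : (P \in fiber b) = (restrict P == b).
Proof.
rewrite /fiber; case: cid => s [us sP] /=; apply/idP/eqP; by move/sP.
Qed.

(** * Existence of a place above b, by Chevalley's extension argument *)

Section PlaceAbove.
Variable b : place iota0.

(* A maximal such subring is the valuation ring of a place above b; T is a
   uniformizer of b, kept out of the units. *)
Definition admissible (A : set L) (T : L) : Prop :=
  [/\ A 1, forall x y, A x -> A y -> A (x - y), forall x y, A x -> A y -> A (x * y),
      forall r, vge b 0 r -> A r%:A & ~ A T^-1].

Lemma maximal_admissible t : b t = 1 ->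
  exists2 A, admissible A t%:A & forall B, A `<=` B -> admissible B t%:A -> B `<=` A.
Proof.
move=> bt; have pb := pv b; set T := t%:A : L.
have t0 : t != 0 by apply/eqP => t0; rewrite t0 (val0 pb) in bt.
pose R0 : set L := [set z | exists2 r, vge b 0 r & z = r%:A].
have R0adm : admissible R0 T.
  split.
  - by exists 1; [right; rewrite (val1 pb) | rewrite scale1r].
  - by move=> _ _ [r br ->] [s bs ->]; exists (r - s); [exact: (vgeB pb) | rewrite scalerBl].
  - move=> _ _ [r br ->] [s bs ->]; exists (r * s); last by rewrite -scale_alg_mul scalerA.
    by rewrite -[0]addr0; apply: (vgeM pb).
  - by move=> r br; exists r.
  - move=> [r br e]; have r0 : r != 0.
      by apply: contra_eq_neq e => ->; rewrite scale0r invr_eq0 alg_neq0.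
    have : r = t^-1.
      apply: (mulfI t0); rewrite divff //; apply: (fmorph_inj (in_alg L)) => /=.
      by rewrite -scalerA scale_alg_mul -e divff ?scale1r // alg_neq0.
    move=> er; have := vge_neq0 r0 br; rewrite er (valV pb) bt; lia.
(* The empty set is put into the family because the empty chain has empty union; comparison with
   [R0] later excludes it as a maximal element. *)
have [F Fchain Ftot|A [PA Amax]] :=
    @Zorn_bigcup L [set A | A = set0 \/ admissible A T].
  have [[X FX XT]|nF] := pselect (exists2 X, F X & admissible X T); last first.
    left; apply/seteqP; split=> // z [X FX Xz]; case: (Fchain X FX) => [X0|XT].
      by rewrite X0 in Xz.
    by case: nF; exists X.
  have adm Y y : F Y -> Y y -> admissible Y T.
    by move=> FY Yy; case: (Fchain Y FY) => // Y0; rewrite Y0 in Yy.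
  have two x y : (\bigcup_(X in F) X) x -> (\bigcup_(X in F) X) y ->
      exists Y, [/\ F Y, admissible Y T, Y x & Y y].
    move=> [Y FY Yx] [Z FZ Zy]; have [YZ|ZY] := Ftot Y Z FY FZ.
      by exists Z; split=> //; [exact: adm Zy | exact: YZ].
    by exists Y; split=> //; [exact: adm Yx | exact: ZY].
  right; split.
  - by exists X => //; case: XT.
  - by move=> x y /two H /H [Y [FY [_ YB _ _ _] Yx Yy]]; exists Y => //; exact: YB.
  - by move=> x y /two H /H [Y [FY [_ _ YM _ _] Yx Yy]]; exists Y => //; exact: YM.
  - by move=> r br; exists X => //; case: XT => _ _ _ + _; apply.
  - by move=> [Y FY Yt]; case: (adm _ _ FY Yt).
have AT : admissible A T.
  case: PA => // A0; case: (Amax R0); last by right.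
  rewrite A0; split; first by [].
  by move=> H; have := H 1; case: R0adm => R1 _ _ _ _; apply.
exists A => // B AB BT; apply: contrapT => nBA; apply: (Amax B); last by right.
by split.
Qed.

Section MaximalSubring.
Variables (A : set L) (T : L).
Hypotheses (T0 : T != 0) (AT1 : A T) (A_adm : admissible A T)
  (A_max : forall B, A `<=` B -> admissible B T -> B `<=` A).

Let A1 : A 1. Proof. by case: A_adm. Qed.
Let AB x y : A x -> A y -> A (x - y). Proof. by case: A_adm => _ + _ _ _; apply. Qed.
Let AM x y : A x -> A y -> A (x * y). Proof. by case: A_adm => _ _ + _ _; apply. Qed.
Let AR r : vge b 0 r -> A r%:A. Proof. by case: A_adm => _ _ _ + _; apply. Qed.
Let AT : ~ A T^-1. Proof. by case: A_adm. Qed.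
Let A0 : A 0. Proof. by rewrite -(subrr 1); apply: AB. Qed.
Let AN x : A x -> A (- x). Proof. by move=> Ax; rewrite -sub0r; apply: AB. Qed.
Let AD x y : A x -> A y -> A (x + y).
Proof. by move=> Ax Ay; rewrite -[y]opprK; apply: AB => //; apply: AN. Qed.
Let AX x n : A x -> A (x ^+ n).
Proof. by move=> Ax; elim: n => [|n IH]; rewrite ?expr0 // exprS; apply: AM. Qed.
Let ASum (I : Type) (s : seq I) (Q : pred I) (z : I -> L) :
  (forall i, Q i -> A (z i)) -> A (\sum_(i <- s | Q i) z i).
Proof. by move=> H; apply: (big_ind A). Qed.

(** T lies in the Jacobson radical of A. Powers of s = 1 - T a are 1 modulo T A, so T^-1 stays
    outside A[s^-1], and maximality puts s^-1 in A. *)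
Lemma adm_jacobson a : A a -> A (1 - T * a)^-1.
Proof.
move=> Aa; set s := 1 - T * a.
have s0 : s != 0.
  rewrite subr_eq0; apply/eqP => e; apply: AT.
  by rewrite -[T^-1]mulr1 e mulKf.
pose B : set L := [set z | exists k : nat, A (z * s ^+ k)].
have As : A s by apply: AB => //; exact: AM.
have sX k : exists2 c, A c & s ^+ k = 1 - T * c.
  elim: k => [|k [c Ac e]]; first by exists 0; rewrite ?expr0 ?mulr0 ?subr0.
  exists (a + c - T * (a * c)); first by apply: AB; [exact: AD | apply: AM => //; exact: AM].
  by rewrite exprS e /s; ring.
have BA : B `<=` A.
  apply: A_max => [x Ax|]; first by exists 0%N; rewrite expr0 mulr1.
  split.
  - by exists 0%N; rewrite expr0 mulr1.
  - move=> x y [k Hx] [l Hy]; exists (k + l)%N; rewrite mulrBl; apply: AB.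
      by rewrite exprD mulrA; apply: AM => //; exact: AX.
    by rewrite addnC exprD mulrA; apply: AM => //; exact: AX.
  - move=> x y [k Hx] [l Hy]; exists (k + l)%N.
    by rewrite exprD mulrACA; apply: AM.
  - by move=> r br; exists 0%N; rewrite expr0 mulr1; exact: AR.
  - move=> [k]; have [c Ac ->] := sX k => H; apply: AT.
    have -> : T^-1 = T^-1 * (1 - T * c) + c by field.
    exact: AD.
by apply: BA; exists 1%N; rewrite expr1 mulVf.
Qed.

(** A[z] is strictly larger than A, so by maximality it contains T^-1. *)
Lemma adm_adjoin z : ~ A z -> exists2 g : {poly L}, (forall i, A g`_i) & T * g.[z] = 1.
Proof.
move=> nAz; pose B : set L := [set w | exists2 g : {poly L}, (forall i, A g`_i) & w = g.[z]].
have [[g Ag e]|nBT] := pselect (B T^-1); first by exists g; rewrite // -e divff.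
case: nAz; have BA : B `<=` A.
  apply: A_max => [x Ax|].
    by exists x%:P; [move=> i; rewrite coefC; case: ifP | rewrite hornerC].
  split=> //.
  - by exists 1; [move=> i; rewrite coefC; case: ifP | rewrite hornerC].
  - move=> x y [g Ag ->] [h Ah ->]; exists (g - h); last by rewrite !hornerE.
    by move=> i; rewrite coefB; apply: AB.
  - move=> x y [g Ag ->] [h Ah ->]; exists (g * h); last by rewrite hornerM.
    by move=> i; rewrite coefM; apply: ASum => j _; apply: AM.
  - move=> r br; exists (r%:A)%:P; last by rewrite hornerC.
    by move=> i; rewrite coefC; case: ifP => // _; exact: AR.
by apply: BA; exists 'X; [move=> i; rewrite coefX; case: eqP | rewrite hornerX].
Qed.

(** Let deg h <= deg g = N, which costs nothing as z and z^-1 play symmetric roles. Multiplied by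
    z^N, the relation for h expresses (1 - T h_0) z^N by lower powers, and 1 - T h_0 is a unit of A.
    Replacing the leading term of g in this way gives a smaller relation of the same kind, and
    descent ends in a contradiction. *)
Lemma adm_minimal_relation n z (g h : {poly L}) : (size g + size h <= n)%N -> z != 0 ->
  (forall i, A g`_i) -> T * g.[z] = 1 ->
  (forall i, A h`_i) -> T * h.[z^-1] = 1 -> False.
Proof.
elim: n z g h => [|n IH] z g h.
  rewrite leqn0 addn_eq0 size_poly_eq0 => /andP[/eqP -> _] _ _.
  by rewrite horner0 mulr0 => /eqP; rewrite eq_sym oner_eq0.
wlog gh : z g h / (size h <= size g)%N => [Hwlog|].
  have [|/ltnW hg] := leqP (size h) (size g); first exact: Hwlog.
  move=> sn z0 Ag e Ah e'; apply: (Hwlog z^-1 h g) => //; rewrite ?invr_eq0 ?invrK //.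
  by rewrite addnC.
move=> sn z0 Ag eg Ah eh.
have sg : (0 < size g)%N.
  rewrite size_poly_gt0; apply/eqP => g0; move/eqP: eg.
  by rewrite g0 horner0 mulr0 eq_sym oner_eq0.
have sh : (0 < size h)%N.
  rewrite size_poly_gt0; apply/eqP => h0; move/eqP: eh.
  by rewrite h0 horner0 mulr0 eq_sym oner_eq0.
pose N := (size g).-1; pose u := (1 - T * h`_0)^-1.
have Au : A u by exact: adm_jacobson.
have u0 : 1 - T * h`_0 != 0.
  rewrite subr_eq0; apply/eqP => e; apply: AT.
  by rewrite -[T^-1]mulr1 e mulKf.
pose H := \sum_(j < (size h).-1) h`_j.+1 *: 'X^(N - j.+1).
have AH i : A H`_i.
  rewrite coef_sum; apply: ASum => j _; rewrite coefZ coefXn.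
  by case: eqP => _; rewrite ?mulr1 ?mulr0.
have sH : (size H <= N)%N.
  apply: (leq_trans (size_sum _ _ _)); apply/bigmax_leqP => j _.
  apply: (leq_trans (size_scale_leq _ _)); rewrite size_polyXn.
  have := ltn_ord j; rewrite /N; move: gh sg sh; lia.
have zN : z ^+ N = T * u * H.[z].
  have eN : T * (h`_0 * z ^+ N + H.[z]) = z ^+ N.
    rewrite -[RHS]mul1r -eh -!mulrA; congr (_ * _).
    have -> : h.[z^-1] = h`_0 + \sum_(j < (size h).-1) h`_j.+1 * z^-1 ^+ j.+1.
      by rewrite horner_coef; case: (size h) sh => // k _; rewrite big_ord_recl expr0 mulr1.
    rewrite mulrDl; congr (_ + _).
    rewrite horner_sum mulr_suml; apply: eq_bigr => j _; rewrite !hornerE -mulrA; congr (_ * _).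
    rewrite expfB_cond ?(negPf z0); first by rewrite exprVn mulrC.
    by have := ltn_ord j; rewrite /N; move: gh sg sh; lia.
  have -> : T * u * H.[z] = u * (T * (h`_0 * z ^+ N + H.[z]) - T * h`_0 * z ^+ N) by ring.
  by rewrite eN -[X in X - _]mul1r -mulrBl mulKf.
pose g' := \poly_(i < N) g`_i.
have eg' : g.[z] = g'.[z] + g`_N * z ^+ N.
  rewrite horner_poly horner_coef /N; case: (size g) sg => // k _; exact: big_ord_recr.
have sk : (size (g' + (g`_N * T * u) *: H)%R <= N)%N.
  rewrite (leq_trans (size_polyD _ _)) // geq_max size_poly /=.
  exact: leq_trans (size_scale_leq _ _) sH.
apply: (IH z (g' + (g`_N * T * u) *: H) h) => //.
- apply: leq_trans (leq_add sk (leqnn _)) _.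
  by move: sn sg; rewrite /N; case: (size g).
- move=> i; rewrite coefD coefZ; apply: AD; last by do 3?apply: AM.
  by rewrite coef_poly; case: ifP.
- by rewrite hornerD hornerZ -[RHS]eg eg' zN; ring.
Qed.

Lemma adm_valuation_ring z : z != 0 -> A z \/ A z^-1.
Proof.
move=> z0; have [|nz] := pselect (A z); [by left | right; apply: contrapT => nzV].
have [g Ag eg] := adm_adjoin nz; have [h Ah eh] := adm_adjoin nzV.
exact: (adm_minimal_relation (leqnn _) z0 Ag eg Ah eh).
Qed.

Definition adm_unit z := A z /\ A z^-1.

Lemma adm_unitM z w : adm_unit z -> adm_unit w -> adm_unit (z * w).
Proof. by move=> [? ?] [? ?]; split; rewrite ?invfM; apply: AM. Qed.

Lemma adm_unitV z : adm_unit z -> adm_unit z^-1.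
Proof. by case=> ? ?; split; rewrite ?invrK. Qed.

Lemma adm_unitX z n : adm_unit z -> adm_unit (z ^+ n).
Proof. by case=> ? ?; split; rewrite -?exprVn; apply: AX. Qed.

Lemma adm_unit_uniformizer (l : int) : adm_unit (T ^ l) -> l = 0.
Proof.
have nat_case (n : nat) : A (T ^+ n)^-1 -> n = 0%N.
  case: n => // n An; case: AT.
  have -> : T^-1 = T ^+ n * (T ^+ n.+1)^-1 by rewrite exprS invfM mulrCA mulfV ?mulr1 ?expf_neq0.
  by apply: AM => //; exact: AX.
case: l => n [H1 H2]; first by rewrite (nat_case n).
by have := nat_case n.+1; rewrite NegzE -invr_expz in H1 => /(_ H1).
Qed.

Lemma adm_least (I : eqType) (f : I -> L) (s : seq I) : s != [::] -> (forall i, f i != 0) ->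
  exists2 i, i \in s & forall j, j \in s -> A (f j / f i).
Proof.
elim: s => // i [|i' s] IH _ f0.
  by exists i; rewrite ?mem_head // => j; rewrite inE => /eqP ->; rewrite divff.
have [//|//|k ks Hk] := IH; have ki0 : f k / f i != 0 by rewrite mulf_neq0 ?invr_eq0.
have [ki|ik] := adm_valuation_ring ki0.
  exists i; first by rewrite mem_head.
  move=> j; rewrite inE => /orP[/eqP ->|/Hk js]; first by rewrite divff.
  by have -> : f j / f i = (f j / f k) * (f k / f i); [rewrite mulrA divfK | exact: AM].
exists k; first by rewrite inE ks orbT.
by move=> j; rewrite inE => /orP[/eqP ->|/Hk //]; rewrite -invf_div.
Qed.

(** The maximal ideal of A. Zero is listed apart because its inverse is 0, which belongs to A. *)
Definition adm_nonunit z := z = 0 \/ A z /\ ~ A z^-1.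

Lemma adm_nonunitD x y : adm_nonunit x -> adm_nonunit y -> adm_nonunit (x + y).
Proof.
have [->|x0] := eqVneq x 0; first by rewrite add0r.
have [->|y0] := eqVneq y 0; first by rewrite addr0.
have [e|xy0] := eqVneq (x + y) 0; first by left.
wlog xy : x y x0 y0 xy0 / A (x / y) => [H Hx Hy|].
  have xy'0 : x / y != 0 by rewrite mulf_neq0 ?invr_eq0.
  case: (adm_valuation_ring xy'0) => [|yx]; first by move=> ?; apply: H.
  by rewrite addrC; apply: H => //; [rewrite addrC | rewrite -invf_div].
case=> [e|[Ax nx]]; first by rewrite e eqxx in x0.
case=> [e|[Ay ny]]; first by rewrite e eqxx in y0.
right; split; first exact: AD.
move=> H; apply: ny; have -> : y^-1 = (1 + x / y) * (x + y)^-1.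
  by apply: (mulIf xy0); rewrite mulfVK // mulrDr mulVf // addrC mulrC.
by apply: AM => //; exact: AD.
Qed.

(** In a relation among powers of z over E, divide by a term f i of least value. The other quotients
    sum to -1, a unit, so they are not all nonunits: some term f j has the same value as f i, and
    z^|j - i| has the value of an element of E. *)
Lemma adm_power_unit z : z != 0 ->
  exists (k : nat) (r : E), [/\ (0 < k)%N, (k <= \dim {:L})%N, r != 0 & adm_unit (z ^+ k * r%:A)].
Proof.
move=> z0; have [c [[i0 ci0] Hc]] := @linear_relation (\dim {:L}).+1 (fun i => z ^+ i) (ltnSn _).
pose I := [seq i <- enum 'I_(\dim {:L}).+1 | c i != 0].
(* Vanishing terms are replaced by 1 to meet the nonvanishing hypothesis of [adm_least]; the list
   [I] leaves them out. *)
pose f (i : 'I_(\dim {:L}).+1) := if c i == 0 then 1 else c i *: z ^+ i.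
have f0 i : f i != 0.
  by rewrite /f; case: ifPn => ci; rewrite ?oner_neq0 // scaler_eq0 negb_or ci expf_neq0.
have I0 : I != [::].
  have : i0 \in I by rewrite mem_filter ci0 mem_enum.
  by apply: contraL => /eqP ->.
have [i iI Hi] := adm_least I0 f0.
have [j [jI ji Hj]] : exists j, [/\ j \in I, j != i & adm_unit (f j / f i)].
  apply: contrapT => H.
  have N j : c j != 0 -> j != i -> adm_nonunit (f j / f i).
    move=> cj ji; have jI : j \in I by rewrite mem_filter cj mem_enum.
    right; split; first exact: Hi.
    by move=> Hj; apply: H; exists j; split=> //; split=> //; exact: Hi.
  have : adm_nonunit (\sum_(j | j != i) c j *: z ^+ j / f i).
    apply: (big_ind adm_nonunit); [by left | exact: adm_nonunitD | move=> j ji].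
    have [cj|cj] := eqVneq (c j) 0; first by rewrite cj scale0r mul0r; left.
    by have := N j cj ji; rewrite {1}/f (negPf cj).
  rewrite -mulr_suml; move: Hc; rewrite (bigD1 i) //= addrC => /eqP; rewrite addr_eq0 => /eqP ->.
  have fi : f i = c i *: z ^+ i.
    by rewrite /f; case: eqP => // ci; move: iI; rewrite mem_filter ci eqxx.
  rewrite -fi mulNr divff //; case=> [/eqP|[_]]; first by rewrite oppr_eq0 oner_eq0.
  by rewrite invrN1; apply; exact: AN.
have [ci cj] : c i != 0 /\ c j != 0 by move: iI jI; rewrite !mem_filter => /andP[-> _] /andP[-> _].
wlog ij : i j {iI jI Hi} ji ci cj Hj / (i < j)%N => [Hw|].
  have [ij|ij|/ord_inj e] := ltngtP i j; first exact: (Hw i j).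
    have := adm_unitV Hj; rewrite invf_div => Hj'.
    by rewrite eq_sym in ji; exact: (Hw j i).
  by rewrite e eqxx in ji.
exists (j - i)%N, (c j / c i); split.
- by rewrite subn_gt0.
- by rewrite (leq_trans (leq_subr _ _)) // -ltnS.
- by rewrite mulf_neq0 ?invr_eq0.
- move: Hj; rewrite /f (negPf ci) (negPf cj); congr adm_unit.
  rewrite (scale_alg_mul (c j)) (scale_alg_mul (c i) (z ^+ i)) -[in LHS](subnK (ltnW ij)) exprD.
  have -> : (c j / c i)%:A = (c j)%:A / (c i)%:A :> L by exact: (fmorph_div (in_alg L)).
  have := alg_neq0 ci; have := expf_neq0 i z0.
  by move: (z ^+ i) (z ^+ (j - i)) (c i)%:A (c j)%:A => u v x y u0 x0; field; rewrite x0 u0.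
Qed.

Hypothesis unitR : forall r, r != 0 -> exists l : int, adm_unit (r%:A * T ^ l).

Lemma adm_value z : z != 0 -> exists l : int, adm_unit (z ^+ (\dim {:L})`! * T ^ (- l)).
Proof.
move=> z0; have [k [r [k0 kn r0 Hu]]] := adm_power_unit z0.
have [l Hl] := unitR r0.
have kd : (k %| (\dim {:L})`!)%N by rewrite dvdn_fact // k0.
exists (l * ((\dim {:L})`! %/ k)%N%:Z).
have -> : z ^+ (\dim {:L})`! * T ^ (- (l * ((\dim {:L})`! %/ k)%N%:Z)) =
    ((z ^+ k * r%:A) * (r%:A * T ^ l)^-1) ^+ ((\dim {:L})`! %/ k).
  rewrite invfM mulrA mulfK ?alg_neq0 // exprMn -exprM.
  rewrite mulnC divnK //; congr (_ * _).
  by rewrite -mulNr -exprz_exp -invr_expz.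
by apply: adm_unitX; apply: adm_unitM => //; exact: adm_unitV.
Qed.

Local Notation N := (\dim {:L})`!.

(* The valuation is not known to be discrete beforehand: only some power z^k,
   with k at most the degree of L, has the same value as an element of the base
   field, so z^N serves for all z at once. *)
Definition adm_val z : int := if z == 0 then 0 else xget 0 [set l : int | adm_unit (z ^+ N * T ^ (- l))].

Lemma adm_valE z (l : int) : z != 0 -> adm_unit (z ^+ N * T ^ (- l)) -> adm_val z = l.
Proof.
move=> z0 Hl; rewrite /adm_val (negPf z0); case: xgetP => [l' _ Hl'|/(_ l)//].
have : adm_unit (T ^ (l' - l)).
  have -> : T ^ (l' - l) = (z ^+ N * T ^ (- l)) * (z ^+ N * T ^ (- l'))^-1.
    rewrite invfM invr_expz opprK mulrACA divff ?expf_neq0 // mul1r addrC.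
    by rewrite expfzDr.
  by apply: adm_unitM => //; exact: adm_unitV.
by move/adm_unit_uniformizer/eqP; rewrite subr_eq0 => /eqP.
Qed.

Lemma adm_valP z : z != 0 -> adm_unit (z ^+ N * T ^ (- adm_val z)).
Proof. by move=> z0; have [l Hl] := adm_value z0; rewrite (adm_valE z0 Hl). Qed.

Lemma adm_valM z w : z != 0 -> w != 0 -> adm_val (z * w) = adm_val z + adm_val w.
Proof.
move=> z0 w0; apply: adm_valE; first exact: mulf_neq0.
rewrite exprMn opprD expfzDr // mulrACA.
by apply: adm_unitM; exact: adm_valP.
Qed.

Lemma adm_val_ge0 z : z != 0 -> A z <-> 0 <= adm_val z.
Proof.
have pos x : x != 0 -> A x -> 0 <= adm_val x.
  move=> x0 Ax; have := adm_valP x0; case: (adm_val x) => // n.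
  rewrite NegzE opprK => -[_ H]; case: AT.
  have -> : T^-1 = x ^+ N * T ^+ n * (x ^+ N * T ^ n.+1%:Z)^-1.
    rewrite -exprnP exprS invfM mulrACA divff ?expf_neq0 // mul1r.
    by rewrite invfM mulrCA mulfV ?mulr1 ?expf_neq0.
  by apply: AM => //; apply: AM; exact: AX.
move=> z0; split; first exact: pos.
move=> vz; have [//|zV] := adm_valuation_ring z0.
have vV : adm_val z^-1 = - adm_val z.
  apply/eqP; rewrite -addr_eq0 -adm_valM ?invr_eq0 // mulVf //; apply/eqP.
  by apply: adm_valE; rewrite ?oner_neq0 // expr1n oppr0 expr0z mulr1; split; rewrite ?invr1.
have z00 : adm_val z = 0.
  by apply/eqP; rewrite eq_le vz andbT -oppr_ge0 -vV; apply: pos; rewrite ?invr_eq0.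
have := adm_valP z0; rewrite z00 oppr0 expr0z mulr1 => -[H _].
have N0 : (0 < N)%N by exact: fact_gt0.
(* Here z has value 0 and z^-1 lies in A; as z^N is a unit, z is recovered as z^N times a power of
   z^-1. *)
have -> : z = z ^+ N * z^-1 ^+ N.-1.
  by rewrite -{1}(prednK N0) exprS exprVn mulfK ?expf_neq0.
by apply: AM => //; exact: AX.
Qed.

Lemma adm_prevaluation : prevaluation ext_constants adm_val.
Proof.
have val1 : adm_val 1 = 0.
  by apply: adm_valE; rewrite ?oner_neq0 // expr1n oppr0 expr0z mulr1; split; rewrite ?invr1.
split.
- by rewrite /adm_val eqxx.
- move=> c c0; have pb := pv b; have ic0 : iota0 c != 0 by rewrite fmorph_eq0.
  have cA (d : K) : d != 0 -> A (iota0 d)%:A.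
    by move=> d0; apply: AR; right; case: pb => _ -> .
  have cP (d : K) : d != 0 -> 0 <= adm_val (ext_constants d).
    by move=> d0; apply/adm_val_ge0; [rewrite fmorph_eq0 | exact: cA].
  have : adm_val (ext_constants c) + adm_val (ext_constants c^-1) = 0.
    by rewrite -adm_valM ?fmorph_eq0 ?invr_eq0 // -rmorphM divff // rmorph1.
  move=> /eqP; rewrite addr_eq0 => /eqP e; apply/eqP.
  by rewrite eq_le cP // andbT e oppr_le0 cP // invr_eq0.
- exact: adm_valM.
- move=> z w; wlog zw : z w / adm_val z <= adm_val w => [H z0 w0 zw0|z0 w0 zw0].
    have [zw|/ltW wz] := leP (adm_val z) (adm_val w); first by have := H z w zw z0 w0 zw0; rewrite min_l.
    by have := H w z wz w0 z0; rewrite addrC min_l //; apply.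
  rewrite min_l //; have q0 : w / z != 0 by rewrite mulf_neq0 ?invr_eq0.
  have Aq : A (w / z).
    apply/adm_val_ge0 => //; have : adm_val (w / z) + adm_val z = adm_val w.
      by rewrite -adm_valM // divfK.
    by move: zw; lia.
  have e : z + w = z * (1 + w / z) by rewrite mulrDr mulr1 mulrC divfK.
  have s0 : 1 + w / z != 0 by apply: contra_neq zw0 => s0; rewrite e s0 mulr0.
  rewrite e adm_valM // lerDl; apply/adm_val_ge0 => //; exact: AD.
Qed.

Lemma adm_val_uniformizer : adm_val T = N%:Z.
Proof.
apply: adm_valE => //; rewrite -invr_expz -exprnP divff ?expf_neq0 //.
by split; rewrite ?invr1.
Qed.

End MaximalSubring.

Lemma place_above : exists P, restrict P = b.
Proof.
have pb := pv b; have [t t0 bt] := place_uniformizer b.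
have [A Aadm Amax] := maximal_admissible bt; set T := t%:A in Aadm Amax.
have T0 : T != 0 by exact: alg_neq0.
have [A1 AB AM AR AT] := Aadm.
have AT1 : A T by apply: AR; right; rewrite bt.
have unitR r : r != 0 -> exists l : int, adm_unit A (r%:A * T ^ l).
  (* On E a power of the uniformizer t of b turns r into a unit of the valuation ring of b. *)
  move=> r0; exists (- b r); have -> : r%:A * T ^ (- b r) = (r * t ^ (- b r))%:A :> L.
    rewrite -[RHS]/(in_alg L _) rmorphM; congr (_ * _).
    by rewrite [RHS](fmorphXz (in_alg L)).
  have s0 : r * t ^ (- b r) != 0 by rewrite mulf_neq0 ?expfz_neq0.
  have bs : b (r * t ^ (- b r)) = 0.
    by rewrite (valM pb) ?expfz_neq0 // (valXz pb) bt mulr1 addrN.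
  split; first by apply: AR; right; rewrite bs.
  have -> : ((r * t ^ (- b r))%:A : L)^-1 = ((r * t ^ (- b r))^-1)%:A.
    by apply/esym; exact: (fmorphV (in_alg L)).
  by apply: AR; right; rewrite (valV pb) bs.
have vP := adm_prevaluation T0 AT1 Aadm Amax unitR.
have [|P [e [e0 He]]] := normalize_valuation vP.
  by exists T; rewrite (adm_val_uniformizer T0 AT1 Aadm); have := fact_gt0 (\dim {:L}); lia.
exists P; apply: restrict_unique => r br.
have [->|r0] := eqVneq r 0; [by left; rewrite scale0r | right].
have := (adm_val_ge0 T0 AT1 Aadm Amax unitR (alg_neq0 r0)).1 (AR _ br).
by rewrite He; move: (P _) => x; nia.
Qed.

End PlaceAbove.
End Extension.

(** * Kummer extensions of degree q - 1 *)

(** The translation c -> c + 1 permutes K, so the sum of all elements equals itself plus #K. *)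
Lemma card_finField_eq0 (K : finFieldType) : #|K|%:R = 0 :> K.
Proof.
have H : \sum_(c : K) c = \sum_(c : K) c + #|K|%:R.
  rewrite [LHS](reindex_onto (fun c => c + 1) (fun c => c - 1)) /=; last by move=> c _; rewrite subrK.
  rewrite (eq_bigl xpredT) => [|c]; last by rewrite addrK eqxx.
  by rewrite big_split /= sumr_const.
by apply/eqP; rewrite -(inj_eq (addrI (\sum_(c : K) c))) -H addr0.
Qed.

(** For k = 0 the sum is #K - 1, that is -1. For 0 < k < #K - 1 some g has g^k different from 1, and
    reindexing by c -> g c shows that the sum is fixed by multiplication by g^k, hence zero. *)
Lemma sum_unit_powers (K : finFieldType) (k : nat) : (k < #|K|.-1)%N ->
  \sum_(c : K | c != 0) c ^+ k = - (k == 0)%:R.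
Proof.
move=> kn; have K1 : #|[pred c : K | c != 0]| = #|K|.-1 by rewrite (cardC1 (0 : K)).
have [k0|k0] /= := eqVneq k 0%N.
  rewrite (eq_bigr (fun=> 1)) => [|c _]; last by rewrite k0 expr0.
  rewrite sumr_const K1; apply/eqP; rewrite -subr_eq0 opprK -mulrSr prednK.
    by rewrite card_finField_eq0.
  by rewrite (cardD1 (0 : K)).
have [g g0 gk] : exists2 g : K, g != 0 & g ^+ k != 1.
  apply: contrapT => H.
  have k1 : (0 < k)%N by rewrite lt0n.
  have : (#|K|.-1 <= k)%N; last by rewrite leqNgt kn.
  have P0 : 'X^k - 1 != 0 :> {poly K}.
    by rewrite -size_poly_gt0 size_XnsubC.
  pose s := enum [pred c : K | c != 0].
  have : (size s < size ('X^k - 1 : {poly K})%R)%N.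
    apply: max_poly_roots => //; last exact: enum_uniq.
    apply/allP => c; rewrite mem_enum inE => c0.
    rewrite rootE !hornerE subr_eq0; apply/negPn/negP => ck; apply: H; by exists c.
  by rewrite size_XnsubC // ltnS -cardE K1.
set S := \sum_(c | _) _; rewrite oppr0; apply/eqP.
have : g ^+ k * S = S.
  rewrite /S mulr_sumr [RHS](reindex_onto (fun c => g * c) (fun c => g^-1 * c)) /=; last first.
    by move=> c c0; rewrite mulrA divff ?mul1r.
  apply: eq_big => c; last by rewrite exprMn.
  by rewrite mulf_eq0 (negPf g0) /= mulKf // eqxx andbT.
move/eqP; rewrite -subr_eq0 -[X in _ - X]mul1r -mulrBl mulf_eq0 subr_eq0.
by case/orP => // gk1; rewrite gk1 in gk.
Qed.

Lemma coprimez_dvd_mul (d e x : int) : coprimez d x -> (d %| e * x)%Z -> (d %| e)%Z.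
Proof. by move=> cdx; rewrite Gauss_dvdzl. Qed.

Lemma natr_sum_posz (I : Type) (s : seq I) (Q : pred I) (F : I -> nat) :
  (\sum_(i <- s | Q i) F i)%N%:Z = \sum_(i <- s | Q i) (F i)%:Z.
Proof. by rewrite (big_morph Posz PoszD (erefl 0%:Z)). Qed.

Lemma divz_unique (a q e : int) : 0 < e -> q * e <= a < (q + 1) * e -> (a %/ e)%Z = q.
Proof.
move=> e0 /andP[qa aq]; apply/eqP; rewrite eq_le lez_divRL // qa andbT.
by rewrite -ltzD1 ltz_divLR.
Qed.

Lemma leq_divz (a a' e : int) : 0 < e -> a <= a' -> (a %/ e)%Z <= (a' %/ e)%Z.
Proof.
move=> e0 aa; rewrite lez_divRL //; apply: le_trans aa; apply: lez_floor.
by rewrite gt_eqF.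
Qed.

Lemma divz_pred (a e : int) : 0 < e ->
  ((a - 1) %/ e)%Z = if (e %| a)%Z then (a %/ e)%Z - 1 else (a %/ e)%Z.
Proof.
move=> e0; have e0' : e != 0 by rewrite gt_eqF.
have := divz_eq a e; have := modz_ge0 a e0'; have := ltz_pmod a e0.
case: ifPn => [/dvdz_mod0P ->|nea] r1 r2 ae.
  by apply: divz_unique => //; move: ae; move: (a %/ e)%Z => q ->; apply/andP; split; lia.
have : (a %% e)%Z != 0 by apply: contra nea => /eqP/dvdz_mod0P.
move: ae r1 r2; move: (a %% e)%Z => r ae r1 r2 r0.
by apply: divz_unique => //; move: ae; move: (a %/ e)%Z => q ->; nia.
Qed.

Lemma eq_of_small_diff (N i j : nat) :
  (i < N)%N -> (j < N)%N -> (N%:Z %| i%:Z - j%:Z)%Z -> i = j.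
Proof.
move=> iN jN /dvdzP [x]; have [->|x0] := eqVneq x 0; first by lia.
have [x1|x1] := leP x (-1); [by nia | by have : 1 <= x; [lia | nia]].
Qed.

Lemma sum_ord_id (e : nat) : 2 * \sum_(i < e) i%:Z = e%:Z * (e%:Z - 1).
Proof.
elim: e => [|e IH]; first by rewrite big_ord0 mul0r mulr0.
by rewrite big_ord_recr mulrDr IH /= -[e.+1]addn1 PoszD; ring.
Qed.

(** Since c is invertible modulo e, the map i -> i c + m permutes the residues modulo e. *)
Lemma sum_modz_period (e : nat) (m c : int) : (0 < e)%N -> coprimez e%:Z c ->
  \sum_(i < e) ((i%:Z * c + m) %% e%:Z)%Z = \sum_(i < e) i%:Z.
Proof.
move=> e0 cop; have e0' : e%:Z != 0 by rewrite eqz_nat -lt0n.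
have e0z : 0 < e%:Z by rewrite ltz_nat.
have lt (i : nat) : (`|((i%:Z * c + m) %% e%:Z)%Z| < e)%N.
  by rewrite -ltz_nat gez0_abs ?modz_ge0 // ltz_pmod.
pose g (i : 'I_e) : 'I_e := Ordinal (lt i).
have ginj : injective g.
  move=> i j /(congr1 val) /= /(congr1 Posz); rewrite !gez0_abs ?modz_ge0 // => H.
  apply: ord_inj; apply: (eq_of_small_diff (ltn_ord i) (ltn_ord j)).
  apply: (coprimez_dvd_mul cop); rewrite mulrBl.
  have -> : i%:Z * c - j%:Z * c = (i%:Z * c + m) - (j%:Z * c + m) by ring.
  by rewrite -eqz_mod_dvd H.
rewrite [RHS](reindex_inj ginj); apply: eq_bigr => i _ /=.
by rewrite gez0_abs // modz_ge0.
Qed.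

(** Over one period the remainders of i c + m run through 0, ..., e - 1, which gives the sum of the
    floors; each further block of e terms raises every floor by c. With e d = n, the last term d (e
    - 1) = n - d is the ramification contribution to the genus. *)
Lemma sum_divz_period (e d : nat) (m c : int) : (0 < e)%N -> coprimez e%:Z c ->
  2 * \sum_(i < e * d) ((i%:Z * c + m) %/ e%:Z)%Z =
  2 * d%:Z * m + c * d%:Z * ((e * d)%N%:Z - 1) - d%:Z * (e%:Z - 1).
Proof.
move=> e0 cop; have e0' : e%:Z != 0 by rewrite eqz_nat -lt0n.
have block : 2 * \sum_(i < e) ((i%:Z * c + m) %/ e%:Z)%Z = 2 * m + c * (e%:Z - 1) - (e%:Z - 1).
  apply: (mulIf e0'); rewrite -mulrA mulr_suml.
  have -> : \sum_(i < e) ((i%:Z * c + m) %/ e%:Z)%Z * e%:Z =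
      (\sum_(i < e) i%:Z) * c + e%:Z * m - \sum_(i < e) i%:Z.
    rewrite -{2}(sum_modz_period m e0 cop) mulr_suml.
    have -> : e%:Z * m = \sum_(i < e) m by rewrite sumr_const card_ord -mulr_natl natz.
    by rewrite -big_split -sumrB; apply: eq_bigr => i _ /=; rewrite {2}(divz_eq (i%:Z * c + m) e%:Z) addrK.
  by have := sum_ord_id e; move: (\sum_(i < e) _) => S HS; rewrite mulrBr mulrDr mulrA HS; ring.
elim: d => [|d IH]; first by rewrite muln0 big_ord0; ring.
rewrite mulnS addnC big_split_ord /= mulrDr IH.
have -> : \sum_(i < e) (((e * d + i)%N%:Z * c + m) %/ e%:Z)%Z =
    e%:Z * (d%:Z * c) + \sum_(i < e) ((i%:Z * c + m) %/ e%:Z)%Z.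
  have -> : e%:Z * (d%:Z * c) = \sum_(i < e) d%:Z * c by rewrite sumr_const card_ord -mulr_natl natz.
  rewrite -big_split; apply: eq_bigr => i _ /=.
  rewrite PoszD PoszM mulrDl -addrA -mulrA [e%:Z * _]mulrC divzMDl //.
by rewrite [2 * (e%:Z * _ + _)]mulrDr block PoszD PoszM -[d.+1]addn1 PoszD; ring.
Qed.

Lemma cyclic_diff (N i j : nat) : (i < N)%N -> (j < N)%N ->
  let k := if (i <= j)%N then (j - i)%N else (N + j - i)%N in
  (k < N)%N /\ (k == 0)%N = (i == j).
Proof.
by move=> iN jN /=; case: (leqP i j) => ij; (split; first lia); apply/eqP/eqP; lia.
Qed.

(** * The extension y^n = f: basis, Galois action and ramification *)

Section Kummer.
Variables (K : finFieldType) (E : fieldType) (iota0 : {rmorphism K -> E}) (L : fieldExtType E).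
Variables (y : L) (f : E) (n : nat).
Local Notation iota := (ext_constants iota0 L).
Local Notation pv := place_prevaluation.
Hypotheses (card_K : #|K| = n.+1) (f0 : f != 0) (y_pow : y ^+ n = f%:A) (y_gen : <<1%VS; y>>%VS = fullv)
  (b_tot : place iota0) (b_totP : coprimez n%:Z (b_tot f)).
Implicit Types (b : place iota0) (P : place iota) (r : E) (z w : L).

Let n_gt0 : (0 < n)%N.
Proof. by have := finNzRing_gt1 K; rewrite card_K. Qed.

Lemma kummer_gen_neq0 : y != 0.
Proof.
apply: contra_eq_neq y_pow => ->; rewrite expr0n -[_ == 0%N]negbK -lt0n n_gt0 eq_sym.
exact: alg_neq0.
Qed.
Local Notation y0 := kummer_gen_neq0.

Lemma kummer_gen_val P : n%:Z * P y = ramification P * restrict P f.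
Proof. by rewrite -restrictE -y_pow (valX (pv P)) -mulr_natl natz. Qed.

Definition kummer_powers : n.-tuple L := [tuple y ^+ i | i < n].

(** At a place P above [b_tot], two terms c_j y^j and c_k y^k of equal value would make n divide (j
    - k) b_tot(f), hence j - k. The values are therefore distinct and no cancellation occurs. *)
Lemma kummer_free : free kummer_powers.
Proof.
have [P Pb] := place_above L b_tot.
apply/freeP => c Hc i; apply/eqP/negPn/negP => ci.
have e0 := ramification_gt0 P; have yP := kummer_gen_val P; rewrite Pb in yP.
suff : \sum_(j < n) c j *: y ^+ j != 0.
  by rewrite -[X in X != 0](_ : 0 = _) ?eqxx // -[LHS]Hc; apply: eq_bigr => j _; rewrite -tnth_nth tnth_mktuple.
apply: (sum_distinct_val (pv P)).
  by exists i; rewrite scaler_eq0 negb_or ci expf_neq0 // y0.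
have Pc j : c j *: y ^+ j != 0 -> P (c j *: y ^+ j) = ramification P * b_tot (c j) + j%:Z * P y.
  rewrite scaler_eq0 negb_or => /andP[cj yj].
  by rewrite (place_scale P cj yj) restrictE Pb (valX (pv P)) -[_ *+ j]mulr_natl natz.
move=> j k /Pc -> /Pc -> H; apply: ord_inj.
apply: (eq_of_small_diff (ltn_ord j) (ltn_ord k)).
apply: (coprimez_dvd_mul b_totP); apply/dvdzP; exists (b_tot (c k) - b_tot (c j)).
apply: (mulfI (lt0r_neq0 e0)); rewrite mulrCA -yP.
have {}H : ramification P * (b_tot (c k) - b_tot (c j)) = (j%:Z - k%:Z) * P y.
  by rewrite mulrBr mulrBl; move: H; lia.
by rewrite [RHS]mulrA H; ring.
Qed.

Lemma kummer_dim : (\dim {:L} <= n)%N.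
Proof.
rewrite -y_gen dim_Fadjoin dimv1 muln1 -ltnS -size_minPoly.
have -> : n.+1 = size ('X^n - (f%:A)%:P : {poly L}) by rewrite size_XnsubC.
apply: dvdp_leq; first by rewrite -size_poly_gt0 size_XnsubC.
apply: minPoly_dvdp; last by rewrite rootE !hornerE y_pow subrr.
rewrite rpredB ?rpredX ?polyOverX // polyOverC; apply/vlineP; by exists f.
Qed.

Lemma kummer_basis : basis_of fullv kummer_powers.
Proof. by rewrite basisEfree kummer_free subvf size_tuple kummer_dim. Qed.

Definition kcoord (i : 'I_n) (z : L) : E := coord kummer_powers i z.

Lemma kcoordE z : z = \sum_(i < n) kcoord i z *: y ^+ i.
Proof.
rewrite {1}(coord_basis kummer_basis (memvf z)); apply: eq_bigr => i _.
by rewrite -tnth_nth tnth_mktuple.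
Qed.

Lemma kcoordD i z w : kcoord i (z + w) = kcoord i z + kcoord i w.
Proof. exact: linearD. Qed.

Lemma kcoordZ i r z : kcoord i (r *: z) = r * kcoord i z.
Proof. exact: linearZ. Qed.

Lemma kcoord_iota i c z : kcoord i (iota c * z) = iota0 c * kcoord i z.
Proof. by rewrite -kcoordZ scale_alg_mul. Qed.

Lemma kcoord0 i : kcoord i 0 = 0.
Proof. exact: linear0. Qed.

Lemma kcoord_sum (c : 'I_n -> E) i : kcoord i (\sum_(j < n) c j *: y ^+ j) = c i.
Proof.
rewrite /kcoord; have := coord_sum_free c i kummer_free; move=> <-; congr (coord _ _ _).
by apply: eq_bigr => j _; rewrite -tnth_nth tnth_mktuple.
Qed.

Lemma kcoord_power i j : kcoord i (y ^+ j) = (i == j :> nat)%:R :> E \/ (n <= j)%N.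
Proof.
have [|jn] := leqP n j; [by right | left].
have -> : y ^+ j = \sum_(k < n) (k == j :> nat)%:R *: y ^+ k.
  rewrite (bigD1 (Ordinal jn)) //= eqxx scale1r big1 ?addr0 // => k kj.
  by rewrite -[k == j :> nat]/(k == Ordinal jn) (negPf kj) scale0r.
by rewrite kcoord_sum.
Qed.

(* Sealed, so that simplification does not unfold the embedding into a scaling. *)
Lemma scalar_key : {s : K -> L | s =1 iota}.
Proof. by exists iota. Qed.

Definition scalar : K -> L := sval scalar_key.

Lemma iota_scalar c : iota c = scalar c.
Proof. by rewrite /scalar; case: scalar_key. Qed.

Lemma scalar_alg c : scalar c = (iota0 c)%:A.
Proof. by rewrite -iota_scalar. Qed.

Lemma scalarM c d : scalar (c * d) = scalar c * scalar d.
Proof. by rewrite -!iota_scalar rmorphM. Qed.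

Lemma scalarX c j : scalar (c ^+ j) = scalar c ^+ j.
Proof. by rewrite -!iota_scalar rmorphXn. Qed.

Lemma scalar1 : scalar 1 = 1.
Proof. by rewrite -iota_scalar rmorph1. Qed.

Lemma scalarN1 : scalar (-1) = -1.
Proof. by rewrite -iota_scalar rmorphN1. Qed.

Lemma scalar0 : scalar 0 = 0.
Proof. by rewrite -iota_scalar rmorph0. Qed.

Lemma scalar_sum (I : Type) (s : seq I) (Q : pred I) (c : I -> K) :
  scalar (\sum_(i <- s | Q i) c i) = \sum_(i <- s | Q i) scalar (c i).
Proof. by rewrite -iota_scalar rmorph_sum; apply: eq_bigr => i _; rewrite iota_scalar. Qed.

(** For nonzero c this is the Galois automorphism over E sending y to c y; the n-th roots of unity
    are exactly the elements of K^*. *)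
Definition twist (c : K) (z : L) : L := \sum_(i < n) kcoord i z *: (scalar c * y) ^+ i.

Lemma twistD c : {morph twist c : z w / z + w}.
Proof.
by move=> z w; rewrite /twist -big_split; apply: eq_bigr => i _; rewrite kcoordD scalerDl.
Qed.

Lemma twistZ c r z : twist c (r *: z) = r *: twist c z.
Proof.
by rewrite /twist scaler_sumr; apply: eq_bigr => i _; rewrite kcoordZ scalerA.
Qed.

Lemma twist0 c : twist c 0 = 0.
Proof. by have := twistZ c 0 0; rewrite !scale0r. Qed.

Lemma twist_sum c (I : Type) (s : seq I) (z : I -> L) :
  twist c (\sum_(i <- s) z i) = \sum_(i <- s) twist c (z i).
Proof. exact: (big_morph _ (twistD c) (twist0 c)). Qed.

Lemma unit_pow (c : K) : c != 0 -> c ^+ n = 1.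
Proof.
by move=> c0; apply: (mulfI c0); rewrite -exprS mulr1 -card_K expf_card.
Qed.

Lemma twist_small c j : (j < n)%N -> twist c (y ^+ j) = (scalar c * y) ^+ j.
Proof.
move=> jn; rewrite /twist (bigD1 (Ordinal jn)) //= big1 ?addr0 => [|k kj].
  by case: (kcoord_power (Ordinal jn) j); [rewrite eqxx => ->; rewrite scale1r | rewrite leqNgt jn].
case: (kcoord_power k j); last by rewrite leqNgt jn.
by rewrite -[k == j :> nat]/(k == Ordinal jn) (negPf kj) => ->; rewrite scale0r.
Qed.

Lemma twist_power c j : c != 0 -> twist c (y ^+ j) = (scalar c * y) ^+ j.
Proof.
move=> c0; rewrite (divn_eq j n) exprD mulnC exprM y_pow.
have pA k : (f%:A : L) ^+ k = (f ^+ k)%:A by exact: (esym (rmorphXn (in_alg L) k f)).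
rewrite pA -scale_alg_mul twistZ twist_small ?ltn_mod // exprD [RHS]mulrC.
have yn : (scalar c * y) ^+ n = f%:A by rewrite exprMn -scalarX unit_pow // scalar1 mul1r.
by rewrite [in RHS]exprM yn pA [RHS]mulrC scale_alg_mul.
Qed.

Lemma twistM c : c != 0 -> {morph twist c : z w / z * w}.
Proof.
move=> c0 z w; rewrite {1}(kcoordE z) mulr_suml twist_sum.
rewrite [in RHS]/twist mulr_suml; apply: eq_bigr => i _.
rewrite -!scalerAl twistZ; congr (_ *: _).
rewrite {1}(kcoordE w) mulr_sumr twist_sum mulr_sumr; apply: eq_bigr => j _.
by rewrite -!scalerAr twistZ -exprD twist_power // exprD.
Qed.

Lemma twist_alg c r : twist c r%:A = r%:A.
Proof.
by rewrite twistZ -[X in twist c X](expr0 y) twist_small // expr0.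
Qed.

Lemma twist_twist c d z : c != 0 -> d != 0 -> twist c (twist d z) = twist (c * d) z.
Proof.
move=> c0 d0; rewrite [twist d z]/twist twist_sum; apply: eq_bigr => i _.
rewrite twistZ; congr (_ *: _); rewrite exprMn -scalarX scalar_alg -scale_alg_mul twistZ.
by rewrite twist_small // scale_alg_mul -scalar_alg scalarX !exprMn scalarM exprMn mulrA [scalar d ^+ i * _]mulrC.
Qed.

Lemma twist1 z : twist 1 z = z.
Proof. by rewrite [RHS]kcoordE /twist; apply: eq_bigr => i _; rewrite scalar1 mul1r. Qed.

Lemma twistK c : c != 0 -> cancel (twist c) (twist c^-1).
Proof. by move=> c0 z; rewrite twist_twist ?invr_eq0 // mulVf // twist1. Qed.

Lemma twist_eq0 c z : c != 0 -> (twist c z == 0) = (z == 0).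
Proof.
move=> c0; apply/eqP/eqP => [H|->]; last exact: twist0.
by rewrite -(twistK c0 z) H twist0.
Qed.

Lemma twist_placeP c P : c != 0 -> discrete_valuation iota (fun z => P (twist c z)).
Proof.
move=> c0; case: (pv P) => v0 vc vM vD; split.
- by rewrite twist0.
- by move=> d d0; rewrite twist_alg; exact: (vc d d0).
- by move=> z w z0 w0; rewrite twistM // vM ?twist_eq0.
- by move=> z w z0 w0 zw0; rewrite twistD; apply: vD; rewrite -?twistD twist_eq0.
- have [t t0 Pt] := place_uniformizer P; exists (twist c^-1 t).
  by have := twistK (c := c^-1); rewrite invr_eq0 invrK => ->.
Qed.

Definition twist_place c P (c0 : c != 0) : place iota := Place (twist_placeP P c0).

Lemma restrict_twist c P (c0 : c != 0) : restrict (twist_place P c0) = restrict P.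
Proof.
apply: restrict_unique => r Hr.
have [->|r0] := eqVneq r 0; [by left; rewrite scale0r | right => /=].
rewrite twist_alg restrictE mulr_ge0 ?(ltW (ramification_gt0 P)) //.
exact: (vge_neq0 r0 Hr).
Qed.

(** Orthogonality of the characters c -> c^j of K^*, a group whose order n is -1 in K. As c^n = 1,
    [cyclic_diff] replaces j - i by an exponent between 0 and n - 1. *)
Lemma sum_unit_characters (i j : 'I_n) :
  \sum_(c : K | c != 0) c ^- i * c ^+ j = - (i == j)%:R.
Proof.
pose k := if (i <= j)%N then (j - i)%N else (n + j - i)%N.
have [kn k0] := cyclic_diff (ltn_ord i) (ltn_ord j); rewrite -/k in kn k0.
rewrite -[i == j]/(i == j :> nat).
rewrite -k0 -sum_unit_powers ?card_K //; apply: eq_bigr => c c0.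
apply: (mulfI (expf_neq0 i c0)); rewrite mulVKf ?expf_neq0 // -exprD /k.
case: leqP => ij; first by rewrite subnKC.
rewrite subnKC; first by rewrite exprD unit_pow // mul1r.
by have := ltn_ord i; lia.
Qed.

(* Averaging over the Galois group against a character isolates one component. *)
Lemma component_average i z :
  kcoord i z *: y ^+ i = - \sum_(c : K | c != 0) scalar (c ^- i) * twist c z.
Proof.
transitivity (- \sum_(j < n) kcoord j z *:
    (scalar (\sum_(c : K | c != 0) c ^- i * c ^+ j) * y ^+ j)).
  rewrite (bigD1 i) //= [X in _ + X]big1 => [|j ji].
    by rewrite addr0 sum_unit_characters eqxx scalarN1 mulN1r scalerN opprK.
  by rewrite sum_unit_characters eq_sym (negPf ji) oppr0 scalar0 mul0r scaler0.
congr (- _); under [RHS]eq_bigr do rewrite /twist mulr_sumr.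
rewrite exchange_big; apply: eq_bigr => j _.
rewrite scalar_sum mulr_suml scaler_sumr; apply: eq_bigr => c c0.
by rewrite -scalerAr exprMn scalarM -mulrA scalarX.
Qed.

Definition twist_stable (V : set L) := forall c z, c != 0 -> V z -> V (twist c z).

(** Consequently a Galois-stable K-subspace is the direct sum of its intersections with the lines E
    y^i. *)
Lemma stable_component (V : set L) i z : subspace iota V -> twist_stable V -> V z ->
  V (kcoord i z *: y ^+ i).
Proof.
move=> sV tV Vz; rewrite component_average; apply: (subspaceN sV).
case: sV => V0 VD VZ; apply: (big_ind V) => // c c0; rewrite -iota_scalar; apply: VZ; exact: tV.
Qed.

Lemma vge_twist c P (c0 : c != 0) k z : vge P k (twist c z) <-> vge (twist_place P c0) k z.
Proof.
split=> -[H|H]; [left|by right|left|by right]; apply/eqP.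
  by rewrite -(twist_eq0 z c0) H.
by rewrite twist_eq0 // H.
Qed.

(** Imposing the condition at all places above b makes the subspace Galois-stable, since twisting
    permutes these places. *)
Definition above_ideal b (k : int) : set L := [set z | forall P, restrict P = b -> vge P k z].

Lemma above_ideal_subspace b k : subspace iota (above_ideal b k).
Proof.
split=> [P _|z w Hz Hw P Pb|c z Hz P Pb]; first by left.
  by apply: (vgeD (pv P)); [exact: Hz | exact: Hw].
by apply: (vgeZ (pv P)); exact: Hz.
Qed.

Lemma above_ideal_stable b k : twist_stable (above_ideal b k).
Proof.
move=> c z c0 Hz P Pb; apply/(vge_twist P c0); apply: Hz.
by rewrite restrict_twist.
Qed.

Definition ram_gcd b : nat := gcdn n `|b f|%N.
Local Notation d := ram_gcd.

Lemma ram_gcd_gt0 b : (0 < d b)%N.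
Proof. by rewrite gcdn_gt0 n_gt0. Qed.

Lemma ram_gcd_dvdn b : (d b %| n)%N.
Proof. exact: dvdn_gcdl. Qed.

(* The ramification index of the places above b, at which y has value [gen_val b]. *)
Definition ram_index b : nat := (n %/ d b)%N.
Local Notation e := ram_index.

Lemma ram_indexE b : (e b * d b)%N = n.
Proof. by rewrite divnK // ram_gcd_dvdn. Qed.

Lemma ram_index_gt0 b : (0 < e b)%N.
Proof. by have := n_gt0; rewrite -[X in (0 < X)%N](ram_indexE b) muln_gt0 => /andP[]. Qed.

Definition gen_val b : int := (b f %/ (d b)%:Z)%Z.

Lemma gen_valE b : gen_val b * (d b)%:Z = b f.
Proof. by rewrite divzK // dvdzE /= dvdn_gcdr. Qed.

Lemma coprime_ram b : coprimez (e b)%:Z (gen_val b).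
Proof.
rewrite coprimezE /coprime /= -(eqn_pmul2r (ram_gcd_gt0 b)) mul1n muln_gcdl ram_indexE.
by apply/eqP; rewrite /ram_gcd; congr gcdn; rewrite -[X in (_ * X)%N]absz_nat -abszM gen_valE.
Qed.

(** Dividing n P(y) = ramification(P) b(f) by d leaves e P(y) = ramification(P) [gen_val b]; since e
    is prime to [gen_val b], it divides the ramification index. *)
Lemma ramification_ramE P : exists s : int,
  [/\ 0 < s, ramification P = s * (e (restrict P))%:Z & P y = s * gen_val (restrict P)].
Proof.
set b := restrict P; have yP := kummer_gen_val P; rewrite -/b in yP.
have d0 : (d b)%:Z != 0 by rewrite eqz_nat -lt0n ram_gcd_gt0.
have e0 := ram_index_gt0 b.
have H : (e b)%:Z * P y = ramification P * gen_val b.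
  have nE : n%:Z = (e b)%:Z * (d b)%:Z by rewrite -PoszM ram_indexE.
  by apply: (mulIf d0); rewrite -[RHS]mulrA gen_valE -yP nE; ring.
have /dvdzP [s Hs] : ((e b)%:Z %| ramification P)%Z.
  by apply: (coprimez_dvd_mul (coprime_ram b)); rewrite -H dvdz_mulr.
exists s; split=> //; first by have := ramification_gt0 P; rewrite Hs; nia.
have e0' : (e b)%:Z != 0 by rewrite eqz_nat -lt0n.
by apply: (mulfI e0'); rewrite H Hs; ring.
Qed.

(** Weak approximation gives w with P(w) = 1 and positive value at every place above b. Its
    components stay in this Galois-stable ideal, so they have positive value at P; as values of
    terms r y^i at P are multiples of s, these are at least s. Hence s <= P(w) = 1. *)
Lemma ramificationE P : ramification P = (e (restrict P))%:Z /\ P y = gen_val (restrict P).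
Proof.
have [s [s0 Hs ys]] := ramification_ramE P; set b := restrict P in Hs ys.
suff s1 : s = 1 by rewrite Hs ys s1 !mul1r.
have [t t0 Pt] := place_uniformizer P.
have [|w [w1 w2]] := @weak_approximation _ _ _ P (rem P (fiber L b)) t 2.
  by rewrite mem_rem_uniq ?fiber_uniq // !inE eqxx.
have Pw : P w = 1.
  rewrite -[w](subrK t) addrC (valD_lt (pv P)) ?Pt //.
have w0 : w != 0 by apply: contra_eq_neq Pw => ->; rewrite (val0 (pv P)).
have wI : above_ideal b 1 w.
  move=> Q Qb; have [->|QP] := eqVneq Q P; first by right; rewrite Pw.
  apply: vge_le (w2 Q _) => //.
  by rewrite mem_rem_uniq ?fiber_uniq // !inE QP mem_fiber Qb eqxx.
have : vge P s w.
  rewrite [w]kcoordE; apply: (vge_sum (pv P)) => i _.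
  have := stable_component i (above_ideal_subspace b 1) (above_ideal_stable (b := b) (k := 1)) wI.
  move=> /(_ P erefl) H; have [z0|z0] := eqVneq (kcoord i w *: y ^+ i) 0; first by left.
  have := vge_neq0 z0 H; move: z0; rewrite scaler_eq0 negb_or => /andP[c0 yi].
  rewrite (place_scale P c0 yi) restrictE (valX (pv P)) -mulr_natl natz Hs ys => H1; right.
  rewrite (place_scale P c0 yi) restrictE (valX (pv P)) -mulr_natl natz Hs ys.
  have E1 (x u v j : int) : s * u * x + j * (s * v) = s * (u * x + j * v) by ring.
  by move: H1; rewrite E1 -gtz0_ge1 (pmulr_rgt0 _ s0) gtz0_ge1 => m1; rewrite ler_peMr // ltW.
by move=> /(vge_neq0 w0); rewrite Pw; lia.
Qed.

Definition components (V : 'I_n -> set E) : set L := [set z | forall i, V i (kcoord i z)].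

Lemma components_subspace V : (forall i, subspace iota0 (V i)) -> subspace iota (components V).
Proof.
move=> sV; split=> [i|z w Hz Hw i|c z Hz i] /=; have [V0 VD VZ] := sV i.
- by rewrite kcoord0.
- by rewrite kcoordD; apply: VD.
- by rewrite kcoord_iota; apply: VZ.
Qed.

Lemma components_dim (V W : 'I_n -> set E) (dim : 'I_n -> nat) :
  (forall i, subspace iota0 (V i)) -> (forall i, subspace iota0 (W i)) ->
  (forall i, W i `<=` V i) -> (forall i, has_quotient_dim iota0 (V i) (W i) (dim i)) ->
  has_quotient_dim iota (components V) (components W) (\sum_i dim i)%N.
Proof.
move=> sV sW WV dimVW.
(* U k has W in the first k components and V in the others, so each step from k to k + 1 adds a
   single quotient V/W. *)
pose U (k : nat) (i : 'I_n) := if (i < k)%N then W i else V i.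
have sU k i : subspace iota0 (U k i) by rewrite /U; case: ifP.
suff H k : (k <= n)%N ->
    has_quotient_dim iota (components (U 0%N)) (components (U k)) (\sum_(i < n | (i < k)%N) dim i)%N.
  have := H n (leqnn n).
  have -> : components (U 0%N) = components V by [].
  have -> : components (U n) = components W.
    by congr components; apply/funext => i; rewrite /U ltn_ord.
  by rewrite [X in has_quotient_dim _ _ _ X](eq_bigl xpredT) => [//|i]; exact: ltn_ord.
elim: k => [_|k IH kn].
  by rewrite big1 => [|i]; [apply/has_quotient_dim_refl/components_subspace | rewrite ltn0].
pose i0 := Ordinal kn.
have -> : (\sum_(i < n | (i < k.+1)%N) dim i = \sum_(i < n | (i < k)%N) dim i + dim i0)%N.
  rewrite (bigD1 i0) //= addnC; congr addn; apply: eq_bigl => i.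
  by rewrite ltnS -[i == i0]/(i == k :> nat) ltn_neqAle andbC.
apply: (has_quotient_dim_chain _ _ _ _ _ (IH (ltnW kn))); try exact: components_subspace.
- by move=> z Hz i; have := Hz i; rewrite /U ltn0; case: ifP => // _; exact: WV.
- move=> z Hz i; have := Hz i; rewrite /U ltnS; case: ltngtP => // _; exact: WV.
have kmono i r : kcoord i (r *: y ^+ i0) = if i == i0 then r else 0.
  have -> : r *: y ^+ i0 = \sum_(j < n) (if j == i0 then r else 0) *: y ^+ j.
    rewrite (bigD1 i0) //= eqxx big1 ?addr0 // => j /negPf ->; exact: scale0r.
  exact: kcoord_sum.
have s0 i k' : U k' i 0 by case: (sU k' i).
have Ui0 : U k i0 = V i0 by rewrite /U ltnn.
have Ui1 : U k.+1 i0 = W i0 by rewrite /U ltnS leqnn.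
apply: (has_quotient_dim_image (phi := fun r => r *: y ^+ i0) _ _ (sV i0) (sW i0) _ _ _ _ _ (dimVW i0)).
- by move=> r s; rewrite scalerDl.
- by move=> c r; rewrite -scalerA scale_alg_mul.
- exact: components_subspace.
- exact: components_subspace.
- by move=> r Vr i; rewrite kmono; case: eqVneq => [->|_] //; rewrite Ui0.
- move=> r Vr; split=> [/(_ i0)|Wr i]; first by rewrite kmono eqxx Ui1.
  by rewrite kmono; case: eqVneq => [->|_] //; rewrite Ui1.
- move=> w Hw; exists (kcoord i0 w); first by rewrite -Ui0.
  move=> i /=; rewrite -scaleNr kcoordD kmono; case: eqVneq => [->|ii0]; first by rewrite addrN.
  rewrite addr0; have := Hw i; rewrite /U ltnS (leq_eqVlt i k).
  by rewrite -[i == k :> nat]/(i == i0) (negPf ii0).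
Qed.

(** By [ramificationE], P(r y^i) = e b(r) + i [gen_val b] at every place P above b; solving for b(r)
    gives a ceiling, written as minus a floor. *)
Lemma above_ideal_components b k :
  above_ideal b k = components (fun i => vge b (- ((i%:Z * gen_val b - k) %/ (e b)%:Z)%Z)).
Proof.
have e0 : 0 < (e b)%:Z by rewrite ltz_nat ram_index_gt0.
have H i r P : restrict P = b -> (vge P k (r *: y ^+ i) <-> vge b (- ((i%:Z * gen_val b - k) %/ (e b)%:Z)%Z) r).
  move=> Pb; have [->|r0] := eqVneq r 0; first by rewrite scale0r; split=> _; left.
  have yi : y ^+ i != 0 by rewrite expf_neq0 // kummer_gen_neq0.
  have z0 : r *: y ^+ i != 0 by rewrite scaler_eq0 negb_or r0.
  have [ePb yPb] := ramificationE P; rewrite Pb in ePb yPb.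
  have Pz : P (r *: y ^+ i) = (e b)%:Z * b r + i%:Z * gen_val b.
    by rewrite (place_scale P r0 yi) restrictE ePb Pb (valX (pv P)) yPb -mulr_natl natz.
  have E1 : (k <= P (r *: y ^+ i)) = (- ((i%:Z * gen_val b - k) %/ (e b)%:Z)%Z <= b r).
    rewrite Pz lerNl lez_divRL // mulNr mulrC; apply/idP/idP; lia.
  by split=> [/(vge_neq0 z0)|/(vge_neq0 r0)]; [rewrite E1 | rewrite -E1]; right.
apply/seteqP; split=> z Hz.
  move=> i /=; have [P Pb] := place_above L b; apply/(H i _ P Pb).
  by have := stable_component i (above_ideal_subspace b k) (@above_ideal_stable b k) Hz; apply.
move=> P Pb; rewrite [z]kcoordE; apply: (vge_sum (pv P)) => i _.
by apply/(H i _ P Pb); apply: Hz.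
Qed.

Hypothesis base_residue : forall b, has_quotient_dim iota0 (vge b 0) (vge b 1) (place_deg b).

Lemma sum_dvdn_ord (u v : nat) : (0 < u)%N -> (\sum_(i < u * v) (u %| i) = v)%N.
Proof.
move=> u0; elim: v => [|v IH]; first by rewrite muln0 big_ord0.
rewrite mulnS addnC big_split_ord /= IH -[in RHS]addn1; congr addn.
rewrite -(prednK u0) big_ord_recl /= addn0 dvdn_mulr // big1 // => i _.
by rewrite dvdn_addr ?dvdn_mulr // /bump /= add1n gtnNdvd // ltnS ltn_ord.
Qed.

(** The floors for the bounds 0 and 1 differ, by one, exactly when e divides i [gen_val b], that is
    when e divides i. This happens for d of the n indices, and each contributes deg b. *)
Lemma above_ideal_residue b :
  has_quotient_dim iota (above_ideal b 0) (above_ideal b 1) (d b * place_deg b)%N.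
Proof.
have pb := pv b; have e0 := ram_index_gt0 b.
rewrite !above_ideal_components.
have -> : (d b * place_deg b = \sum_(i < n) (e b %| i) * place_deg b)%N.
  by rewrite -big_distrl /= -[in RHS](ram_indexE b) sum_dvdn_ord.
have dvE (i : 'I_n) : (e b %| i)%N = ((e b)%:Z %| i%:Z * gen_val b)%Z.
  apply/idP/idP => [ei|]; first by rewrite dvdz_mulr // dvdzE.
  by move/(coprimez_dvd_mul (coprime_ram b)); rewrite dvdzE.
apply: components_dim => [i|i|i|i]; try exact: vge_subspace.
  by move=> r; apply: (vge_le (v := b)); rewrite lerN2 leq_divz // lerD2l.
rewrite (dvE i) subr0 divz_pred //; case: ifPn => _; last first.
  exact/has_quotient_dim_refl/vge_subspace.
by rewrite mul1n opprD opprK; exact: shifted_residue.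
Qed.

(** Chinese remainder theorem, one place at a time: weak approximation maps the space already cut
    out onto the residue field of the next place. Finiteness of that residue field is obtained in
    the same induction, from the finite dimension of the quotient in [above_ideal_residue]. *)
Lemma fiber_residues b (s : seq (place iota)) : uniq s -> {subset s <= fiber L b} ->
  (forall P, P \in s -> has_quotient_dim iota (vge P 0) (vge P 1) (place_deg P)) /\
  has_quotient_dim iota (above_ideal b 0)
    [set z | above_ideal b 0 z /\ forall P, P \in s -> vge P 1 z] (\sum_(P <- s) place_deg P)%N.
Proof.
pose W (s : seq (place iota)) := [set z | above_ideal b 0 z /\ forall P, P \in s -> vge P 1 z].
have sI k := above_ideal_subspace b k.
have sW s' : subspace iota (W s').
  split.
  - by split; [case: (sI 0) | left].
  - move=> z w [Hz sz] [Hw sw]; split; first by case: (sI 0) => _ + _; apply.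
    by move=> P Ps; apply: (vgeD (pv P)); [exact: sz | exact: sw].
  - move=> c z [Hz sz]; split; first by case: (sI 0) => _ _; apply.
    by move=> P Ps; apply: (vgeZ (pv P)); exact: sz.
elim: s => [_ _|P s IH /= /andP[Ps us] sb].
  split=> //; rewrite big_nil.
  have -> : [set z | above_ideal b 0 z /\ forall P, P \in [::] -> vge P 1 z] = above_ideal b 0.
    by apply/seteqP; split=> [z []|z Hz].
  exact: has_quotient_dim_refl.
have [|IHdeg IHdim] := IH us; first by move=> Q Qs; apply: sb; rewrite inE Qs orbT.
have Pb : restrict P = b by apply/eqP; rewrite -(mem_fiber b P); apply: sb; rewrite mem_head.
have pP := pv P.
have WW : W (P :: s) `<=` W s.
  by move=> z [Hz sz]; split=> // Q Qs; apply: sz; rewrite inE Qs orbT.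
have I1W : above_ideal b 1 `<=` W (P :: s).
  move=> z Hz; split=> [Q Qb|Q Qs]; first by apply: vge_le (Hz Q Qb).
  by apply: Hz; apply/eqP; rewrite -(mem_fiber b Q); apply: sb.
have [d1 _ Hd1] := has_quotient_dim_sub (sI 0) (sI 1) (sW s) (fun z H => H.1) (above_ideal_residue b).
have sWI : W s `&` above_ideal b 1 `<=` W (P :: s) by move=> z [_ /I1W].
have [d2 _ Hd2] := has_quotient_dim_quo (sW s) (sW (P :: s)) (subspaceI (sW s) (sI 1)) sWI Hd1.
have HP : has_quotient_dim iota (vge P 0) (vge P 1) d2.
  apply: (has_quotient_dim_image (phi := id) _ _ (sW s) (sW (P :: s)) (vge_subspace pP 0)
    (vge_subspace pP 1) _ _ _ Hd2) => //.
  - by move=> z [Hz _]; exact: Hz.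
  - move=> z [Hz sz]; split=> [Pz|[_ H]]; last by apply: H; rewrite mem_head.
    by split=> // Q; rewrite inE => /orP[/eqP -> //|]; exact: sz.
  - move=> w Pw; have [|z [z1 z2]] := @weak_approximation _ _ _ P (rem P (fiber L b)) w 1.
      by rewrite mem_rem_uniq ?fiber_uniq // !inE eqxx.
    have zQ Q : restrict Q = b -> Q != P -> vge Q 1 z.
      by move=> Qb QP; apply: z2; rewrite mem_rem_uniq ?fiber_uniq // !inE QP mem_fiber Qb eqxx.
    exists z; last by rewrite -opprB; apply: (vgeN pP).
    split=> [Q Qb|Q Qs].
      have [->|QP] := eqVneq Q P; last by apply: vge_le (zQ Q Qb QP).
      by rewrite -[z](subrK w); apply: (vgeD pP) => //; apply: vge_le z1.
    apply: zQ; last by apply: contraNneq Ps => <-.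
    by apply/eqP; rewrite -(mem_fiber b Q); apply: sb; rewrite inE Qs orbT.
have degP := place_deg_unique HP; rewrite big_cons addnC degP; split.
  by move=> Q; rewrite inE => /orP[/eqP ->|/IHdeg //]; rewrite degP.
apply: (has_quotient_dim_chain (sI 0) (sW s) (sW (P :: s)) _ WW IHdim Hd2).
by move=> z [].
Qed.

Lemma residue P : has_quotient_dim iota (vge P 0) (vge P 1) (place_deg P).
Proof.
have [H _] := fiber_residues (fiber_uniq L (restrict P)) (fun _ => id).
by apply: H; rewrite mem_fiber.
Qed.

(** The fundamental identity for the fiber: all places above b have ramification index n / d. *)
Lemma fiber_degree b : (\sum_(P <- fiber L b) place_deg P = d b * place_deg b)%N.
Proof.
have [_ H] := fiber_residues (fiber_uniq L b) (fun _ => id).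
apply: has_quotient_dim_uniq (above_ideal_subspace b 0) (above_ideal_subspace b 1) _ (above_ideal_residue b).
have <- : [set z | above_ideal b 0 z /\ forall P, P \in fiber L b -> vge P 1 z] = above_ideal b 1 => //.
apply/seteqP; split=> z.
  by move=> [_ H1] P Pb; apply: H1; rewrite mem_fiber Pb.
move=> Hz; split=> [P Pb|P]; first by apply: vge_le (Hz P Pb).
by rewrite mem_fiber => /eqP; exact: Hz.
Qed.

Lemma place_deg_gt0 P : (0 < place_deg P)%N.
Proof.
rewrite lt0n; apply/eqP => d0; have := residue P; rewrite d0 => -[b /quotient_basisP[]].
- exact: vge_subspace (pv P) 0.
- exact: vge_subspace (pv P) 1.
move=> _ /(_ 1) [|c]; first by right; rewrite (val1 (pv P)).
by rewrite /lincomb big_ord0 subr0 => /(vge_neq0 (oner_neq0 _)); rewrite (val1 (pv P)).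
Qed.

(** * Riemann-Roch spaces of divisors pulled back from the base *)

Hypothesis base_riemann_roch : forall (M : place iota0 -> int) (S : seq (place iota0)) (N : nat),
  uniq S -> (forall b, b \notin S -> M b = 0) ->
  \sum_(b <- S) M b * (place_deg b)%:Z + 1 = N ->
  has_quotient_dim iota0 [set r | forall b, vge b (- M b) r] [set 0] N.

Definition pullback (m : place iota0 -> int) : place iota -> int := fun P => m (restrict P).

Lemma flatten_fiber_uniq (S : seq (place iota0)) : uniq S ->
  uniq (flatten [seq fiber L b | b <- S]).
Proof.
elim: S => //= b S IH /andP[bS uS]; rewrite cat_uniq fiber_uniq IH // andbT.
apply/hasPn => P /flatten_mapP [b' b'S]; rewrite !mem_fiber => /eqP ->.
by apply: contraNneq bS => <-.
Qed.

Lemma pullback_deg (m : place iota0 -> int) (S : seq (place iota0)) :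
  uniq S -> (forall b, b \notin S -> m b = 0) ->
  divisor_deg (pullback m) = \sum_(b <- S) m b * ((d b)%:Z * (place_deg b)%:Z).
Proof.
move=> uS mS; rewrite (@divisor_degE _ _ _ _ (flatten [seq fiber L b | b <- S])); first last.
- move=> P PS; apply: mS; apply: contra PS => PS; apply/flatten_mapP.
  by exists (restrict P); rewrite ?mem_fiber.
- exact: flatten_fiber_uniq.
rewrite big_flatten big_map; apply: eq_bigr => b _.
rewrite -PoszM -fiber_degree natr_sum_posz mulr_sumr; apply: eq_big_seq => P.
by rewrite /pullback mem_fiber => /eqP ->.
Qed.

(* r y^i lies in L(pullback m) if and only if b(r) >= - component_divisor m i b for all b. *)
Definition component_divisor (m : place iota0 -> int) (i : nat) (b : place iota0) : int :=
  ((i%:Z * gen_val b + m b) %/ (e b)%:Z)%Z.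

Lemma pullback_space (m : place iota0 -> int) :
  riemann_roch_space (pullback m) =
  components (fun i => [set r | forall b, vge b (- component_divisor m i b) r]).
Proof.
rewrite riemann_roch_spaceE.
have H b : above_ideal b (- m b) = components (fun i => vge b (- component_divisor m i b)).
  by rewrite above_ideal_components /component_divisor; congr components; apply/funext => i; rewrite opprK.
apply/seteqP; split=> z Hz.
  move=> i b; have : above_ideal b (- m b) z by move=> P Pb; rewrite -Pb; exact: Hz.
  by rewrite H; apply.
move=> P; have : above_ideal (restrict P) (- m (restrict P)) z; last by apply.
by rewrite H => i; exact: Hz.
Qed.

Lemma component_divisor_support (m : place iota0 -> int) i b :
  m b = 0 -> b f = 0 -> component_divisor m i b = 0.
Proof.
move=> mb bf; have /eqP := gen_valE b; rewrite bf mulf_eq0 eqz_nat -[_ == 0%N]negbK -lt0n ram_gcd_gt0 orbF.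
by rewrite /component_divisor mb => /eqP ->; rewrite mulr0 addr0 div0z.
Qed.

(** Every component divisor has degree at least -1, so its space on the base has dimension exactly
    degree plus one. The degrees are sums of floors; exchanging the sums and applying
    [sum_divz_period] at each b gives the formula. *)
Lemma pullback_dim (m : place iota0 -> int) (S : seq (place iota0)) : uniq S ->
  (forall b, b \notin S -> m b = 0) -> (forall b, b \notin S -> b f = 0) ->
  (forall i : 'I_n, -1 <= \sum_(b <- S) component_divisor m i b * (place_deg b)%:Z) ->
  exists2 l, has_quotient_dim iota (riemann_roch_space (pullback m)) [set 0] l &
    2 * l%:Z = 2 * divisor_deg (pullback m)
      + (n%:Z - 1) * (\sum_(b <- S) b f * (place_deg b)%:Z)
      - \sum_(b <- S) (n%:Z - (d b)%:Z) * (place_deg b)%:Z + 2 * n%:Z.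
Proof.
move=> uS mS fS Hdeg.
pose N (i : 'I_n) := `|(\sum_(b <- S) component_divisor m i b * (place_deg b)%:Z + 1)%R|%N.
have NE i : (N i)%:Z = \sum_(b <- S) component_divisor m i b * (place_deg b)%:Z + 1.
  by rewrite /N gez0_abs //; move: (Hdeg i); lia.
exists (\sum_i N i)%N.
  rewrite pullback_space; have -> : [set 0] = components (fun=> [set 0]).
    apply/seteqP; split=> z; first by move=> -> i /=; rewrite kcoord0.
    by move=> Hz; rewrite [z]kcoordE big1 // => i _; rewrite (Hz i) scale0r.
  have s0 := zero_subspace iota0.
  have sM i : subspace iota0 [set r | forall b, vge b (- component_divisor m i b) r].
    rewrite -[X in subspace _ X](_ : riemann_roch_space (component_divisor m i) = _).
      exact: riemann_roch_subspace.
    exact: riemann_roch_spaceE.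
  apply: components_dim => // i; first by move=> r ->; case: (sM i).
  apply: (base_riemann_roch uS) => [b bS|]; last by rewrite NE.
  by apply: component_divisor_support; [exact: mS | exact: fS].
rewrite (pullback_deg uS mS) natr_sum_posz.
under eq_bigr do rewrite NE.
rewrite big_split /= sumr_const card_ord mulrDr; congr (_ + _); last first.
  by congr (_ * _); rewrite -mulr_natl mulr1; exact: natz.
rewrite exchange_big /= !mulr_sumr -big_split -sumrB; apply: eq_bigr => b _ /=.
rewrite -mulr_suml mulrA.
have -> : 2 * \sum_(i < n) component_divisor m i b =
    2 * (d b)%:Z * m b + gen_val b * (d b)%:Z * (n%:Z - 1) - (d b)%:Z * ((e b)%:Z - 1).
  rewrite -[in RHS](ram_indexE b) -sum_divz_period ?ram_index_gt0 ?coprime_ram //.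
  by rewrite ram_indexE.
have nE : n%:Z = (e b)%:Z * (d b)%:Z by rewrite -PoszM ram_indexE.
by rewrite gen_valE nE; ring.
Qed.

(** * Residues of y and rational places above a rational place *)

Lemma const_vge1 P (c : K) : vge P 1 (iota c) -> c = 0.
Proof.
move=> H; apply/eqP; apply: contraPT H => c0 /vge_neq0; rewrite fmorph_eq0 => /(_ c0).
by case: (pv P) => _ -> .
Qed.

(** The given basis vector u of the residue field is arbitrary; dividing by the coordinate of 1
    expresses residues as constants. *)
Lemma residue_constant P z : place_deg P = 1%N -> vge P 0 z -> exists c : K, vge P 1 (z - iota c).
Proof.
move=> dP Hz; have := residue P; rewrite dP => -[u /quotient_basisP[]].
- exact: vge_subspace (pv P) 0.
- exact: vge_subspace (pv P) 1.
move=> _ uS; have [c Hc] := uS z Hz.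
have [|c' Hc'] := uS 1; first by right; rewrite (val1 (pv P)).
rewrite /lincomb !big_ord1 in Hc Hc'.
have c'0 : c' 0 0 != 0.
  apply: contraPneq Hc' => ->; rewrite rmorph0 mul0r subr0.
  by move=> /(vge_neq0 (oner_neq0 _)); rewrite (val1 (pv P)).
exists (c 0 0 / c' 0 0).
have -> : z - iota (c 0 0 / c' 0 0) =
    (z - iota (c 0 0) * u ord0) - iota (c 0 0 / c' 0 0) * (1 - iota (c' 0 0) * u ord0).
  rewrite mulrBr mulr1 mulrA -rmorphM divfK //; ring.
by apply: (vgeB (pv P)) => //; apply: (vgeZ (pv P)).
Qed.

Lemma vge_subX P z w k : vge P 0 z -> vge P 0 w -> vge P 1 (z - w) -> vge P 1 (z ^+ k - w ^+ k).
Proof.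
move=> Hz Hw Hzw; rewrite subrXX -[1]addr0; apply: (vgeM (pv P)) => //.
apply: (vge_sum (pv P)) => i _; rewrite -[0]addr0; have X j v : vge P 0 v -> vge P 0 (v ^+ j).
  move=> Hv; elim: j => [|j IH]; first by right; rewrite expr0 (val1 (pv P)).
  by rewrite exprS -[0]addr0; apply: (vgeM (pv P)).
by apply: (vgeM (pv P)); apply: X.
Qed.

Lemma alg_vge1 P r : vge (restrict P) 1 r -> vge P 1 (r%:A : L).
Proof.
have [->|r0] := eqVneq r 0; first by left; rewrite scale0r.
move=> /(vge_neq0 r0) Hr; apply/vge_alg; right; have := ramification_gt0 P.
by move: (ramification P) (restrict P r) Hr => u v; nia.
Qed.

(** The product of y - c over all c in K is y^(n+1) - y = y (f - 1), which vanishes at P. The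
    factors are integral at P, so one of them vanishes there, and c is nonzero because y is a unit
    at P. *)
Lemma gen_residue P : vge (restrict P) 1 (f - 1) -> exists2 c : K, c != 0 & vge P 1 (y - iota c).
Proof.
set b := restrict P; move=> bf; have pP := pv P.
have f_val : b f = 0.
  have -> : f = 1 + (f - 1) by ring.
  by rewrite (valD_lt (pv b)) ?oner_neq0 // (val1 (pv b)).
have Py : P y = 0.
  have := kummer_gen_val P; rewrite -/b f_val mulr0 => /eqP.
  by rewrite mulf_eq0 eqz_nat -[n == 0%N]negbK -lt0n n_gt0 => /eqP.
have y0 := kummer_gen_neq0.
have prodE : \prod_(c : K) (y - iota c) = y * (f - 1)%:A.
  have E1 : (map_poly iota (\prod_(c : K) ('X - c%:P))).[y] = \prod_(c : K) (y - iota c).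
    rewrite rmorph_prod horner_prod; apply: eq_bigr => c _.
    by rewrite [X in X.[_]]map_polyXsubC hornerXsubC.
  have E2 : map_poly iota ('X^#|K| - 'X) = 'X^#|K| - 'X by rewrite rmorphB /= map_polyXn map_polyX.
  rewrite -E1 -finField_genPoly E2 hornerD hornerN hornerXn hornerX card_K exprS y_pow.
  by rewrite scalerBl scale1r mulrBr mulr1.
have Pprod : vge P 1 (\prod_(c : K) (y - iota c)).
  rewrite prodE -[1]add0r; apply: (vgeM pP); first by right; rewrite Py.
  exact: alg_vge1.
have [c Hc] : exists c : K, vge P 1 (y - iota c).
  apply: contrapT => H.
  have Hc (c : K) : y - iota c != 0 /\ P (y - iota c) = 0.
    have nz : y - iota c != 0 by apply/eqP => e; apply: H; exists c; left.
    split=> //; have : vge P 0 (y - iota c).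
      by apply: (vgeB pP); [right; rewrite Py | exact: vge_const].
    move=> /(vge_neq0 nz) ge0; apply/eqP; rewrite eq_le ge0 andbT leNgt; apply/negP => gt0.
    by apply: H; exists c; right; rewrite -gtz0_ge1.
  have := vge_neq0 (v := P) _ Pprod; rewrite (val_prod pP) => [|c]; last by case: (Hc c).
  rewrite [X in _ <= X]big1 => [H1|c _]; last by case: (Hc c).
  by have /H1 : \prod_(c : K) (y - iota c) != 0 by apply/prodf_neq0 => c _; case: (Hc c).
exists c => //; apply: contraPneq Hc => ->; rewrite rmorph0 subr0 => /(vge_neq0 y0).
by rewrite Py.
Qed.

Lemma fiber_neq_nil b : fiber L b != [::].
Proof.
by have [P /eqP] := place_above L b; rewrite -mem_fiber; apply: contraTneq => ->.
Qed.

Lemma fiber_size_le b : (size (fiber L b) <= d b * place_deg b)%N.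
Proof.
rewrite -fiber_degree -sum1_size; apply: leq_sum => P _; exact: place_deg_gt0.
Qed.

Lemma fiber_degree_one b : size (fiber L b) = (d b * place_deg b)%N ->
  forall P, restrict P = b -> place_deg P = 1%N.
Proof.
move=> sb P Pb; have Pf : P \in fiber L b by rewrite mem_fiber Pb.
move: sb; rewrite -fiber_degree -sum1_size !(big_rem _ Pf) /=.
have H : (\sum_(Q <- rem P (fiber L b)) 1 <= \sum_(Q <- rem P (fiber L b)) place_deg Q)%N.
  by apply: leq_sum => Q _; exact: place_deg_gt0.
have := place_deg_gt0 P; move: H.
by move: (\sum_(Q <- _) 1)%N (\sum_(Q <- _) place_deg Q)%N => u v; lia.
Qed.

(* The Galois group permutes simply transitively the places above b, on which
   y takes as residues all nonzero constants. *)
Lemma split_fiber b : place_deg b = 1%N -> vge b 1 (f - 1) ->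
  size (fiber L b) = n /\ forall P, restrict P = b -> place_deg P = 1%N.
Proof.
move=> db bf.
have f_val : b f = 0.
  have -> : f = 1 + (f - 1) by ring.
  by rewrite (valD_lt (pv b)) ?oner_neq0 // (val1 (pv b)).
have dn : (d b * place_deg b = n)%N by rewrite db muln1 /ram_gcd f_val gcdn0.
have [P0 P0b] := place_above L b.
have [c0 c00 Hc0] : exists2 c : K, c != 0 & vge P0 1 (y - iota c).
  by apply: gen_residue; rewrite P0b.
have ex (c : K) : exists P, c != 0 -> restrict P = b /\ vge P 1 (y - iota c).
  have [cz|cn] := eqVneq c 0; first by exists P0 => //; rewrite cz.
  have t0 : c / c0 != 0 by rewrite mulf_neq0 ?invr_eq0.
  exists (twist_place P0 t0) => _; split; first by rewrite restrict_twist.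
  apply/vge_twist; have -> : twist (c / c0) (y - iota c) = iota (c / c0) * (y - iota c0).
    rewrite -scaleN1r twistD twistZ twist_alg scaleN1r -[X in twist _ X]expr1 twist_power // expr1.
    rewrite -iota_scalar mulrBr -rmorphM divfK //.
  exact: (vgeZ (pv P0)).
have [pl plP] := boolp.choice ex.
pose s := [seq pl c | c <- enum [pred c : K | c != 0]].
have us : uniq s.
  rewrite map_inj_in_uniq ?enum_uniq // => c c'; rewrite !mem_enum => /plP [_ H] /plP [_ H'] e.
  rewrite -e in H'; apply/esym/eqP; rewrite -subr_eq0; apply/eqP/(@const_vge1 (pl c)).
  have -> : iota (c' - c) = (y - iota c) - (y - iota c') by rewrite rmorphB; ring.
  exact: (vgeB (pv (pl c))).
have sf : {subset s <= fiber L b}.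
  move=> P /mapP [c]; rewrite mem_enum => /plP [Pb _] ->; by rewrite mem_fiber Pb.
have ss : size s = n.
  by rewrite size_map -cardE (cardC1 (0 : K)) card_K.
have sn : size (fiber L b) = n.
  apply/eqP; rewrite eqn_leq -{1}dn fiber_size_le /= -ss; exact: uniq_leq_size.
by split=> //; apply: fiber_degree_one; rewrite dn.
Qed.

Lemma totally_ramified_fiber b : place_deg b = 1%N -> d b = 1%N ->
  size (fiber L b) = 1%N /\ forall P, restrict P = b -> place_deg P = 1%N.
Proof.
move=> db d1; have dn : (d b * place_deg b = 1)%N by rewrite db d1.
have sn : size (fiber L b) = 1%N.
  by apply/eqP; rewrite eqn_leq -{1}dn fiber_size_le lt0n size_eq0 fiber_neq_nil.
by split=> //; apply: fiber_degree_one; rewrite dn.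
Qed.

Lemma no_rational_above P (s : E) (k w : nat) : s != 0 -> n = (k * w)%N -> odd w ->
  (-1 : K) != 1 -> vge (restrict P) 1 (f / s ^+ k + 1) -> place_deg P != 1%N.
Proof.
set b := restrict P; move=> s0 nkw ow m1 bf; apply/eqP => dP; have pP := pv P.
have k0 : (0 < k)%N by move: n_gt0; rewrite nkw muln_gt0 => /andP[].
(* The power z^k is f / s^k, of residue -1. The residue c of z at a rational place then satisfies
   c^k = -1, whereas 1 = c^n = (-1)^w = -1. *)
have sA := alg_neq0 L s0; pose z := y ^+ w / s%:A.
have y0 := kummer_gen_neq0.
have z0 : z != 0 by rewrite mulf_neq0 ?invr_eq0 // expf_neq0.
have zk : z ^+ k = (f / s ^+ k)%:A.
  rewrite /z exprMn exprVn -exprM mulnC -nkw y_pow.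
  have -> : (s%:A : L) ^+ k = (s ^+ k)%:A by exact: (esym (rmorphXn (in_alg L) k s)).
  by exact: (esym (fmorph_div (in_alg L) f (s ^+ k))).
have g_val : b (f / s ^+ k) = 0.
  have -> : f / s ^+ k = -1 + (f / s ^+ k + 1) by ring.
  have n1 : (-1 : E) != 0 by rewrite oppr_eq0 oner_neq0.
  have v1 : b (-1) = 0 by rewrite (valN (pv b)) (val1 (pv b)).
  by rewrite (valD_lt (pv b)) ?v1.
have Pz : P z = 0.
  have : P z *+ k = 0 by rewrite -(valX pP) zk restrictE g_val mulr0.
  by move/eqP; rewrite mulrn_eq0 -[k == 0%N]negbK -lt0n k0 => /eqP.
have Pz0 : vge P 0 z by right; rewrite Pz.
have [c Hc] := residue_constant dP Pz0.
have Hk := vge_subX k Pz0 (vge_const pP c) Hc.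
have ck : c ^+ k = -1.
  apply/eqP; rewrite -subr_eq0 opprK; apply/eqP/(@const_vge1 P).
  have -> : iota (c ^+ k + 1) = (z ^+ k + 1) - (z ^+ k - iota c ^+ k).
    by rewrite rmorphD rmorphXn rmorph1; ring.
  by apply: (vgeB pP) => //; have := alg_vge1 bf; rewrite scalerDl scale1r -zk.
have c0 : c != 0.
  by apply: contra_eq_neq ck => ->; rewrite expr0n -[k == 0%N]negbK -lt0n k0 eq_sym oppr_eq0 oner_neq0.
by have := unit_pow c0; rewrite nkw exprM ck -signr_odd ow expr1 => /eqP; rewrite (negPf m1).
Qed.

Variables (b1 : place iota0) (Sf : seq (place iota0)).
Hypotheses (b1_deg : place_deg b1 = 1%N) (Sf_supp : forall b, b \notin Sf -> b f = 0)
  (Sf_sum : forall S, uniq S -> {subset Sf <= S} -> \sum_(b <- S) b f * (place_deg b)%:Z = 0)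
  (Sf_uniq : uniq Sf).

(* Enough extra poles above b1 make Riemann-Roch exact on every component. *)
Lemma dominating_pullback (D : place iota -> int) : divisor iota D ->
  exists D' : place iota -> int, exists (s : seq (place iota)) l,
  [/\ divisor iota D', uniq s, forall P, P \notin s -> D P = 0 /\ D' P = 0, forall P, D P <= D' P &
   has_quotient_dim iota (riemann_roch_space D') [set 0] l /\
   2 * (divisor_deg D' - l%:Z) = \sum_(b <- Sf) (n%:Z - (d b)%:Z) * (place_deg b)%:Z - 2 * n%:Z].
Proof.
move=> /finite_seqP [sD sDE].
pose S := undup (b1 :: Sf ++ [seq restrict P | P <- sD]); have uS : uniq S := undup_uniq _.
pose m0 b : int := \sum_(P <- fiber L b) `|D P|.
have b1S : b1 \in S by rewrite mem_undup mem_head.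
have m0S b : b \notin S -> m0 b = 0.
  move=> bS; rewrite /m0 big1_seq // => P /andP[_]; rewrite mem_fiber => /eqP Pb.
  apply/eqP; rewrite normr_eq0; apply: contraNT bS => DP.
  rewrite mem_undup inE mem_cat -Pb; apply/orP; right; apply/orP; right; apply: map_f.
  by have : [set P | D P != 0] P by []; rewrite sDE.
have fS b : b \notin S -> b f = 0.
  by move=> bS; apply: Sf_supp; apply: contra bS => bS; rewrite mem_undup inE mem_cat bS orbT.
have SfS : {subset Sf <= S} by move=> b bS; rewrite mem_undup inE mem_cat bS orbT.
(* The divisor [m0] pulls back above D but its components may have very negative degree. As b1 has
   degree one, adding k e at b1 raises the degree of each component by exactly k, and k is at least
   |G i| for all i. *)
pose G (i : 'I_n) := \sum_(b <- S) component_divisor m0 i b * (place_deg b)%:Z.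
pose k := (\sum_i `|G i|)%N.
pose m b := m0 b + (if b == b1 then k%:Z * (e b1)%:Z else 0).
have mS b : b \notin S -> m b = 0.
  move=> bS; rewrite /m m0S //; case: eqVneq => [bb1|_]; last by rewrite addr0.
  by rewrite bb1 b1S in bS.
have Hdeg (i : 'I_n) : -1 <= \sum_(b <- S) component_divisor m i b * (place_deg b)%:Z.
  have E1 b : component_divisor m i b = component_divisor m0 i b + (if b == b1 then k%:Z else 0).
    rewrite /component_divisor /m; case: eqVneq => [->|_]; last by rewrite !addr0.
    by rewrite addrA [X in (X %/ _)%Z]addrC divzMDl;
      [exact: addrC | rewrite eqz_nat -lt0n ram_index_gt0].
  under eq_bigr do rewrite E1 mulrDl.
  rewrite big_split /= -/(G i) (bigD1_seq b1) //= eqxx b1_deg mulr1 big1 ?addr0 => [|b /negPf ->]; last by rewrite mul0r.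
  have : (`|G i| <= k)%N by rewrite /k (bigD1 i) //= leq_addr.
  by move: (G i) => x; lia.
have [l Hl El] := pullback_dim uS mS fS Hdeg.
pose s := flatten [seq fiber L b | b <- S].
have us : uniq s by exact: flatten_fiber_uniq.
have sP P : P \notin s -> restrict P \notin S.
  apply: contra => PS; apply/flatten_mapP; exists (restrict P) => //.
  by rewrite mem_fiber.
exists (pullback m), s, l; split=> //.
- apply: (sub_finite_set (B := [set` s])); last exact: finite_seq.
  by move=> P /=; apply: contraNT => /sP /mS H; apply/eqP.
- move=> P /sP PS; split; last exact: mS.
  apply/eqP; apply: contraNT PS => DP; rewrite mem_undup inE mem_cat.
  apply/orP; right; apply/orP; right; apply: map_f.
  by have : [set P | D P != 0] P by []; rewrite sDE.
- move=> P; apply: (le_trans (ler_norm _)); rewrite /pullback /m /m0.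
  have Pf : P \in fiber L (restrict P) by rewrite mem_fiber.
  rewrite (sum_rem _ Pf) -addrA lerDl addr_ge0 ?sumr_ge0 //.
  by case: eqP.
split=> //; rewrite mulrBr El (Sf_sum uS SfS).
have -> : \sum_(b <- Sf) (n%:Z - (d b)%:Z) * (place_deg b)%:Z = \sum_(b <- S) (n%:Z - (d b)%:Z) * (place_deg b)%:Z.
  apply: sum_support => // b /Sf_supp bf.
  by rewrite /ram_gcd bf /= gcdn0 subrr mul0r.
ring.
Qed.

(** All dominating pullbacks have the same deg - l. By monotonicity this value bounds deg - l for
    every divisor, and the pullback dominating 0 attains it. *)
Lemma kummer_genus :
  2 * genus iota = \sum_(b <- Sf) (n%:Z - (d b)%:Z) * (place_deg b)%:Z - 2 * n%:Z + 2.
Proof.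
set R := \sum_(b <- _) _.
have [D0 [s0 [l0 [dD0 us0 sD0 _ [Hl0 E0]]]]] : exists D' : place iota -> int, exists (s : seq (place iota)) l,
  [/\ divisor iota D', uniq s, forall P, P \notin s -> (0 : int) = 0 /\ D' P = 0, forall P, 0 <= D' P &
   has_quotient_dim iota (riemann_roch_space D') [set 0] l /\
   2 * (divisor_deg D' - l%:Z) = R - 2 * n%:Z].
  apply: (dominating_pullback (D := fun=> 0)).
  by rewrite /divisor /=; apply: (sub_finite_set (B := set0)) => // P /=; rewrite eqxx.
rewrite (@genus_unique _ _ _ (divisor_deg D0 - l0%:Z + 1)).
- by rewrite mulrDr E0 mulr1.
- by exists D0 => //; rewrite (riemann_roch_dimE Hl0).
move=> D dD; have [D' [s [l' [dD' us sD DD' [Hl' E']]]]] := dominating_pullback dD.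
have [l Hl lE] := riemann_roch_mono residue (fun P Ps => etrans (sD P Ps).1 (esym (sD P Ps).2)) us DD' Hl'.
rewrite (riemann_roch_dimE Hl) lerD2r.
have e1 : divisor_deg D' - l'%:Z = divisor_deg D0 - l0%:Z.
  by apply: (mulfI (x := 2)) => //; rewrite E' E0.
rewrite -e1; move: lE; rewrite (divisor_degE us (fun P Ps => (sD P Ps).1)) (divisor_degE us (fun P Ps => (sD P Ps).2)).
under eq_bigr do rewrite mulrBl.
rewrite sumrB; move: (\sum_(P <- s) D P * _) (\sum_(P <- s) D' P * _) => x x'; lia.
Qed.

End Kummer.

(** * The curve *)

Lemma frobeniusB (R : comNzRingType) (p k : nat) (x y : R) : p \in [pchar R] ->
  (x - y) ^+ (p ^ k) = x ^+ (p ^ k) - y ^+ (p ^ k).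
Proof.
move=> pR; have pnat : [pchar R].-nat (p ^ k)%N.
  rewrite pnatX pnatE ?pR //; exact: pcharf_prime pR.
by apply/eqP; rewrite eq_sym subr_eq -exprDn_pchar // subrK.
Qed.

(** One Euclidean step: p^(2h+1) - 1 = p (p^h + 1)(p^h - 1) + (p - 1), and p - 1 divides p^h - 1. *)
Lemma gcdn_pred_pow (p h : nat) : (0 < p)%N ->
  gcdn (p ^ (h + h.+1)).-1 (p ^ h).-1 = p.-1.
Proof.
move=> p0; have pk k : (0 < p ^ k)%N by rewrite expn_gt0 p0.
have p1 : (p.-1 %| (p ^ h).-1)%N.
  by rewrite predn_exp dvdn_mulr.
have -> : (p ^ (h + h.+1)).-1 = (p * (p ^ h).+1 * (p ^ h).-1 + p.-1)%N.
  rewrite expnD expnS; case: (p ^ h)%N (pk h) => // a _; case: {pk} p p0 p1 => // p' _ _ /=.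
  nia.
by rewrite gcdnC gcdnMDl; apply/gcdn_idPr.
Qed.

Lemma coprime_pred_pow (p k l : nat) : (0 < p)%N -> (0 < k)%N -> coprime (p ^ k).-1 (p ^ l).
Proof.
move=> p0 k0; apply: coprimeXr; rewrite -(coprime_pexpr _ _ k0).
by rewrite -{2}[(p ^ k)%N]prednK ?expn_gt0 ?p0 // coprimenS.
Qed.

(** The second argument is the pole order of f at infinity. It equals (q - 1) - (p^h - 1), which
    reduces the claim to [gcdn_pred_pow]. *)
Lemma gcdn_pred_pow_infinity (p h : nat) : (0 < p)%N ->
  gcdn (p ^ (h + h.+1)).-1 (p ^ h * (p ^ h.+1).-1) = p.-1.
Proof.
move=> p0; have pk k : (0 < p ^ k)%N by rewrite expn_gt0 p0.
rewrite -(gcdn_pred_pow h p0).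
have e : (p ^ (h + h.+1)).-1 = (1 * (p ^ h * (p ^ h.+1).-1) + (p ^ h).-1)%N.
  by rewrite expnD; have := pk h; have := pk h.+1; move: (p ^ h)%N (p ^ h.+1)%N => a b a0 b0; nia.
have e' : (p ^ h * (p ^ h.+1).-1)%N = ((p ^ (h + h.+1)).-1 - (p ^ h).-1)%N by rewrite e mul1n addnK.
rewrite {1}e gcdnC gcdnMDl gcdnC [RHS]gcdnC.
by rewrite e mul1n gcdnC gcdnDr [RHS]gcdnC.
Qed.

(** * Local forms of f in terms of u *)

Section CurveFunctionInField.
Variables (K F : fieldType) (iota : {rmorphism K -> F}) (v : F -> int) (pv : prevaluation iota v).
Variables (p h : nat).
Hypotheses (p_gt1 : (1 < p)%N) (h_gt0 : (0 < h)%N).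
Local Notation q := (p ^ (h + h.+1))%N.

Lemma power_quotient_val (x z : F) (N : nat) : x != 0 -> z != 0 ->
  v (- (x ^+ N / z)) = N%:Z * v x - v z.
Proof.
move=> x0 z0; have xN := expf_neq0 N x0.
have zV : z^-1 != 0 by rewrite invr_eq0.
by rewrite (valN pv) (valM pv xN zV) (valX pv) (valV pv) -mulr_natl natz.
Qed.

(** The fraction is the common local form of f / s^(p-1) + 1 at the roots of u^p - u and at
    infinity: its denominator is a unit and its numerator vanishes with t. *)
Lemma vge_geometric (t : F) (A B : nat) : (0 < A)%N -> (0 < B)%N -> vge v 1 t ->
  vge v 1 ((t ^+ A - t ^+ B) / (t ^+ A - 1)).
Proof.
move=> A0 B0 vt.
have vtN N : (0 < N)%N -> vge v 1 (t ^+ N).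
  elim: N => // -[|N] IH _; first by rewrite expr1.
  by rewrite exprS -[1]addr0; apply: (vgeM pv vt); apply: vge_le (IH isT).
have d : v (t ^+ A - 1) = 0.
  by rewrite addrC (valD_lt pv) ?oppr_eq0 ?oner_eq0 // (valN pv) (val1 pv) //; exact: vtN.
rewrite -[1 : int]addr0; apply: (vgeM pv); first by apply: (vgeB pv); exact: vtN.
by right; rewrite (valV pv) d.
Qed.

Hypothesis pchF : p \in [pchar F].

Definition field_curve_fun (u : F) : F :=
  - ((u ^+ (p ^ h.+1) - u) ^+ (p ^ h) / (u ^+ (p ^ h) - u)).

Lemma field_curve_num (u : F) : (u ^+ (p ^ h.+1) - u) ^+ (p ^ h) = u ^+ q - u ^+ (p ^ h).
Proof. by rewrite frobeniusB // -exprM -expnD addSn addnS. Qed.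

(** Since u^q - u vanishes at every rational finite place, f takes the value 1 wherever the
    denominator does not vanish. *)
Lemma field_curve_fun_sub1 (u : F) : u ^+ (p ^ h) - u != 0 ->
  field_curve_fun u - 1 = - ((u ^+ q - u) / (u ^+ (p ^ h) - u)).
Proof. by move=> u0; rewrite /field_curve_fun field_curve_num; field. Qed.

Lemma frobenius_translate (u c : F) (k : nat) : c ^+ p = c ->
  (u - c) ^+ (p ^ k) - (u - c) = u ^+ (p ^ k) - u.
Proof.
move=> cp; have ck : c ^+ (p ^ k) = c by elim: k => [|k IH]; rewrite ?expr1 // expnSr exprM IH.
by rewrite frobeniusB // ck; ring.
Qed.

(** Moves any root of u^p = u to the origin, so that one expansion serves them all. *)
Lemma field_curve_fun_translate (u c : F) : c ^+ p = c -> field_curve_fun u = field_curve_fun (u - c).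
Proof. by move=> cp; rewrite /field_curve_fun !frobenius_translate. Qed.

Let pk_gt0 k : (0 < p ^ k)%N. Proof. by rewrite expn_gt0 ltnW. Qed.

Lemma q_split : q = (p ^ h + (q - p ^ h))%N.
Proof. by rewrite subnKC // leq_pexp2l ?leq_addr // ltnW. Qed.

(** The exponent p^h - 1 is the order of f at t = 0, so the quotient has value -1 there. *)
Lemma field_curve_fun_zero (t : F) : t != 0 -> t ^+ (p ^ h) - t != 0 ->
  field_curve_fun t / t ^+ (p ^ h).-1 + 1 =
  (t ^+ (p ^ h).-1 - t ^+ (q - p ^ h)) / (t ^+ (p ^ h).-1 - 1).
Proof.
move=> t0; rewrite /field_curve_fun field_curve_num.
have -> : t ^+ q = t * t ^+ (p ^ h).-1 * t ^+ (q - p ^ h).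
  by rewrite -exprS prednK // -exprD -q_split.
have -> : t ^+ (p ^ h) = t * t ^+ (p ^ h).-1 by rewrite -exprS prednK.
have : t ^+ (p ^ h).-1 != 0 by exact: expf_neq0.
move: (t ^+ _) (t ^+ _) => X Y X0; rewrite -{2}[t]mulr1 -mulrBr mulf_eq0 negb_or => /andP[_ X1].
have W : t * Y - t != 0 by rewrite -[X in _ - X]mulr1 -mulrBr mulf_neq0.
by field; rewrite ?W ?X0 ?X1.
Qed.

(** With t = 1/u, the exponent q - p^h is the pole order of f, and the right-hand side is the same
    as at a zero. *)
Lemma field_curve_fun_infinity (t : F) : t != 0 -> t^-1 ^+ (p ^ h) - t^-1 != 0 ->
  field_curve_fun t^-1 / t^-1 ^+ (q - p ^ h) + 1 =
  (t ^+ (p ^ h).-1 - t ^+ (q - p ^ h)) / (t ^+ (p ^ h).-1 - 1).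
Proof.
move=> t0; rewrite /field_curve_fun field_curve_num !exprVn.
have -> : t ^+ q = t * t ^+ (p ^ h).-1 * t ^+ (q - p ^ h).
  by rewrite -exprS prednK // -exprD -q_split.
have -> : t ^+ (p ^ h) = t * t ^+ (p ^ h).-1 by rewrite -exprS prednK.
have : t ^+ (p ^ h).-1 != 0 by exact: expf_neq0.
have : t ^+ (q - p ^ h) != 0 by exact: expf_neq0.
move: (t ^+ _) (t ^+ _) => Y X Y0 X0 H.
have Y1 : Y - 1 != 0.
  by apply: contraNneq H => e; rewrite -[Y](subrK 1) e add0r mulr1 subrr.
have Y1' : 1 + -1 * Y != 0 by rewrite mulN1r -opprB oppr_eq0.
by field; rewrite Y1 Y0 oner_neq0 t0 X0 Y1'.
Qed.

End CurveFunctionInField.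

(** * The polynomials u^(p^k) - u and their values at places *)

Section PowerDifference.
Variables (K : finFieldType) (p h : nat) (beta : K).
Hypotheses (p_pr : prime p) (h_gt0 : (0 < h)%N) (card_K : #|K| = (p ^ (h + h.+1))%N) (beta0 : beta != 0).
Local Notation Kx := {fraction {poly K}}.
Local Notation inf := (place_at_infinity K).
Local Notation iota0 := (base_constants K).
Local Notation q := (p ^ (h + h.+1))%N.
Implicit Types b : place iota0.
Let pv := @place_prevaluation K Kx iota0.

Lemma pcharK : p \in [pchar K]. Proof. exact: card_finPcharP card_K p_pr. Qed.

Lemma pchar_polyK : p \in [pchar {poly K}]. Proof. by rewrite pchar_poly pcharK. Qed.

Let p_gt1 : (1 < p)%N. Proof. exact: prime_gt1. Qed.
Let p_gt0 : (0 < p)%N. Proof. exact: prime_gt0. Qed.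

Lemma frob_card (x : K) : x ^+ q = x. Proof. by rewrite -card_K expf_card. Qed.

Definition uvar : {poly K} := beta *: 'X.
Local Notation u := uvar.

Definition power_diff (k : nat) : {poly K} := u ^+ (p ^ k) - u.
Local Notation g := power_diff.

Lemma horner_power_diff k c : (g k).[c] = (beta * c) ^+ (p ^ k) - beta * c.
Proof. by rewrite /power_diff /uvar !hornerE. Qed.

Lemma size_upow N : size (u ^+ N) = N.+1.
Proof. by rewrite /uvar exprZn size_scale ?expf_neq0 // size_polyXn. Qed.

Lemma pk_gt1 k : (0 < k)%N -> (1 < p ^ k)%N.
Proof. by move=> k0; rewrite -(exp1n k) ltn_exp2r. Qed.

Lemma size_power_diff k : (0 < k)%N -> size (g k) = (p ^ k).+1.
Proof.
move=> k0; have su : size u = 2%N by have := size_upow 1; rewrite expr1.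
by rewrite size_polyDl ?size_upow // size_polyN su ltnS pk_gt1.
Qed.

Lemma power_diff_neq0 k : (0 < k)%N -> g k != 0.
Proof. by move=> k0; rewrite -size_poly_gt0 size_power_diff. Qed.

Lemma deriv_power_diff k : (0 < k)%N -> (g k)^`() = - beta%:P.
Proof.
move=> k0; rewrite /power_diff /uvar derivB exprZn !derivZ derivXn derivX -mulr_natl.
have -> : (p ^ k)%:R = 0 :> {poly K}.
  by rewrite -(prednK k0) expnS natrM (pcharf0 pchar_polyK) mul0r.
by rewrite mul0r scaler0 sub0r alg_polyC.
Qed.

Lemma power_diff_rec k : g k.+1 = g k ^+ p + g 1.
Proof.
have := @frobeniusB _ p 1 (u ^+ (p ^ k)) u pchar_polyK; rewrite /power_diff !expn1 => ->.
by rewrite -exprM -expnSr addrA subrK.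
Qed.

Lemma dvdp_power_diff k : (0 < k)%N -> g 1 %| g k.
Proof.
elim: k => // -[|k] IH _ //; rewrite [g k.+2]power_diff_rec dvdp_add //.
by rewrite -(prednK p_gt0) exprS dvdp_mulr // IH.
Qed.

(** By [power_diff_rec] the polynomial for h + 1 is the p-th power of the one for h plus u^p - u. *)
Lemma power_diff_coprime (pi : {poly K}) : pi %| g h.+1 -> pi %| g h -> pi %| g 1.
Proof.
rewrite power_diff_rec => H1 H0.
have pg : pi %| g h ^+ p by rewrite -(prednK p_gt0) exprS dvdp_mulr.
by rewrite -(dvdp_addr _ pg).
Qed.

(* The polynomials are separable, since their derivative is a nonzero constant. *)
Lemma power_diff_val b k : b != inf -> (0 < k)%N -> b (g k)%:F = 0 \/ b (g k)%:F = 1.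
Proof.
move=> /base_place_finite [pi [pi_irr ->]] k0.
rewrite finite_place_tofrac ?power_diff_neq0 //.
have [j Hj] := multiplicity_exists pi_irr (power_diff_neq0 k0).
rewrite (multiplicityE pi_irr Hj); case: j Hj => [|[|j]] Hj; [by left | by right |].
have [r e] : exists r, g k = pi * (pi * r).
  by case: Hj => r _ ->; exists (pi ^+ j * r); rewrite !exprS -!mulrA.
have : pi %| (g k)^`().
  by rewrite e derivM dvdp_add //; [rewrite dvdp_mull // dvdp_mulr | rewrite dvdp_mulr].
rewrite deriv_power_diff // dvdpNr => /dvdp_leq; rewrite polyC_eq0 => /(_ beta0).
by rewrite size_polyC beta0 leqNgt; case: pi_irr => ->.
Qed.

Lemma power_diff_val_gt0 b k : b != inf -> (0 < k)%N ->
  (b (g k)%:F == 1) = `[< vge b 1 (g k)%:F >].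
Proof.
move=> binf k0; have g0 : (g k)%:F != 0 by rewrite tofrac_eq0 power_diff_neq0.
apply/eqP/asboolP => [e|/(vge_neq0 g0)]; first by right; rewrite e.
by case: (power_diff_val binf k0) => ->.
Qed.

Lemma power_diff_val_infinity k : (0 < k)%N -> inf (g k)%:F = - (p ^ k)%:Z.
Proof. by move=> k0; rewrite place_at_infinity_tofrac ?power_diff_neq0 // size_power_diff. Qed.

Definition curve_fun : Kx := - ((g h.+1)%:F ^+ (p ^ h) / (g h)%:F).
Local Notation f := curve_fun.

Lemma curve_fun_neq0 : f != 0.
Proof.
rewrite /curve_fun oppr_eq0 mulf_eq0 invr_eq0 !expf_eq0 !tofrac_eq0.
by rewrite (negPf (power_diff_neq0 (ltn0Sn h))) (negPf (power_diff_neq0 h_gt0)) andbF.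
Qed.

Lemma curve_fun_val b : b f = (p ^ h)%:Z * b (g h.+1)%:F - b (g h)%:F.
Proof.
by apply: (power_quotient_val (pv b)); rewrite tofrac_eq0 power_diff_neq0.
Qed.

End PowerDifference.

(** * Ramification, genus and rational places of the curve *)

Section CurvePlaces.
Variables (K : finFieldType) (p h : nat) (beta : K).
Hypotheses (p_pr : prime p) (h_gt0 : (0 < h)%N) (card_K : #|K| = (p ^ (h + h.+1))%N) (beta0 : beta != 0).
Local Notation Kx := {fraction {poly K}}.
Local Notation inf := (place_at_infinity K).
Local Notation iota0 := (base_constants K).
Local Notation q := (p ^ (h + h.+1))%N.
Local Notation n := q.-1.
Local Notation u := (uvar beta).
Local Notation g := (power_diff p beta).
Local Notation f := (curve_fun p h beta).
Implicit Types b : place iota0.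
Let pv := @place_prevaluation K Kx iota0.
Let p_gt1 : (1 < p)%N. Proof. exact: prime_gt1. Qed.
Let p_gt0 : (0 < p)%N. Proof. exact: prime_gt0. Qed.
Lemma tofrac_power_diff k : (g k)%:F = u%:F ^+ (p ^ k) - u%:F.
Proof. by rewrite /power_diff rmorphB rmorphXn. Qed.

Lemma curve_funE : f = field_curve_fun p h u%:F.
Proof. by rewrite /curve_fun /field_curve_fun !tofrac_power_diff. Qed.

Lemma power_diff_val_int b k : b != inf -> (0 < k)%N ->
  b (g k)%:F = (b (g k)%:F == 1)%:Z.
Proof.
by move=> bi k0; case: (power_diff_val p_pr card_K beta0 bi k0) => ->.
Qed.

Lemma power_diff_one_val b : b != inf ->
  (b (g 1)%:F == 1) = (b (g h.+1)%:F == 1) && (b (g h)%:F == 1).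
Proof.
move=> bi; rewrite !(power_diff_val_gt0 p_pr card_K beta0 bi) //.
have [pi [pi_irr ->]] := base_place_finite bi.
apply/asboolP/andP => [/finite_place_gt0 H|[/asboolP/finite_place_gt0 H1 /asboolP/finite_place_gt0 H2]].
  by split; apply/asboolP/finite_place_gt0; apply: (dvdp_trans H);
     [exact: (dvdp_power_diff beta p_pr card_K (ltn0Sn h)) | exact: (dvdp_power_diff beta p_pr card_K h_gt0)].
by apply/finite_place_gt0; exact: (power_diff_coprime p_pr card_K H1 H2).
Qed.

(** In the order of the branches, b(f) is p^h - 1, p^h, -1 and 0. *)
Lemma ram_gcd_curve b : b != inf -> ram_gcd f n b =
  if b (g h.+1)%:F == 1 then if b (g h)%:F == 1 then p.-1 else 1%N
  else if b (g h)%:F == 1 then 1%N else n.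
Proof.
move=> bi; rewrite /ram_gcd (curve_fun_val p_pr h_gt0 beta0).
rewrite [in X in gcdn _ `|X|%N](power_diff_val_int bi (ltn0Sn h)) [in X in gcdn _ `|X|%N](power_diff_val_int bi h_gt0).
have pp : (0 < p ^ h)%N by rewrite expn_gt0 p_gt0.
case: (_ == 1); case: (_ == 1); rewrite ?mulr1 ?mulr0 ?subr0 ?sub0r.
- have -> : (p ^ h)%N%:Z - true%:Z = (p ^ h).-1%:Z by rewrite predn_int.
  by rewrite absz_nat gcdn_pred_pow.
- by apply/eqP; exact: (coprime_pred_pow h p_gt0 (ltn_addl h (ltn0Sn h))).
- by rewrite abszN gcdn1.
- by rewrite gcdn0.
Qed.

Lemma curve_fun_val_infinity : inf f = - (p ^ h * (p ^ h.+1).-1)%N%:Z.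
Proof.
rewrite (curve_fun_val p_pr h_gt0 beta0) !(power_diff_val_infinity p_pr beta0) //.
have pp : (0 < p ^ h.+1)%N by rewrite expn_gt0 p_gt0.
by rewrite -{1}(prednK pp) PoszM -addn1 PoszD; ring.
Qed.

Lemma ram_gcd_infinity : ram_gcd f n inf = p.-1.
Proof. by rewrite /ram_gcd curve_fun_val_infinity abszN absz_nat gcdn_pred_pow_infinity. Qed.

(** The finite zeros are simple, and by the product formula their total degree is the pole order p^k
    at infinity. *)
Lemma power_diff_degree k : (0 < k)%N -> exists S0 : seq (place iota0), forall S, uniq S -> {subset S0 <= S} ->
  (\sum_(b <- S | b != inf) (b (g k)%:F == 1)%R * place_deg b = p ^ k)%N.
Proof.
move=> k0; have gk0 : (g k)%:F != 0 by rewrite tofrac_eq0 (power_diff_neq0 p_pr beta0).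
have [S0 [_ H]] := product_formula gk0.
exists (inf :: S0) => S Su sub.
have infS : inf \in S by apply: sub; rewrite mem_head.
have := H S Su (fun b bS => sub b (mem_behead (s := inf :: S0) bS)).
have einf : inf (g k)%:F * (place_deg inf)%:Z = - (p ^ k)%N%:Z.
  by rewrite (power_diff_val_infinity p_pr beta0 k0) place_at_infinity_deg mulr1.
rewrite (bigD1_seq inf infS Su) einf /= => /eqP; rewrite addrC subr_eq0 => /eqP e; apply/eqP; rewrite -eqz_nat -e natr_sum_posz; apply/eqP.
by apply: eq_bigr => b bi; rewrite PoszM -power_diff_val_int.
Qed.

(** Expresses through total degrees that S contains all finite zeros of the three polynomials. *)
Definition degree_sum_cover S := forall k, k \in [:: 1; h; h.+1]%N ->
  (\sum_(b <- S | b != inf) (b (g k)%:F == 1)%R * place_deg b = p ^ k)%N.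

Lemma degree_sum_cover_exists : exists S0 : seq (place iota0), forall S, uniq S -> {subset S0 <= S} -> degree_sum_cover S.
Proof.
have [S1 H1] := power_diff_degree (ltn0Sn 0).
have [S2 H2] := power_diff_degree h_gt0.
have [S3 H3] := power_diff_degree (ltn0Sn h).
exists (S1 ++ S2 ++ S3) => S Su sub k; rewrite !inE.
by case/or3P => /eqP ->; [apply: H1 | apply: H2 | apply: H3] => // b bS;
   apply: sub; rewrite !mem_cat bS ?orbT.
Qed.

(** A zero of the polynomial for h + 1 that is not one for h has b(f) = p^h, prime to n. Without
    such a zero all zeros for h + 1 would be zeros of u^p - u, and comparing degrees would give
    p^(h+1) <= p. *)
Lemma totally_ramified_place_exists : exists b, coprimez n%:Z (b f).
Proof.
apply: contrapT => H.
have [S0 HS] := degree_sum_cover_exists.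
have cov := HS _ (undup_uniq S0) (fun b bS => etrans (mem_undup S0 b) bS).
have : (p ^ h.+1 <= p ^ 1)%N; last by rewrite leq_exp2l // ltnNge h_gt0.
rewrite -(cov h.+1) ?inE ?eqxx ?orbT // -(cov 1%N) ?inE ?eqxx ?orbT //.
apply: leq_sum => b bi; rewrite leq_mul2r; apply/orP; right.
rewrite power_diff_one_val //; case: eqP => // e1; case: eqP => // e2; case: H; exists b.
rewrite /coprimez /gcdz; have := ram_gcd_curve bi; rewrite /ram_gcd => ->.
by rewrite e1 eqxx (introF eqP e2).
Qed.

(** If A and B are the indicators of the zeros for h + 1 and h, then n - gcd = (n - 1)(A + B) - (n +
    p - 3) A B, where n + p - 3 = 2 (n - 1) - (n - (p - 1)). The product A B is the indicator for
    u^p - u. *)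
Lemma degree_sum_complement (S : seq (place iota0)) : degree_sum_cover S ->
  \sum_(b <- S | b != inf) (n%:Z - (ram_gcd f n b)%:Z) * (place_deg b)%:Z =
  (n%:Z - 1) * ((p ^ h.+1)%N%:Z + (p ^ h)%N%:Z) - (n%:Z + p%:Z - 3) * p%:Z.
Proof.
move=> cov.
transitivity ((n%:Z - 1) * ((\sum_(b <- S | b != inf) (b (g h.+1)%:F == 1)%R * place_deg b)%N%:Z
    + (\sum_(b <- S | b != inf) (b (g h)%:F == 1)%R * place_deg b)%N%:Z)
  - (n%:Z + p%:Z - 3) * (\sum_(b <- S | b != inf) (b (g 1)%:F == 1)%R * place_deg b)%N%:Z); last first.
  by rewrite !cov ?inE ?eqxx ?orbT // expn1.
rewrite !natr_sum_posz -big_split mulr_sumr.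
rewrite mulr_sumr -sumrB; apply: eq_bigr => b bi.
rewrite (ram_gcd_curve bi) (power_diff_one_val bi).
have p1 : p.-1%:Z = p%:Z - 1 by rewrite predn_int.
case: (b _ == 1); case: (b _ == 1); rewrite /= ?p1; lia.
Qed.

Variables (L : fieldExtType Kx) (y : L).
Hypotheses (y_pow : y ^+ n = f%:A) (y_gen : <<1%VS; y>>%VS = fullv).
Local Notation iota := (ext_constants iota0 L).
Implicit Types P : place iota.

Let card_n : #|K| = n.+1. Proof. by rewrite card_K prednK // expn_gt0 p_gt0. Qed.
Let f0 : f != 0. Proof. exact: curve_fun_neq0. Qed.

Lemma curve_genus : 2 * genus iota =
  (n%:Z - 1) * ((p ^ h.+1)%N%:Z + (p ^ h)%N%:Z - p%:Z - 1) - p%:Z ^+ 2 + p%:Z + 2.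
Proof.
have [b_tot b_totP] := totally_ramified_place_exists.
have [S0 HS0] := degree_sum_cover_exists.
have [S1 [S1v S1s]] := product_formula f0.
pose S := undup (inf :: S0 ++ S1).
have sub1 : {subset S1 <= S} by move=> b bS; rewrite mem_undup inE mem_cat bS !orbT.
have sub0 : {subset S0 <= S} by move=> b bS; rewrite mem_undup inE mem_cat bS !orbT.
have Su : uniq S := undup_uniq _.
have Sv b : b \notin S -> b f = 0.
  by move=> bS; apply: S1v; apply: contra bS; exact: sub1.
have Ss T : uniq T -> {subset S <= T} -> \sum_(b <- T) b f * (place_deg b)%:Z = 0.
  by move=> Tu ST; apply: S1s => // b /sub1 /ST.
rewrite (kummer_genus card_n f0 y_pow y_gen b_totP (@base_residue K) (@base_riemann_roch K)
  (place_at_infinity_deg K) Sv Ss Su).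
have infS : inf \in S by rewrite mem_undup mem_head.
rewrite (bigD1_seq inf) //= degree_sum_complement; last exact: HS0.
rewrite ram_gcd_infinity place_at_infinity_deg mulr1.
have p1 : p.-1%:Z = p%:Z - 1 by rewrite predn_int.
rewrite p1; ring.
Qed.

Definition rational_place (c : K) : place iota0 := finite_place (irredp_XsubC c).

Lemma rational_place_gt0 c (r : {poly K}) : vge (rational_place c) 1 r%:F <-> root r c.
Proof. by rewrite -dvdp_XsubCl; exact: finite_place_gt0. Qed.

Lemma rational_place_deg c : place_deg (rational_place c) = 1%N.
Proof. by rewrite /rational_place finite_place_deg size_XsubC. Qed.

Lemma rational_place_inj : injective rational_place.
Proof.
move=> c d e; have /rational_place_gt0 : root ('X - c%:P) c by rewrite root_XsubC.
by rewrite e => /rational_place_gt0; rewrite root_XsubC => /eqP.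
Qed.

Lemma rational_place_neq_infinity c : rational_place c != inf.
Proof. exact: finite_place_neq_infinity. Qed.

Lemma rational_place_val0 c (r : {poly K}) : ~~ root r c -> rational_place c r%:F = 0.
Proof.
move=> rc; have r0 : r%:F != 0 by rewrite tofrac_eq0; apply: contraNneq rc => ->; exact: root0.
have ge0 := vge_neq0 r0 (finite_place_poly (irredp_XsubC c) r).
apply/le_anti/andP; split; last exact: ge0.
rewrite leNgt; apply/negP => gt0; move/negP: rc; apply.
by apply/rational_place_gt0; right; rewrite -gtz0_ge1.
Qed.

Lemma root_power_diff k c : root (g k) c = ((beta * c) ^+ (p ^ k) == beta * c).
Proof. by rewrite rootE horner_power_diff subr_eq0. Qed.

Lemma root_power_diff_one k c : root (g 1) c -> root (g k) c.
Proof.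
rewrite !root_power_diff expn1 => /eqP e; apply/eqP.
by elim: k => [|k IH]; rewrite ?expr1 // expnSr exprM IH.
Qed.

(** Write v for beta c. As q = p^(h + h + 1), using v^(p^h) = v twice in v^q = v leaves v^p = v. *)
Lemma root_power_diff_h c : root (g h) c -> root (g 1) c.
Proof.
rewrite !root_power_diff expn1 => /eqP e; apply/eqP.
by have := frob_card card_K (beta * c); rewrite expnD exprM e expnSr exprM e.
Qed.

Lemma pchar_Kx : p \in [pchar Kx].
Proof. exact: (rmorph_pchar iota0 (pcharK p_pr card_K)). Qed.

Lemma curve_fun_split c : ~~ root (g 1) c -> vge (rational_place c) 1 (f - 1).
Proof.
move=> c1; have ch : ~~ root (g h) c by apply: contra c1; exact: root_power_diff_h.
have pc := pv (rational_place c).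
have gh0 : u%:F ^+ (p ^ h) - u%:F != 0.
  by rewrite -tofrac_power_diff tofrac_eq0 (power_diff_neq0 p_pr beta0).
rewrite curve_funE (field_curve_fun_sub1 pchar_Kx gh0).
apply: (vgeN pc); rewrite -[1 : int]addr0; apply: (vgeM pc).
  rewrite -tofrac_power_diff; apply/rational_place_gt0.
  by rewrite root_power_diff (frob_card card_K).
by right; rewrite -tofrac_power_diff (valV pc) rational_place_val0.
Qed.

Lemma rational_place_ramified c : root (g 1) c -> ram_gcd f n (rational_place c) = p.-1.
Proof.
move=> c1; rewrite (ram_gcd_curve (rational_place_neq_infinity c)).
have one k : (0 < k)%N -> rational_place c (g k)%:F == 1.
  move=> k0; rewrite (power_diff_val_gt0 p_pr card_K beta0 (rational_place_neq_infinity c) k0).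
  by apply/asboolP/rational_place_gt0; exact: root_power_diff_one.
by rewrite !one.
Qed.

Lemma pred_pow_div k (t : Kx) : (t ^+ ((p ^ k).-1 %/ p.-1)) ^+ p.-1 = t ^+ (p ^ k).-1.
Proof. by rewrite -exprM divnK // predn_exp dvdn_mulr. Qed.

Let q_gt_ph : (0 < q - p ^ h)%N.
Proof. by rewrite subn_gt0 ltn_exp2l // -addSnnS ltn_addr. Qed.

Let ph_pred_gt0 : (0 < (p ^ h).-1)%N.
Proof. by rewrite -ltnS prednK ?expn_gt0 ?p_gt0 // -(exp1n h) ltn_exp2r. Qed.

Lemma curve_fun_at_root c : root (g 1) c -> exists2 s : Kx, s != 0 &
  vge (rational_place c) 1 (f / s ^+ p.-1 + 1).
Proof.
move=> c1; pose d : Kx := ((beta * c)%:P)%:F; pose t : Kx := u%:F - d.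
have dp : d ^+ p = d.
  have /eqP e : (beta * c) ^+ p == beta * c by move: c1; rewrite root_power_diff expn1.
  by rewrite /d -!rmorphXn e.
have te : t = (beta *: ('X - c%:P))%:F.
  by rewrite /t /d -rmorphB /uvar scalerBr polyCM mul_polyC.
have t0 : t != 0 by rewrite te tofrac_eq0 scaler_eq0 negb_or beta0 polyXsubC_eq0.
have tv : vge (rational_place c) 1 t.
  by rewrite te; apply/rational_place_gt0; rewrite rootZ // root_XsubC.
have gt0 : t ^+ (p ^ h) - t != 0.
  rewrite (frobenius_translate pchar_Kx _ _ dp) -tofrac_power_diff tofrac_eq0.
  exact: (power_diff_neq0 p_pr beta0 h_gt0).
(* Since p - 1 divides p^h - 1, the factor t^(p^h - 1) of f is a (p - 1)-th power. *)
exists (t ^+ ((p ^ h).-1 %/ p.-1)); first exact: (expf_neq0 _ t0).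
rewrite pred_pow_div curve_funE (field_curve_fun_translate _ pchar_Kx _ dp) -/t.
rewrite (field_curve_fun_zero p_gt1 pchar_Kx t0 gt0).
exact: (vge_geometric (pv (rational_place c))).
Qed.

Lemma curve_fun_at_infinity : exists2 s : Kx, s != 0 & vge inf 1 (f / s ^+ p.-1 + 1).
Proof.
have su : size u = 2%N by have := size_upow beta0 1; rewrite expr1.
have u0 : u != 0 by rewrite -size_poly_gt0 su.
have uF0 : u%:F != 0 by rewrite tofrac_eq0.
pose t : Kx := u%:F^-1; have t0 : t != 0 by rewrite invr_eq0.
have uE : u%:F = t^-1 by rewrite invrK.
have tv : vge inf 1 t by right; rewrite (valV (pv inf)) (place_at_infinity_tofrac u0) su opprK.
have gt0 : t^-1 ^+ (p ^ h) - t^-1 != 0.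
  by rewrite -uE -tofrac_power_diff tofrac_eq0 (power_diff_neq0 p_pr beta0 h_gt0).
(* The pole order q - p^h factors as p^h (p^(h+1) - 1), a multiple of p - 1. *)
exists ((u%:F ^+ ((p ^ h.+1).-1 %/ p.-1)) ^+ (p ^ h)); first exact: (expf_neq0 _ (expf_neq0 _ uF0)).
rewrite exprAC pred_pow_div -exprM.
have -> : (p ^ h * (p ^ h.+1).-1 = q - p ^ h)%N by rewrite -subn1 mulnBr muln1 -expnD.
rewrite curve_funE uE (field_curve_fun_infinity p_gt1 pchar_Kx t0 gt0).
exact: (vge_geometric (pv inf)).
Qed.

Lemma card_root_power_diff : #|[pred c | root (g 1) c]| = p.
Proof.
have g0 : g 1 != 0 by exact: (power_diff_neq0 p_pr beta0).
have sz : size (g 1) = p.+1 by rewrite (size_power_diff p_pr beta0) // expn1.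
apply/eqP; rewrite eqn_leq; apply/andP; split.
  rewrite cardE -ltnS -sz; apply: max_poly_roots => //; last exact: enum_uniq.
  by apply/allP => c; rewrite mem_enum.
(* The roots are the elements of the prime field divided by beta. *)
pose r (i : 'I_p) := i%:R / beta : K.
have rinj : injective r.
  move=> i j /(mulIf (invr_neq0 beta0)); wlog ij : i j / (i <= j)%N => [H|] e.
    by case: (leqP i j) => [/H|/ltnW /H H']; [exact | exact: esym (H' (esym e))].
  have : (p %| j - i)%N.
    by rewrite (dvdn_pcharf (pcharK p_pr card_K)) natrB // e subrr.
  move/dvdnP => [k]; have := ltn_ord j; move: ij; case: k => [|k] ij jp e'.
    by apply: ord_inj; lia.
  by move: e'; rewrite mulSn; lia.
rewrite -{1}(card_ord p) -(card_codom rinj); apply: subset_leq_card.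
apply/fintype.subsetP => c /codomP [i ->]; rewrite inE root_power_diff expn1 /r mulrC divfK //.
by rewrite -(pFrobenius_autE (pcharK p_pr card_K)) pFrobenius_aut_nat.
Qed.

(** Away from infinity x is integral at P, with constant residue c; then X - c vanishes at the
    restriction of P and determines it. *)
Lemma rational_restrict P : place_deg P = 1%N -> restrict P = inf \/ exists c, restrict P = rational_place c.
Proof.
move=> P1; have [b_tot b_totP] := totally_ramified_place_exists.
have [|binf] := eqVneq (restrict P) inf; [by left | right].
have x0 : ('X : {poly K})%:F != 0 by rewrite tofrac_eq0 polyX_eq0.
have xP : vge P 0 (('X : {poly K})%:F%:A : L).
  apply/vge_alg; right; rewrite mulr_ge0 ?(ltW (ramification_gt0 P)) //.
  by rewrite leNgt; apply: contra binf => /base_place_infinity ->.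
have [c Hc] := residue_constant card_n f0 y_pow y_gen b_totP (@base_residue K) P1 xP.
exists c; apply: (finite_place_uniq _ binf).
have e : ('X : {poly K})%:F%:A - iota c = (('X - c%:P)%:F)%:A :> L.
  by rewrite rmorphB scalerBl.
rewrite e in Hc; have [/eqP|] := (vge_alg P 1 _).1 Hc.
  by rewrite tofrac_eq0 polyXsubC_eq0.
by rewrite -gtz0_ge1 (pmulr_rgt0 _ (ramification_gt0 P)).
Qed.

Lemma card_set_seq (T : choiceType) (s : seq T) : uniq s -> [set x | x \in s] #= `I_(size s).
Proof.
move=> us; have -> : [set x | x \in s] = [set` [fset x in s]%fset].
  by apply/seteqP; split=> x /=; rewrite inE.
by apply/card_eq_fsetP; rewrite card_fseq undup_id.
Qed.

Definition split_places := [seq rational_place c | c <- enum [pred c | ~~ root (g 1) c]].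
Definition ramified_places := inf :: [seq rational_place c | c <- enum [pred c | root (g 1) c]].

Lemma size_split_places : size split_places = (q - p)%N.
Proof.
rewrite size_map -cardE -card_K -(cardC [pred c | root (g 1) c]) card_root_power_diff addKn.
by apply: eq_card => c; rewrite !inE.
Qed.

Lemma size_ramified_places : size ramified_places = p.+1.
Proof. by rewrite /= size_map -cardE card_root_power_diff. Qed.

Lemma curve_places_uniq : uniq (split_places ++ ramified_places).
Proof.
have ninf s : inf \notin [seq rational_place c | c <- s].
  by apply/mapP => -[c _ /eqP]; rewrite eq_sym (negPf (rational_place_neq_infinity c)).
rewrite cat_uniq /= !map_inj_uniq ?enum_uniq; try exact: rational_place_inj.
rewrite ninf /= negb_or ninf /= andbT; apply/hasPn => _ /mapP [c cr ->].
rewrite (mem_map rational_place_inj) mem_enum inE negbK.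
by move: cr; rewrite mem_enum.
Qed.

Lemma rational_restrict_curve P : place_deg P = 1%N -> restrict P \in split_places ++ ramified_places.
Proof.
move=> /rational_restrict [->|[c ->]]; rewrite mem_cat inE ?eqxx ?orbT //.
rewrite !(mem_map rational_place_inj) !mem_enum !inE.
by case: (root _ c); rewrite ?orbT.
Qed.

Lemma split_places_fiber b : b \in split_places ->
  size (fiber L b) = n /\ (forall P, restrict P = b -> place_deg P = 1%N).
Proof.
move=> /mapP [c]; rewrite mem_enum inE => c1 ->.
have [b_tot b_totP] := totally_ramified_place_exists.
exact: (split_fiber card_n f0 y_pow y_gen b_totP (@base_residue K) (rational_place_deg c) (curve_fun_split c1)).
Qed.

Lemma ramified_placesP b : b \in ramified_places -> [/\ place_deg b = 1%N, ram_gcd f n b = p.-1 &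
  exists2 s : Kx, s != 0 & vge b 1 (f / s ^+ p.-1 + 1)].
Proof.
rewrite inE => /orP [/eqP ->|/mapP [c]].
  by split; [exact: place_at_infinity_deg | exact: ram_gcd_infinity | exact: curve_fun_at_infinity].
rewrite mem_enum inE => c1 ->.
by split; [exact: rational_place_deg | exact: rational_place_ramified | exact: curve_fun_at_root].
Qed.

Lemma rational_points_fibers (S : seq (place iota0)) : uniq S ->
  (forall P, place_deg P = 1%N <-> restrict P \in S) ->
  rational_points iota #= `I_(\sum_(b <- S) size (fiber L b)).
Proof.
move=> Su HS; have := card_set_seq (flatten_fiber_uniq L Su).
have -> : [set x | x \in flatten [seq fiber L b | b <- S]] = rational_points iota.
  apply/seteqP; split=> P /=.
    by move/flatten_mapP => [b bS]; rewrite mem_fiber => /eqP e; apply/HS; rewrite e.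
  by move/HS => PS; apply/flatten_mapP; exists (restrict P); rewrite // mem_fiber.
by rewrite size_flatten /shape -map_comp sumnE big_map.
Qed.

Lemma sum_split_fibers : (\sum_(b <- split_places) size (fiber L b) = n * (q - p))%N.
Proof.
rewrite -size_split_places (eq_big_seq (fun=> n)) => [|b /split_places_fiber []] //.
by rewrite big_const_seq count_predT iter_addn_0.
Qed.

Lemma card_rational_points_odd : odd p -> rational_points iota #= `I_(n * (q - p)).
Proof.
move=> p_odd; rewrite -sum_split_fibers; apply: rational_points_fibers.
  by have := curve_places_uniq; rewrite cat_uniq => /and3P [].
move=> P; split=> [P1|/split_places_fiber [_]]; last exact.
have := rational_restrict_curve P1; rewrite mem_cat => /orP [//|/ramified_placesP [_ _ [s s0 Hs]]].
have [b_tot b_totP] := totally_ramified_place_exists.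
(* w = (q - 1)/(p - 1) is a sum of 2h + 1 odd terms, hence odd; the parity of m enters here. *)
pose w := (\sum_(i < h + h.+1) p ^ i)%N.
have nw : n = (p.-1 * w)%N by rewrite predn_exp.
have w_odd : odd w.
  have H k : odd (\sum_(i < k) p ^ i)%N = odd k.
    by elim: k => [|k IH]; rewrite ?big_ord0 // big_ord_recr oddD IH oddX p_odd orbT addbT.
  by rewrite H oddD /= addbN addbb.
have N1 : (-1 : K) != 1.
  rewrite eq_sym -addr_eq0 -mulr2n -(dvdn_pcharf (pcharK p_pr card_K)).
  by rewrite dvdn_prime2 //; apply: contraTneq p_odd => ->.
by have := no_rational_above card_n f0 y_pow y_gen b_totP (@base_residue K) s0 nw w_odd N1 Hs; rewrite P1 eqxx.
Qed.

Lemma card_rational_points_two : p = 2%N -> rational_points iota #= `I_(n * (q - p) + 3).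
Proof.
move=> p2; have [b_tot b_totP] := totally_ramified_place_exists.
have ram b : b \in ramified_places ->
    size (fiber L b) = 1%N /\ (forall P, restrict P = b -> place_deg P = 1%N).
  move=> /ramified_placesP [b1 br _].
  apply: (totally_ramified_fiber card_n f0 y_pow y_gen b_totP (@base_residue K) b1).
  by rewrite br p2.
(* For p = 2 there are p + 1 = 3 ramified places, each totally ramified because p - 1 = 1, and each
   carries one rational place. *)
have -> : (n * (q - p) + 3 = \sum_(b <- split_places ++ ramified_places) size (fiber L b))%N.
  rewrite big_cat sum_split_fibers /=; congr addn.
  rewrite (eq_big_seq (fun=> 1%N)) => [|b /ram []] //.
  by rewrite big_const_seq count_predT iter_addn_0 mul1n size_ramified_places p2.
apply: rational_points_fibers; first exact: curve_places_uniq.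
move=> P; split=> [|]; first exact: rational_restrict_curve.
by rewrite mem_cat => /orP [/split_places_fiber|/ram] [_]; exact.
Qed.

End CurvePlaces.

(** * Reduction of the given equation to the normal form in u = b x *)

Section CurveEquation.

(** Passing to u = b x multiplies u^(p^(h+1)) - u by b^(p^(h+1)), whose p^h-th power is b^q = b;
    this cancels the factor b of the denominator. *)
Lemma field_curve_fun_scale (F : fieldType) (p h : nat) (b x : F) :
  (0 < p)%N -> b != 0 -> b ^+ (p ^ (h + h.+1)) = b ->
  let a := b ^+ (p ^ h - 1) in
  - ((x ^+ (p ^ h.+1) - a ^+ (p ^ h.+1) * x) ^+ (p ^ h) / (a * x ^+ (p ^ h) - x)) =
  field_curve_fun p h (b * x).
Proof.
move=> p0 b0 bq a; have P0 : (0 < p ^ h)%N by rewrite expn_gt0 p0.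
have aP : b * a = b ^+ (p ^ h) by rewrite -exprS subn1 prednK.
have aP' : b ^+ (p ^ h.+1) * a ^+ (p ^ h.+1) = b by rewrite -exprMn aP -exprM -expnD.
move: aP aP'; move: a => {}a aP aP'; rewrite /field_curve_fun !exprMn.
have -> : b ^+ (p ^ h.+1) * x ^+ (p ^ h.+1) - b * x =
    b ^+ (p ^ h.+1) * (x ^+ (p ^ h.+1) - a ^+ (p ^ h.+1) * x) by rewrite -{2}aP'; ring.
have -> : b ^+ (p ^ h) * x ^+ (p ^ h) - b * x = b * (a * x ^+ (p ^ h) - x) by rewrite -aP; ring.
by rewrite exprMn -exprM -expnD addnC bq -mulf_div divff // mul1r.
Qed.

Variables (K : finFieldType) (p h : nat) (b : K).
Hypotheses (p_pr : prime p) (card_K : #|K| = (p ^ (h + h.+1))%N) (b0 : b != 0).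

Lemma curve_rhsE : curve_rhs p (h + h.+1) (b ^+ (p ^ h - 1)) = curve_fun p h b.
Proof.
pose B := base_constants K b.
have B0 : B != 0 by rewrite fmorph_eq0.
have Bq : B ^+ (p ^ (h + h.+1)) = B by rewrite -rmorphXn (frob_card card_K).
rewrite /curve_rhs (_ : (h + h.+1 - 1) %/ 2 = h)%N; last by lia.
rewrite (_ : (h + h.+1 + 1) %/ 2 = h.+1)%N; last by lia.
rewrite curve_funE (_ : (uvar b)%:F = B * ('X%:F)); last by rewrite /uvar -mul_polyC rmorphM.
rewrite -(field_curve_fun_scale _ (prime_gt0 p_pr) B0 Bq).
rewrite (_ : ((b ^+ (p ^ h - 1))%:P)%:F = B ^+ (p ^ h - 1)) //.
exact: (rmorphXn (base_constants K)).
Qed.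

End CurveEquation.

Theorem mainTheorem3 (p m q : nat) (K : finFieldType) (a : K)
    (L : fieldExtType {fraction {poly K}}) (y : L)
    (p_prime : prime p) (m_ge3 : (3 <= m)%N) (m_odd : odd m)
    (q_def : q = (p ^ m)%N) (card_K : #|K| = q)
    (a_neq0 : a != 0)
    (a_power : exists2 b : K, b != 0 & a = b ^+ (p ^ ((m - 1) %/ 2) - 1))
    (y_gen : <<1%VS; y>>%VS = fullv)
    (y_eq : y ^+ (q - 1) = (curve_rhs p m a)%:A) :
  ((genus (constants L))%:~R : rat) =
    1 / 2 * (((p ^ ((m + 1) %/ 2))%:R + (p ^ ((m - 1) %/ 2))%:R - p%:R - 1)
               * (q%:R - 2) - p%:R ^+ 2 + p%:R + 2)
  /\ (odd p -> rational_points (constants L) #= `I_((q - 1) * (q - p)))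
  /\ (p = 2%N -> rational_points (constants L) #= `I_((q - 1) * (q - p) + 3)).
Proof.
pose h := ((m - 1) %/ 2)%N.
have m_eq : m = (h + h.+1)%N by rewrite /h; lia.
have h_gt0 : (0 < h)%N by rewrite /h; lia.
have -> : ((m + 1) %/ 2 = h.+1)%N by rewrite /h; lia.
case: a_power => b b0; rewrite -/h => a_eq.
subst q a; rewrite m_eq in card_K y_eq *; rewrite subn1 (curve_rhsE p_prime card_K b0) in y_eq.
rewrite subn1; split; last split.
- have := curve_genus p_prime h_gt0 card_K b0 y_eq y_gen.
  rewrite -[ext_constants _ _]/(constants L); move: (genus _) => G.
  rewrite predn_int ?expn_gt0 ?prime_gt0 // => H.
  have {H} := congr1 (fun z : int => z%:~R : rat) H.
  rewrite !(rmorphD, rmorphM, rmorphN, rmorphB, rmorphXn) /= !pmulrn => H.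
  lra.
- exact: (card_rational_points_odd p_prime h_gt0 card_K b0 y_eq y_gen).
- exact: (card_rational_points_two p_prime h_gt0 card_K b0 y_eq y_gen).
Qed.
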